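(* Let $D$ be a complex set satisfying $\overline{\log dens}\{r=|z| : z\in D\}>0$ and let $A_0(z),A_1(z),\dots,A_k(z)$ be entire functions of $(p,q)$-order satisfying $\max_{0\le j\le k}\{\rho_{A_j}(p,q)\}\le\rho$. If there exists an integer $l$ $(0\le l\le k)$ such that for some constants $a,b$ $(0\le b<a)$ and $\delta$ $(0<\delta<\rho)$ sufficiently small with $$|A_l(z)|\ge \exp_p\left[a\{\log_{q-1}(r)\}^{\rho-\delta}\right],$$ $$|A_j(z)|\le \exp_p\left[b\{\log_{q-1}(r)\}^{\rho-\delta}\right],\quad j=0,1,\dots,k,\ j\ne l,$$ as $z\to\infty$ for $z\in D$ (where $r=|z|$), then every meromorphic solution $f\ (\not\equiv 0)$ of the equation $$A_k(z)f(z+c_k)+A_{k-1}(z)f(z+c_{k-1})+\cdots+A_1(z)f(z+c_1)+A_0(z)f(z)=0$$ satisfies: (i) $\rho_f\ge\rho_{A_l}+1$, for $p=1$, $q=1$; (ii) $\rho_f(p,q)\ge\rho_{A_l}(p,q)$, for $p\ge q\ge 2$.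
   Context: Meromorphic means meromorphic in $\mathbb{C}$; $T(r,f)$ is the Nevanlinna characteristic and $M(r,f)$ the maximum modulus. Iterated exponentials and logarithms: $\exp_1 r=e^r$, $\exp_{n+1}r=\exp(\exp_n r)$, $\log_1 r=\log r$, $\log_{n+1}r=\log(\log_n r)$ for sufficiently large $r$, and $\exp_0 r=\log_0 r=r$, $\exp_{-1}r=\log_1 r$, $\log_{-1}r=\exp_1 r$. The $(p,q)$-order (for integers $p\ge q\ge1$ or $2\le q=p+1$) of a transcendental meromorphic function $f$ is $\rho_f(p,q)=\limsup_{r\to\infty}\frac{\log_p T(r,f)}{\log_q r}$; if $f$ is transcendental entire, $\rho_f(p,q)=\limsup_{r\to\infty}\frac{\log_{p+1}M(r,f)}{\log_q r}$. For a rational function $\rho_f(p,q)=0$. In (i), $\rho_f$ and $\rho_{A_l}$ denote the usual orders $\rho_f(1,1)$ and $\rho_{A_l}(1,1)$. The logarithmic measure of $S\subset(1,\infty)$ is $lm(S)=\int_1^\infty\frac{\chi_S(t)}{t}dt$, where $\chi_S$ is the characteristic function of $S$, and the upper logarithmic density is $\overline{\log dens}\,S=\limsup_{r\to\infty}\frac{lm(S\cap[1,r])}{\log r}$. Standing assumptions on the equation: $k\ge2$, the coefficients $A_0,\dots,A_k$ are not identically zero, and $c_1,\dots,c_k$ are distinct nonzero complex numbers. *)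

(* Defs.v *)
From HB Require Import structures.
From mathcomp Require Import all_boot all_order all_algebra.
From mathcomp Require Import complex.
From mathcomp Require Import all_classical all_reals all_analysis.

Set Implicit Arguments.
Unset Strict Implicit.
Unset Printing Implicit Defensive.

Import Order.TTheory GRing.Theory Num.Theory.
Import numFieldNormedType.Exports.
Import ComplexField.Normc.

Local Open Scope classical_set_scope.
Local Open Scope ring_scope.
Local Open Scope complex_scope.

(* Only indices n >= 0 are needed; the value of [log_ n x] is meaningful for
   x large, since [ln] is 0 on nonpositive reals. *)
Definition exp_ (R : realType) (n : nat) (x : R) : R := iter n (@expR R) x.
Definition log_ (R : realType) (n : nat) (x : R) : R := iter n (@ln R) x.

Definition log_plus (R : realType) (x : R) : R := Num.max 0 (ln x).

Section Meromorphic.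
Context {R : realType}.
Implicit Types (f : R[i] -> R[i]) (z w : R[i]) (r t : R).

(* Derivability over the scalar field R[i], i.e. complex differentiability. *)
Definition holomorphic_at f z : Prop :=
  \forall w \near (z : R[i]^o), derivable (f : R[i]^o -> R[i]^o) w 1.

Definition entire f : Prop := forall z, holomorphic_at f z.

Definition is_pole f z : Prop :=
  (\forall w \near (z : R[i]^o)^', derivable (f : R[i]^o -> R[i]^o) w 1) /\
  normc (f w) @[w --> (z : R[i]^o)^'] --> +oo.

(* A meromorphic function in C is a total function whose values at its poles
   are irrelevant; removable singularities are assumed to be removed. *)
Definition meromorphic f : Prop :=
  forall z, holomorphic_at f z \/ is_pole f z.

Definition not_identically_zero f : Prop :=
  exists z, holomorphic_at f z /\ f z != 0.

(* Multiplicity of the pole z: the n such that (w - z)^n f(w) has a finite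
   nonzero limit at z. *)
Definition pole_order f z : nat :=
  xget 0%N [set n : nat | exists2 l : R[i]^o, l != 0 &
    ((w - z) ^+ n * f w : R[i]^o) @[w --> (z : R[i]^o)^'] --> l].

Definition rational_function f : Prop :=
  exists P Q : {poly R[i]}, Q != 0 /\
    forall z, Q.[z] != 0 -> f z = P.[z] / Q.[z].

(* Poles in the closed disc of radius t, counted with multiplicity; the sum
   has finite support when f is meromorphic. *)
Definition pole_count f t : nat :=
  (\sum_(z \in [set z | is_pole f z /\ (normc z <= t)%R]) pole_order f z)%N.

Definition proximity f r : R :=
  (2 * pi)^-1 *
  \int[lebesgue_measure]_(theta in `[0, 2 * pi])
    log_plus (normc (f ((r * cos theta) +i* (r * sin theta)))).

Definition counting_integral f r : R :=
  \int[lebesgue_measure]_(t in `]0, r])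
    (((pole_count f t)%:R - (pole_count f 0)%:R) / t)
  + (pole_count f 0)%:R * ln r.

Definition nevanlinna_T f r : R := proximity f r + counting_integral f r.

(* The (p,q)-order, valued in the extended reals. *)
Definition pq_order (p q : nat) f : \bar R :=
  if `[< rational_function f >] then 0%E
  else limf_esup (fun r : R => (log_ p (nevanlinna_T f r) / log_ q r)%:E) +oo.

End Meromorphic.

Section LogDensity.
Context {R : realType}.
Implicit Type S : set R.

(* For a non-measurable S this is the inner logarithmic measure, the integral
   of a nonnegative function being the supremum over simple minorants. *)
Definition log_measure S : \bar R :=
  (\int[lebesgue_measure]_(t in `[1%R, +oo[) (\1_S t / t)%:E)%E.

Definition upper_log_density S : \bar R :=
  limf_esup (fun r : R => (log_measure (S `&` `[1%R, r]) * ((ln r)^-1)%:E)%E) +oo.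

End LogDensity.

(* Main.v *)
Require Import Defs.
From HB Require Import structures.
From mathcomp Require Import all_boot all_order all_algebra.
From mathcomp Require Import complex.
From mathcomp Require Import all_classical all_reals all_analysis.
From mathcomp Require Import measurable_realfun.
From mathcomp Require Import ring lra.

Set Implicit Arguments.
Unset Strict Implicit.
Unset Printing Implicit Defensive.

Import Order.TTheory GRing.Theory Num.Theory.
Import numFieldNormedType.Exports.
Import ComplexField.Normc.

Local Open Scope classical_set_scope.
Local Open Scope ring_scope.
Local Open Scope complex_scope.

(** Write the equation as a vanishing sum of the terms A_j(z) f(z + c_j), with
    c_0 = 0.  On D the coefficient A_l is enormous compared with the others, so
    some quotient f(z + c_j) / f(z + c_l) has to be enormous as well
    ([dominant_term_bound]); the proof bounds such quotients by the
    characteristic T of f, at suitable points of D, and concludes that T is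
    large.

    The quotients are bounded pointwise.  On a circle of radius R that carries
    no zero or pole, divide f by the Blaschke factors of its zeros and poles:
    the result is zero-free, has the modulus of f on the circle, and the
    gradient of the logarithm of its modulus is at most 16 / R times the mean
    of |log |f|| over the circle ([ln_normc_diff]).  Each Blaschke factor
    contributes the inverse of the distance from z to a zero or a pole
    ([ln_normc_f_diff]).  Jensen's formula ([jensen]) controls by T both the
    mean of |log |f|| and the number of zeros and poles ([nevanlinna_bounds],
    [count_specials]).  It remains to keep |z| away from the finitely many
    radii to which the zeros and poles correspond.  By Markov's inequality the
    sum of the inverse distances from r to N given points is of order
    N^(1 + tau) / B, for all r in [B, 2B] outside a set of measure d B
    ([radial_exceptional]); and since the radii of D have positive upper
    logarithmic density, they avoid such exceptional sets at arbitrarily large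
    scales B ([pos_density]).  Hence D has points at which the logarithms of
    the quotients are O((1 + T)^(1 + tau) / B), with T taken at radii at most
    19 B ([good_point]).

    Taking one logarithm of the growth conditions, the equation now yields, with
    X = (log_(q-1) |z|)^(rho - delta),
      exp_(p-1)(a X) <= K + exp_(p-1)(b X) + C (1 + T)^(1 + tau) / B
    ([equation_growth]).  When p = q = 1, X is |z|^(rho - delta), and the
    division by B ~ |z| gains a whole order: the order of T is at least
    rho - delta + 1, up to tau ([order_contradiction]).  When q >= 2 the factor
    1 / B is invisible on the scale of the iterated logarithms, and the
    (p,q)-order of T is at least rho - delta ([pq_order_contradiction]).  As
    delta is arbitrarily small and the order of A_l is at most rho, both claims
    follow.  A rational f, whose order is 0 by convention, is impossible, since
    the quotients of its shifts are bounded far from the origin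
    ([rational_shift]).

    All the complex analysis rests on Cauchy's formula for a function that is
    complex differentiable on a closed disc.  The closed form g(w) dw / (w - z)
    is integrated over the homotopy that contracts a circle to the point z,
    parametrized by a rectangle to which Goursat's subdivision applies
    ([goursat], [cauchy_formula]).  The formula gives the factorization
    (w - z)^m h(w), with h zero-free, of a meromorphic function near each point
    ([local_factor], [mero_local_form]), from which zeros, poles and their
    orders are read off. *)

(** * Complex modulus and complex derivative *)

(** The form in which derivatives enter the integral estimates, with [K] the
    real or the complex field. *)
Lemma is_derive_eps (K : numFieldType) (f : K^o -> K^o) (x l : K^o) :
  is_derive x 1 f l <-> (forall e : K, 0 < e -> exists2 d : K, 0 < d &
   forall h : K, `|h| < d -> `|f (x + h) - f x - l * h| <= e * `|h|).
Proof.
split=> [[df dl] e e0|H].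
  have : (h^-1 *: ((f \o shift x) (h *: (1:K^o)) - f x) : K^o) @[h --> (0:K)^'] --> l.
    by rewrite -dl; exact: df.
  move/cvgrPdist_le => /(_ e e0); rewrite near_withinE /prop_near1.
  move=> /nbhs_ballP[d d0 Hd]; exists d => // h hd.
  have [->|h0] := eqVneq h 0; first by rewrite addr0 subrr mulr0 subr0 normr0 mulr0.
  have := Hd h; rewrite /ball /= sub0r normrN => /(_ hd h0) /=.
  rewrite /GRing.scale /= mulr1 => H.
  have -> : f (x + h) - f x - l * h = - ((l - h^-1 * (f (h + x) - f x)) * h).
    by rewrite mulrBl mulrAC mulVf // mul1r opprB [h + x]addrC.
  by rewrite normrN normrM ler_wpM2r.
have C : (h^-1 *: ((f \o shift x) (h *: (1:K^o)) - f x) : K^o) @[h --> (0:K)^'] --> l.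
  apply/cvgrPdist_le => e e0; rewrite near_withinE /prop_near1.
  have [d d0 Hd] := H e e0; apply/nbhs_ballP; exists d => //= h.
  rewrite /ball /= sub0r normrN => hd h0.
  rewrite /GRing.scale /= mulr1.
  have := Hd h hd.
  have -> : f (x + h) - f x - l * h = - ((l - h^-1 * (f (h + x) - f x)) * h).
    by rewrite mulrBl mulrAC mulVf // mul1r opprB [h + x]addrC.
  by rewrite normrN normrM ler_pM2r ?normr_gt0.
apply: DeriveDef; first by apply/cvg_ex; exists l.
exact: (cvg_lim (@norm_hausdorff _ _) C).
Qed.

Section ComplexNorm.
Context {R : realType}.
Implicit Types (z w : R[i]) (x y : R).

Lemma normc_ge0 z : 0 <= normc z.
Proof. by case: z => a b; exact: sqrtr_ge0. Qed.

Lemma normcD z w : normc (z + w) <= normc z + normc w.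
Proof. exact: (@le_normcD R z w). Qed.

Lemma normc_opp z : normc (- z) = normc z.
Proof. exact: (@normcN R z). Qed.

Lemma normcB z w : normc (z - w) <= normc z + normc w.
Proof. by rewrite -(normc_opp w) normcD. Qed.

Lemma normc_distC z w : normc (z - w) = normc (w - z).
Proof. by rewrite -normc_opp opprB. Qed.

Lemma normc_distD z u w : normc (z - w) <= normc (z - u) + normc (u - w).
Proof. by rewrite (_ : z - w = (z - u) + (u - w)) ?normcD // addrA subrK. Qed.

Lemma normc_triB z w : normc z - normc w <= normc (z - w).
Proof. by rewrite lerBlDr -{1}(subrK w z) normcD. Qed.

Lemma normc_eq0 z : (normc z == 0) = (z == 0).
Proof.
by apply/eqP/eqP => [/eq0_normc//|->]; rewrite normc0.
Qed.

Lemma normc_gt0 z : (0 < normc z) = (z != 0).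
Proof. by rewrite lt_def normc_eq0 normc_ge0 andbT. Qed.

Lemma normcX z n : normc (z ^+ n) = normc z ^+ n.
Proof. by elim: n => [|n IH]; rewrite ?normc1 // !exprS normcM IH. Qed.

Lemma normc_real x : normc (x%:C) = `|x|.
Proof. by rewrite /normc /= expr0n /= addr0 sqrtr_sqr. Qed.

Lemma normc_conj z : normc (z^*)%C = normc z.
Proof. by case: z => a b; rewrite /= sqrrN. Qed.

Lemma normc_Re z : `|complex.Re z| <= normc z.
Proof.
case: z => a b /=; rewrite -sqrtr_sqr ler_sqrt ?addr_ge0 ?sqr_ge0 //.
by rewrite lerDl sqr_ge0.
Qed.

Lemma normc_Im z : `|complex.Im z| <= normc z.
Proof.
case: z => a b /=; rewrite -sqrtr_sqr ler_sqrt ?addr_ge0 ?sqr_ge0 //.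
by rewrite lerDr sqr_ge0.
Qed.

Lemma normc_le_ReIm z : normc z <= `|complex.Re z| + `|complex.Im z|.
Proof.
case: z => a b /=; rewrite -[leRHS]ger0_norm ?addr_ge0 // -sqrtr_sqr.
rewrite ler_sqrt ?sqr_ge0 // sqrrD !real_normK ?num_real //.
by rewrite -addrA lerD2l lerDr mulrn_wge0 ?mulr_ge0.
Qed.

Lemma sqr_normcE z : normc z ^+ 2 = complex.Re z ^+ 2 + complex.Im z ^+ 2.
Proof. by case: z => a b /=; rewrite sqr_sqrtr ?addr_ge0 ?sqr_ge0. Qed.

Lemma cReM z w : complex.Re (z * w) =
  complex.Re z * complex.Re w - complex.Im z * complex.Im w.
Proof. by case: z; case: w. Qed.
Lemma cImM z w : complex.Im (z * w) =
  complex.Re z * complex.Im w + complex.Im z * complex.Re w.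
Proof. by case: z; case: w. Qed.
Lemma cReD z w : complex.Re (z + w) = complex.Re z + complex.Re w.
Proof. by case: z; case: w. Qed.
Lemma cImD z w : complex.Im (z + w) = complex.Im z + complex.Im w.
Proof. by case: z; case: w. Qed.
Lemma cReN z : complex.Re (- z) = - complex.Re z.
Proof. by case: z. Qed.
Lemma cImN z : complex.Im (- z) = - complex.Im z.
Proof. by case: z. Qed.
Lemma cReCM x z : complex.Re (x%:C * z) = x * complex.Re z.
Proof. by rewrite cReM /= mul0r subr0. Qed.
Lemma cImCM x z : complex.Im (x%:C * z) = x * complex.Im z.
Proof. by rewrite cImM /= mul0r addr0. Qed.

Lemma complex_ext z w :
  complex.Re z = complex.Re w -> complex.Im z = complex.Im w -> z = w.
Proof. by case: z; case: w => /= ? ? ? ? -> ->. Qed.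

(** The norm of [R[i]^o] takes values in R[i]; comparing two complex numbers
    forces their imaginary parts to agree, so its balls are those of the
    real-valued [normc]. *)
Lemma nbhs_normc z (P : R[i] -> Prop) :
  (\forall w \near (z : R[i]^o), P w) <->
  exists2 d : R, 0 < d & forall w, normc (w - z) < d -> P w.
Proof.
split.
- move=> /nbhs_ballP[d /=]; rewrite ltcE /= => /andP[/eqP d0 d1] H.
  exists (complex.Re d) => // w wz; apply: H.
  by rewrite /ball /= ltcE /= normc_distC wz d0 eqxx.
- move=> [d d0 H]; apply/nbhs_ballP; exists (d%:C) => /=.
    by rewrite ltcE /= eqxx.
  move=> w; rewrite /ball /= ltcE /= eqxx /= => wz; apply: H.
  by rewrite normc_distC.
Qed.

Lemma dnbhs_normc z (P : R[i] -> Prop) :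
  (\forall w \near (z : R[i]^o)^', P w) <->
  exists2 d : R, 0 < d & forall w, normc (w - z) < d -> w != z -> P w.
Proof. by rewrite near_withinE /prop_near1; exact: nbhs_normc. Qed.

End ComplexNorm.

Section ComplexDerivative.
Context {R : realType}.
Implicit Types (f g : R[i] -> R[i]) (z w d : R[i]).

Definition has_cderiv g w d := is_derive (w : R[i]^o) 1 (g : R[i]^o -> R[i]^o) d.

Lemma cderivE g w d : has_cderiv g w d <->
  (forall e : R, 0 < e -> exists2 r : R, 0 < r &
    forall h, normc h < r -> normc (g (w + h) - g w - d * h) <= e * normc h).
Proof.
rewrite /has_cderiv is_derive_eps; split=> H e.
- move=> e0; have [|r] := H (e%:C); first by rewrite ltcE /= eqxx.
  rewrite ltcE /= => /andP[/eqP r0 r1] Hr; exists (complex.Re r) => // h hr.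
  have := Hr h; rewrite ltcE /= r0 eqxx hr => /(_ isT).
  by rewrite lecE => /andP[_]; rewrite cReCM.
- case: e => e ei; rewrite ltcE /= => /andP[/eqP -> e1].
  have [r r0 Hr] := H _ e1; exists (r%:C); first by rewrite ltcE /= eqxx.
  move=> h; rewrite ltcE /= eqxx /= => /Hr; rewrite lecE /=.
  by rewrite !mul0r mulr0 addr0 subr0 eqxx.
Qed.

Lemma cderiv_cst c w : has_cderiv (fun=> c) w 0.
Proof. exact: is_derive_cst. Qed.
Lemma cderiv_id w : has_cderiv id w 1.
Proof. exact: is_derive_id. Qed.
Lemma cderivB f g w a b : has_cderiv f w a -> has_cderiv g w b ->
  has_cderiv (fun z => f z - g z) w (a - b).
Proof. by move=> *; exact: is_deriveB. Qed.
Lemma cderivM f g w a b : has_cderiv f w a -> has_cderiv g w b ->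
  has_cderiv (fun z => f z * g z) w (a * g w + f w * b).
Proof.
move=> fa gb; have := @is_deriveM _ _ (f : R[i]^o -> R[i]) (g : R[i]^o -> R[i]) _ _ _ _ fa gb.
by rewrite addrC /GRing.scale /= [a * _]mulrC.
Qed.
Lemma cderivV f w a : f w != 0 -> has_cderiv f w a ->
  has_cderiv (fun z => (f z)^-1) w (- (f w) ^- 2 * a).
Proof.
move=> f0 [df <-]; apply: DeriveDef; first exact: derivableV.
exact: (@deriveV _ _ (f : R[i]^o -> R[i]) _ _ f0 df).
Qed.

Lemma cderiv_inv w : w != 0 -> has_cderiv (fun z => z^-1) w (- w ^- 2).
Proof. by move=> w0; have := @cderivV id w 1 w0 (cderiv_id w); rewrite mulr1. Qed.

Lemma cderiv_unique g w a b : has_cderiv g w a -> has_cderiv g w b -> a = b.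
Proof. by move=> [_ <-] [_ <-]. Qed.

Lemma cderiv_near f g w d (r : R) : 0 < r ->
  (forall z, normc (z - w) < r -> f z = g z) ->
  has_cderiv f w d -> has_cderiv g w d.
Proof.
move=> r0 fg /cderivE Hf; apply/cderivE => e /Hf[s s0 Hs].
exists (Num.min r s) => [|h]; first by rewrite lt_min r0.
rewrite lt_min => /andP[hr hs]; rewrite -!fg ?Hs //.
- by rewrite subrr normc0.
- by rewrite addrC addKr.
Qed.

End ComplexDerivative.

(** * Continuous and differentiable paths in the plane *)

Section Paths.
Context {R : realType}.
Implicit Types (f g : R[i] -> R[i]) (z w d : R[i]) (F G : R -> R[i]).

Lemma holE f z : holomorphic_at f z <-> exists2 r : R, 0 < r &
  forall w, normc (w - z) < r -> exists d, has_cderiv f w d.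
Proof.
rewrite /holomorphic_at nbhs_normc; split=> -[r r0 H]; exists r => // w /H.
- by move=> df; exists ('D_1 (f : R[i]^o -> R[i]^o) w); apply: DeriveDef.
- by move=> [d [df _]]; exact: df.
Qed.

Lemma cReJ z : complex.Re (z^*)%C = complex.Re z. Proof. by case: z. Qed.
Lemma cImJ z : complex.Im (z^*)%C = - complex.Im z. Proof. by case: z. Qed.

Definition ccont g w := forall e : R, 0 < e -> exists2 r : R, 0 < r &
  forall z, normc (z - w) < r -> normc (g z - g w) < e.

Lemma cderiv_ccont g w d : has_cderiv g w d -> ccont g w.
Proof.
move=> /cderivE H e e0; have [r r0 Hr] := H 1 ltr01.
exists (Num.min r (e / (normc d + 2))).
  by rewrite lt_min r0 divr_gt0 // ltr_wpDl // normc_ge0.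
move=> z; rewrite lt_min => /andP[zr ze].
have := Hr (z - w) zr; rewrite mul1r (_ : w + (z - w) = z); last by ring. move=> {}Hr.
rewrite ltr_pdivlMr in ze; last by rewrite ltr_wpDl // normc_ge0.
apply: le_lt_trans ze.
rewrite (_ : g z - g w = (g z - g w - d * (z - w)) + d * (z - w)); last by rewrite subrK.
rewrite (le_trans (normcD _ _)) // normcM.
by move: (normc_ge0 (z - w)) Hr; lra.
Qed.

Lemma cont_max (h k : R -> R) : continuous h -> continuous k ->
  continuous (fun t => Num.max (h t) (k t)).
Proof. by move=> ch ck t; exact: (continuous_max (ch t) (ck t)). Qed.

Lemma cont_min (h k : R -> R) : continuous h -> continuous k ->
  continuous (fun t => Num.min (h t) (k t)).
Proof. by move=> ch ck t; exact: (continuous_min (ch t) (ck t)). Qed.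

(** Stated on the two coordinates, to which the theory of real integrals
    applies. *)
Definition pcont F := continuous (fun t => complex.Re (F t)) /\
  continuous (fun t => complex.Im (F t)).

Lemma pcontE F : pcont F <-> forall t (e : R), 0 < e -> exists2 r : R, 0 < r &
  forall s, `|s - t| < r -> normc (F s - F t) < e.
Proof.
split=> [[HR HI] t e e0|H].
- have /cvgrPdist_lt/(_ (e/2)) := HR t; have e20 : 0 < e / 2 by rewrite divr_gt0.
  move=> /(_ e20) /nbhs_ballP[r1 /= r10 H1].
  have /cvgrPdist_lt/(_ (e/2)) := HI t => /(_ e20) /nbhs_ballP[r2 /= r20 H2].
  exists (Num.min r1 r2) => [|s]; first by rewrite lt_min r10.
  rewrite lt_min distrC => /andP[s1 s2].
  apply: le_lt_trans (normc_le_ReIm _) _; rewrite (splitr e) ltrD //.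
    by rewrite cReD cReN distrC; exact: H1.
  by rewrite cImD cImN distrC; exact: H2.
- split=> t; apply/cvgrPdist_lt => e e0; have [r r0 Hr] := H t e e0;
    apply/nbhs_ballP; exists r => //= s; rewrite /ball /= distrC => /Hr;
    apply: le_lt_trans; rewrite distrC.
    by rewrite -cReN -cReD normc_Re.
  by rewrite -cImN -cImD normc_Im.
Qed.

Lemma pcont_cst c : pcont (fun=> c).
Proof. by split; exact: cst_continuous. Qed.

Lemma pcont_real (f : R -> R) : continuous f -> pcont (fun t => (f t)%:C).
Proof. by split => //; exact: cst_continuous. Qed.

Lemma pcontD F G : pcont F -> pcont G -> pcont (fun t => F t + G t).
Proof.
move=> [F1 F2] [G1 G2]; split.
  under eq_fun do rewrite cReD; move=> t; apply: cvgD; [exact: F1|exact: G1].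
under eq_fun do rewrite cImD; move=> t; apply: cvgD; [exact: F2|exact: G2].
Qed.

Lemma pcontN F : pcont F -> pcont (fun t => - F t).
Proof.
move=> [F1 F2]; split.
  under eq_fun do rewrite cReN; move=> t; apply: cvgN; exact: F1.
under eq_fun do rewrite cImN; move=> t; apply: cvgN; exact: F2.
Qed.

Lemma pcontB F G : pcont F -> pcont G -> pcont (fun t => F t - G t).
Proof. by move=> hF hG; apply: pcontD => //; exact: pcontN. Qed.

Lemma pcontM F G : pcont F -> pcont G -> pcont (fun t => F t * G t).
Proof.
move=> [F1 F2] [G1 G2]; split.
  under eq_fun do rewrite cReM; move=> t; apply: cvgB; apply: cvgM;
    by [exact: F1|exact: G1|exact: F2|exact: G2].
under eq_fun do rewrite cImM; move=> t; apply: cvgD; apply: cvgM;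
  by [exact: F1|exact: G1|exact: F2|exact: G2].
Qed.

Lemma pcont_conj F : pcont F -> pcont (fun t => (F t)^*%C).
Proof.
move=> [F1 F2]; split.
  by under eq_fun do rewrite cReJ.
by under eq_fun do rewrite cImJ; move=> t; apply: cvgN; exact: F2.
Qed.

Lemma pcont_comp g F : (forall t, ccont g (F t)) -> pcont F ->
  pcont (fun t => g (F t)).
Proof.
move=> Hg /pcontE HF; apply/pcontE => t e e0.
have [r r0 Hr] := Hg t e e0; have [s s0 Hs] := HF t r r0.
by exists s => // u /Hs /Hr.
Qed.

Lemma ccontV z : z != 0 -> ccont (fun z => z^-1) z.
Proof.
move=> z0; apply: cderiv_ccont; exact: (cderivV z0 (cderiv_id z)).
Qed.

Lemma pcontV F : (forall t, F t != 0) -> pcont F -> pcont (fun t => (F t)^-1).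
Proof.
by move=> F0 HF; apply: (@pcont_comp (fun z => z^-1)) => // t; exact: ccontV.
Qed.

Lemma pcont_normc F : pcont F -> continuous (fun t => normc (F t)).
Proof.
move=> /pcontE H t; apply/cvgrPdist_lt => e e0; have [r r0 Hr] := H t e e0.
apply/nbhs_ballP; exists r => //= s; rewrite /ball /= distrC => /Hr.
apply: le_lt_trans; rewrite distrC.
rewrite real_ler_norml ?num_real // normc_triB andbT.
by rewrite lerNl opprB normc_distC normc_triB.
Qed.

Definition has_pderiv F (t : R) (d : R[i]) :=
  is_derive t 1 (fun s => complex.Re (F s)) (complex.Re d) /\
  is_derive t 1 (fun s => complex.Im (F s)) (complex.Im d).

Lemma pderivE F t d : has_pderiv F t d <->
  (forall e : R, 0 < e -> exists2 r : R, 0 < r &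
    forall h : R, `|h| < r -> normc (F (t + h) - F t - h%:C * d) <= e * `|h|).
Proof.
rewrite /has_pderiv !is_derive_eps; split=> [[H1 H2] e e0|H].
- have e20 : 0 < e / 2 by rewrite divr_gt0.
  have [r1 r10 Hr1] := H1 _ e20; have [r2 r20 Hr2] := H2 _ e20.
  exists (Num.min r1 r2) => [|h]; first by rewrite lt_min r10.
  rewrite lt_min => /andP[h1 h2]; apply: (le_trans (normc_le_ReIm _)).
  rewrite (splitr e) mulrDl lerD //.
    by rewrite !cReD !cReN cReCM mulrC; exact: Hr1.
  by rewrite !cImD !cImN cImCM mulrC; exact: Hr2.
- split=> e e0; have [r r0 Hr] := H e e0; exists r => // h /Hr;
    apply: le_trans; rewrite mulrC.
    by rewrite -cReCM -!cReN -!cReD normc_Re.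
  by rewrite -cImCM -!cImN -!cImD normc_Im.
Qed.

Lemma pderiv_chain g F t a d : has_cderiv g (F t) a -> has_pderiv F t d ->
  has_pderiv (fun s => g (F s)) t (a * d).
Proof.
move=> /cderivE Hg /pderivE HF; apply/pderivE => e e0.
have D0 : 0 < normc d + 1 + (normc a + 1) by rewrite addr_gt0 // ltr_wpDl // normc_ge0.
set e' := Num.min 1 (e / (normc d + 1 + (normc a + 1))).
have e'0 : 0 < e' by rewrite lt_min ltr01 divr_gt0.
have [r r0 Hr] := Hg e' e'0; have [s s0 Hs] := HF e' e'0.
have d10 : 0 < normc d + 1 by rewrite ltr_wpDl // normc_ge0.
exists (Num.min s (r / (normc d + 1))) => [|h]; first by rewrite lt_min s0 divr_gt0.
rewrite lt_min => /andP[hs hr]; have {}Hs := Hs h hs.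
have K : normc (F (t + h) - F t) <= (normc d + 1) * `|h|.
  rewrite -(subrK (h%:C * d) (F (t + h) - F t)) (le_trans (normcD _ _)) //.
  rewrite normcM normc_real mulrDl mul1r addrC [`|h| * _]mulrC lerD2l (le_trans Hs) //.
  by rewrite ler_piMl // ge_min lexx.
have := Hr (F (t + h) - F t).
rewrite (_ : F t + (F (t + h) - F t) = F (t + h)) => [Hk|]; last by ring.
have {}Hk : normc (g (F (t + h)) - g (F t) - a * (F (t + h) - F t)) <=
    e' * ((normc d + 1) * `|h|).
  apply: le_trans (Hk _) _; last by rewrite ler_wpM2l // ltW.
  by apply: (le_lt_trans K); rewrite mulrC -ltr_pdivlMr.
rewrite (_ : _ - _ - _ = (g (F (t + h)) - g (F t) - a * (F (t + h) - F t)) +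
   a * (F (t + h) - F t - h%:C * d)); last by ring.
rewrite (le_trans (normcD _ _)) // normcM.
apply: (@le_trans _ _ (e' * ((normc d + 1) * `|h|) + (normc a + 1) * (e' * `|h|))).
  by rewrite lerD // ler_pM ?normc_ge0 // lerDl.
rewrite (_ : _ + _ = e' * (normc d + 1 + (normc a + 1)) * `|h|); last by ring.
by rewrite ler_wpM2r // -ler_pdivlMr // ge_min lexx orbT.
Qed.

Lemma pderiv_cst c t : has_pderiv (fun=> c) t 0.
Proof. by split; exact: is_derive_cst. Qed.

Lemma pderivD F G t a b : has_pderiv F t a -> has_pderiv G t b ->
  has_pderiv (fun s => F s + G s) t (a + b).
Proof.
move=> [F1 F2] [G1 G2]; split.
  under eq_fun do rewrite cReD; rewrite cReD; exact: is_deriveD.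
under eq_fun do rewrite cImD; rewrite cImD; exact: is_deriveD.
Qed.

Lemma pderivM F G t a b : has_pderiv F t a -> has_pderiv G t b ->
  has_pderiv (fun s => F s * G s) t (a * G t + F t * b).
Proof.
move=> [F1 F2] [G1 G2]; split.
  under eq_fun do rewrite cReM; apply: is_derive_eq.
  by rewrite cReD !cReM /GRing.scale /=; ring.
under eq_fun do rewrite cImM; apply: is_derive_eq.
by rewrite cImD !cImM /GRing.scale /=; ring.
Qed.

Lemma pderiv_real (f : R -> R) (t a : R) : is_derive t 1 f a ->
  has_pderiv (fun s => (f s)%:C) t (a%:C).
Proof. by split => //=; exact: is_derive_cst. Qed.

Lemma pderiv_pcont F (D : R -> R[i]) : (forall t, has_pderiv F t (D t)) -> pcont F.
Proof.
move=> H; split=> t; have [H1 H2] := H t.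
  by apply: differentiable_continuous; apply/derivable1_diffP.
by apply: differentiable_continuous; apply/derivable1_diffP.
Qed.

Definition cis (t : R) : R[i] := cos t +i* sin t.

Arguments cis : simpl never.

Lemma normc_cis t : normc (cis t) = 1.
Proof. by rewrite /cis /= cos2Dsin2 sqrtr1. Qed.

Lemma cis_neq0 t : cis t != 0.
Proof. by rewrite -normc_gt0 normc_cis. Qed.

Lemma pderiv_cis t : has_pderiv cis t ('i * cis t).
Proof.
split; rewrite /cis /=.
  by rewrite mul0r mul1r sub0r; exact: is_derive_cos.
by rewrite mul0r mul1r add0r; exact: is_derive_sin.
Qed.

Lemma pcont_cis : pcont cis.
Proof. exact: (pderiv_pcont pderiv_cis). Qed.

Lemma cis0 : cis 0 = 1.
Proof. by rewrite /cis cos0 sin0. Qed.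

Lemma cis2pi : cis (2 * pi) = 1.
Proof. by rewrite /cis mulr_natl cos2pi sin2pi. Qed.

End Paths.

(** * Integrals over segments *)

Section Integrals.
Context {R : realType}.
Implicit Types (f g : R -> R) (F G : R -> R[i]) (a b c : R).

Notation mu := (@lebesgue_measure R).

Definition rint a b f : R := (\int[mu]_(x in `[a, b]) f x)%R.

Lemma cont_integrable a b f : continuous f ->
  mu.-integrable `[a, b] (EFin \o f).
Proof.
move=> cf; apply: continuous_compact_integrable; first exact: segment_compact.
exact: continuous_subspaceT.
Qed.

Lemma eq_rint a b f g : (forall t, a <= t <= b -> f t = g t) ->
  rint a b f = rint a b g.
Proof.
by move=> fg; apply: eq_Rintegral => t; rewrite inE /= in_itv /=; exact: fg.
Qed.

Lemma rintZ a b k f : continuous f -> rint a b (fun t => k * f t) = k * rint a b f.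
Proof. by move=> cf; apply: RintegralZl => //; exact: cont_integrable. Qed.

Lemma rintD a b f g : continuous f -> continuous g ->
  rint a b (fun t => f t + g t) = rint a b f + rint a b g.
Proof. by move=> cf cg; apply: RintegralD => //; exact: cont_integrable. Qed.

Lemma rintB a b f g : continuous f -> continuous g ->
  rint a b (fun t => f t - g t) = rint a b f - rint a b g.
Proof. by move=> cf cg; apply: RintegralB => //; exact: cont_integrable. Qed.

Lemma rint_le a b f g : continuous f -> continuous g ->
  (forall t, a <= t <= b -> f t <= g t) -> rint a b f <= rint a b g.
Proof.
move=> cf cg fg; apply: le_Rintegral => //; try exact: cont_integrable.
Qed.

Lemma rint_abs a b f : continuous f ->
  `|rint a b f| <= rint a b (fun t => `|f t|).
Proof. by move=> cf; apply: le_normr_Rintegral => //; exact: cont_integrable. Qed.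

Lemma rint_cst a b k : a <= b -> rint a b (fun=> k) = k * (b - a).
Proof.
by move=> ab; rewrite /rint Rintegral_cst //= lebesgue_measure_itv /= lte_fin;
   case: ltgtP ab => //= [->]; rewrite subrr.
Qed.

Lemma rint_split a c b f : a <= c -> c <= b -> continuous f ->
  rint a b f = rint a c f + rint c b f.
Proof.
move=> ac cb cf; apply/eqP; rewrite addrC -subr_eq; apply/eqP.
rewrite /rint Rintegral_itvB ?bnd_simp //; last exact: cont_integrable.
rewrite Rintegral_itv_obnd_cbnd //; apply: (integrableS _ _ _ (@cont_integrable c b f cf)) => //.
by move=> t; rewrite /= !in_itv /= => /andP[/ltW -> ->].
Qed.

Lemma rint_FTC a b f (F : R -> R) : a <= b -> continuous f ->
  (forall t : R, is_derive t 1 F (f t)) -> rint a b f = F b - F a.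
Proof.
rewrite le_eqVlt => /predU1P[->|ab] cf HF.
  by rewrite /rint set_itv1 Rintegral_set1 subrr.
rewrite /rint /Rintegral (@continuous_FTC2 R f F) //.
- exact: continuous_subspaceT.
- have cF : continuous F.
    by move=> t; apply: differentiable_continuous; apply/derivable1_diffP; case: (HF t).
  split; first by move=> t _; case: (HF t).
  + exact: cvg_at_right_filter (cF a).
  + exact: cvg_at_left_filter (cF b).
- by move=> t _; rewrite derive1E; case: (HF t).
Qed.

Definition cint a b F : R[i] :=
  rint a b (fun t => complex.Re (F t)) +i* rint a b (fun t => complex.Im (F t)).

Lemma eq_cint a b F G : (forall t, a <= t <= b -> F t = G t) ->
  cint a b F = cint a b G.
Proof. by move=> FG; congr (_ +i* _); apply: eq_rint => t /FG ->. Qed.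

Lemma cintD a b F G : pcont F -> pcont G ->
  cint a b (fun t => F t + G t) = cint a b F + cint a b G.
Proof.
move=> [F1 F2] [G1 G2]; rewrite /cint; apply: complex_ext; rewrite /= -rintD //;
  by apply: eq_rint => t _; rewrite ?cReD ?cImD.
Qed.

Lemma cintZ a b (c : R[i]) F : pcont F -> cint a b (fun t => c * F t) = c * cint a b F.
Proof.
move=> [F1 F2]; have cZ k f : continuous f -> continuous (fun t : R => k * f t).
  by move=> cf t; apply: cvgM; [exact: cvg_cst|exact: cf].
rewrite /cint; apply: complex_ext; rewrite ?cReM ?cImM /= -!rintZ //.
  rewrite -rintB; try exact: cZ.
  by apply: eq_rint => t _; rewrite cReM.
rewrite -rintD; try exact: cZ.
by apply: eq_rint => t _; rewrite cImM.
Qed.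

Lemma cintB a b F G : pcont F -> pcont G ->
  cint a b (fun t => F t - G t) = cint a b F - cint a b G.
Proof.
move=> hF hG; rewrite cintD //; last exact: pcontN.
congr (_ + _); rewrite -[RHS]mulN1r -cintZ //.
by apply: eq_cint => t _; rewrite mulN1r.
Qed.

Lemma cint_conj a b F : pcont F ->
  cint a b (fun t => ((F t)^*)%C) = ((cint a b F)^*)%C.
Proof.
move=> [F1 F2]; rewrite /cint /=; congr (_ +i* _).
  by apply: eq_rint => t _; rewrite cReJ.
rewrite -mulN1r -rintZ //; apply: eq_rint => t _; by rewrite cImJ mulN1r.
Qed.

Lemma cint_split a c b F : a <= c -> c <= b -> pcont F ->
  cint a b F = cint a c F + cint c b F.
Proof.
by move=> ac cb [F1 F2]; rewrite /cint (rint_split ac cb F1) (rint_split ac cb F2).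
Qed.

Lemma cint_cst a b k : a <= b -> cint a b (fun=> k) = (b - a)%:C * k.
Proof.
move=> ab; rewrite /cint !rint_cst //; apply: complex_ext.
  by rewrite cReCM /= mulrC.
by rewrite cImCM /= mulrC.
Qed.

Lemma cint_FTC a b F D : a <= b -> pcont D -> (forall t, has_pderiv F t (D t)) ->
  cint a b D = F b - F a.
Proof.
move=> ab [D1 D2] FD; rewrite /cint; apply: complex_ext.
  by rewrite cReD cReN /=; apply: (rint_FTC (F := fun t => complex.Re (F t))) => // t; case: (FD t).
by rewrite cImD cImN /=; apply: (rint_FTC (F := fun t => complex.Im (F t))) => // t; case: (FD t).
Qed.

(** The factor 2 is the price of estimating the real and imaginary parts
    separately; no sharp constant is ever needed. *)
Lemma normc_cint a b F g : pcont F -> continuous g ->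
  (forall t, a <= t <= b -> normc (F t) <= g t) ->
  normc (cint a b F) <= 2 * rint a b g.
Proof.
move=> [F1 F2] cg Fg; apply: (le_trans (normc_le_ReIm _)) => /=.
have cn f : continuous f -> continuous (fun t : R => `|f t|).
  by move=> cf t; apply: cvg_norm; exact: cf.
rewrite mulr_natl mulr2n; apply: lerD; apply: le_trans (rint_abs _ _ _) _ => //;
  apply: rint_le => // [|t ab]; try exact: cn.
  by apply: le_trans (Fg t ab); exact: normc_Re.
by apply: le_trans (Fg t ab); exact: normc_Im.
Qed.

Lemma normc_cint_cst a b F M : a <= b -> pcont F ->
  (forall t, a <= t <= b -> normc (F t) <= M) ->
  normc (cint a b F) <= 2 * M * (b - a).
Proof.
move=> ab hF FM; have := @normc_cint a b F (fun=> M) hF (@cst_continuous _ _ _) FM.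
by rewrite rint_cst // mulrA.
Qed.

End Integrals.

(** * Goursat's subdivision argument *)

Section Goursat.
Context {R : realType}.

Lemma nested_intervals (x w : nat -> R) : (forall n, 0 <= w n) ->
  (forall n, x n <= x n.+1) -> (forall n, x n.+1 + w n.+1 <= x n + w n) ->
  exists u, forall n, x n <= u <= x n + w n.
Proof.
move=> w0 xS wS.
have xm : {homo x : m n / (m <= n)%N >-> m <= n} by apply: homo_leq => //; exact: le_trans.
have wm m n : (m <= n)%N -> x n + w n <= x m + w m.
  elim: n => [|n IH]; first by rewrite leqn0 => /eqP ->.
  rewrite leq_eqVlt => /predU1P[->//|/IH]; exact: le_trans (wS n).
have xw m n : x m <= x n + w n.
  have [mn|/ltnW nm] := leqP m n.
    by apply: le_trans (xm _ _ mn) _; rewrite lerDl.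
  by apply: le_trans (wm _ _ nm); rewrite lerDl.
exists (sup (range x)) => n; apply/andP; split.
  apply: ub_le_sup; last by exists n.
  by exists (x 0%N + w 0%N) => _ [m _ <-].
by apply: ge_sup => [|_ [m _ <-]//]; exists (x 0%N), 0%N.
Qed.

Lemma cvg0_geometric (q : R) : 0 <= q < 1 -> forall e, 0 < e -> exists n, q ^+ n < e.
Proof.
move=> /andP[q0 q1] e e0; have := @cvg_geometric R 1 q.
rewrite ger0_norm // => /(_ q1) /cvgrPdist_lt/(_ e e0) [n _ /(_ n (leqnn n))] /=.
by rewrite sub0r normrN mul1r ger0_norm ?exprn_ge0 // => H; exists n.
Qed.

(** If Phi did not vanish on the whole rectangle, then by additivity one
    quarter in each generation would keep |Phi| >= eta e^2, where e is the
    scale; the nested quarters shrink to a point at which Phi = o(e^2). The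
    rectangle at scale e with corner (x, y) has sides a e and b e, so that all
    the rectangles are similar and are determined by a corner and a scale. *)
Lemma goursat (a b x0 y0 : R) (Phi : R -> R -> R -> R[i]) :
  0 <= a -> 0 <= b ->
  (forall x y e, 0 < e -> x0 <= x -> x + a * e <= x0 + a ->
     y0 <= y -> y + b * e <= y0 + b ->
     Phi x y e = Phi x y (e / 2) + Phi (x + a * (e / 2)) y (e / 2) +
       Phi x (y + b * (e / 2)) (e / 2) +
       Phi (x + a * (e / 2)) (y + b * (e / 2)) (e / 2)) ->
  (forall u v, x0 <= u <= x0 + a -> y0 <= v <= y0 + b ->
     forall eps, 0 < eps -> exists2 r : R, 0 < r & forall x y e, 0 < e < r ->
       x0 <= x -> x + a * e <= x0 + a -> y0 <= y -> y + b * e <= y0 + b ->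
       x <= u <= x + a * e -> y <= v <= y + b * e ->
       normc (Phi x y e) <= eps * e ^+ 2) ->
  Phi x0 y0 1 = 0.
Proof.
move=> a0 b0 Hadd Hloc; apply/eqP; rewrite -normc_eq0.
rewrite -[_ == _]negbK; apply/negP => H0.
have {H0} eta0 : 0 < normc (Phi x0 y0 1) by rewrite lt_def H0 normc_ge0.
set eta := normc _ in eta0.
pose e n : R := 2 ^- n.
have e0 n : 0 < e n by rewrite invr_gt0 exprn_gt0.
have eS n : e n.+1 = e n / 2 by rewrite /e exprS invfM mulrC.
pose P n (p : R * R) := [/\ x0 <= p.1, p.1 + a * e n <= x0 + a, y0 <= p.2,
   p.2 + b * e n <= y0 + b & eta * e n ^+ 2 <= normc (Phi p.1 p.2 (e n))].
pose Q n (p q : R * R) := [/\ p.1 <= q.1, q.1 + a * e n.+1 <= p.1 + a * e n,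
   p.2 <= q.2 & q.2 + b * e n.+1 <= p.2 + b * e n].
have step n p : P n p -> exists q, P n.+1 q /\ Q n p q.
  case: p => x y [/= p1 p2 p3 p4 p5].
  have ae0 := mulr_ge0 a0 (ltW (e0 n)); have be0 := mulr_ge0 b0 (ltW (e0 n)).
  have [q1|q1] := leP (eta * e n.+1 ^+ 2) (normc (Phi x y (e n.+1))).
    exists (x, y); split; split => //=; rewrite ?eS;
      clear eta0 eS e0 p5 q1; lra.
  have [q2|q2] := leP (eta * e n.+1 ^+ 2) (normc (Phi (x + a * (e n / 2)) y (e n.+1))).
    exists (x + a * (e n / 2), y); split; split => //=; rewrite ?eS;
      clear eta0 eS e0 p5 q1 q2; lra.
  have [q3|q3] := leP (eta * e n.+1 ^+ 2) (normc (Phi x (y + b * (e n / 2)) (e n.+1))).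
    exists (x, y + b * (e n / 2)); split; split => //=; rewrite ?eS;
      clear eta0 eS e0 p5 q1 q2 q3; lra.
  have [q4|q4] := leP (eta * e n.+1 ^+ 2)
      (normc (Phi (x + a * (e n / 2)) (y + b * (e n / 2)) (e n.+1))).
    exists (x + a * (e n / 2), y + b * (e n / 2)); split; split => //=; rewrite ?eS;
      clear eta0 eS e0 p5 q1 q2 q3 q4; lra.
  exfalso; move: p5; rewrite (Hadd _ _ _ (e0 n)) // -eS leNgt => /negP; apply.
  apply: le_lt_trans (normcD _ _) _.
  have := normcD (Phi x y (e n.+1) + Phi (x + a * (e n / 2)) y (e n.+1))
    (Phi x (y + b * (e n / 2)) (e n.+1)).
  have := normcD (Phi x y (e n.+1)) (Phi (x + a * (e n / 2)) y (e n.+1)).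
  rewrite eS in q1 q2 q3 q4 *.
  have : eta * (e n / 2) ^+ 2 * 4 = eta * e n ^+ 2 by field.
  lra.
have P0 : P 0%N (x0, y0) by split; rewrite /= /e ?expr0 ?invr1 ?mulr1 ?expr1n ?mulr1.
(* dependent choice of a nested sequence of quarters *)
pose next n (p : {p | P n p}) : {q | P n.+1 q} :=
  let q := cid (step n (sval p) (svalP p)) in exist _ (sval q) (proj1 (svalP q)).
pose s := fix s n : {p | P n p} := if n is m.+1 then next m (s m) else exist _ _ P0.
have sQ n : Q n (sval (s n)) (sval (s n.+1)).
  by rewrite /= /next /=; case: cid => q /= [].
have [u Hu] := @nested_intervals (fun n => (sval (s n)).1) (fun n => a * e n)
  (fun n => mulr_ge0 a0 (ltW (e0 n))) (fun n => let: And4 h _ _ _ := sQ n in h)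
  (fun n => let: And4 _ h _ _ := sQ n in h).
have [v Hv] := @nested_intervals (fun n => (sval (s n)).2) (fun n => b * e n)
  (fun n => mulr_ge0 b0 (ltW (e0 n))) (fun n => let: And4 _ _ h _ := sQ n in h)
  (fun n => let: And4 _ _ _ h := sQ n in h).
have [|||r r0 Hr] := Hloc u v _ _ (eta / 2).
- by have := Hu 0%N; rewrite /= /e expr0 invr1 mulr1.
- by have := Hv 0%N; rewrite /= /e expr0 invr1 mulr1.
- by rewrite divr_gt0.
have [n nr] : exists n, e n < r.
  have [|n Hn] := @cvg0_geometric 2^-1 _ r r0.
    by rewrite invr_ge0 ler0n invf_lt1 // ltr1n.
  by exists n; rewrite /e -exprVn.
have [p1 p2 p3 p4 p5] := svalP (s n).
have := Hr (sval (s n)).1 (sval (s n)).2 (e n); rewrite e0 nr => /(_ isT).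
move=> /(_ p1 p2 p3 p4 (Hu n) (Hv n)) /(le_trans p5).
rewrite ler_pM2r ?exprn_gt0 // => H.
have : eta / 2 < eta by rewrite ltr_pdivrMr // ltr_pMr // ltr1n.
by rewrite ltNge H.
Qed.

End Goursat.

(** * Circles, means and the Cauchy kernel *)

(** Locked, so that rewriting rules for the modulus of a product do not take a
    point of the circle apart. *)
HB.lock Definition circ {R : realType} (rho t : R) : R[i] := rho%:C * cis t.

Section Circle.
Context {R : realType}.
Implicit Types (rho t : R) (z w : R[i]).

Lemma normc_circ rho t : 0 <= rho -> normc (circ rho t) = rho.
Proof. by move=> r0; rewrite circ.unlock normcM normc_cis mulr1 normc_real ger0_norm. Qed.

Lemma pderiv_circ rho t : has_pderiv (circ rho) t ('i * circ rho t).
Proof.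
rewrite circ.unlock; have := pderivM (pderiv_cst rho%:C t) (pderiv_cis t).
by rewrite mul0r add0r mulrCA.
Qed.

Lemma pcont_circ rho : pcont (circ rho).
Proof. exact: (pderiv_pcont (pderiv_circ rho)). Qed.

Lemma circ2pi rho : circ rho (2 * pi) = circ rho 0.
Proof. by rewrite circ.unlock cis2pi cis0. Qed.

Lemma twopi_ge0 : 0 <= 2 * pi :> R.
Proof. by rewrite mulr_ge0 // pi_ge0. Qed.

Lemma twopi_gt0 : 0 < 2 * pi :> R.
Proof. by rewrite mulr_gt0 // pi_gt0. Qed.

Lemma normc_i : normc ('i : R[i]) = 1.
Proof. by rewrite /normc /= expr0n expr1n add0r sqrtr1. Qed.

Lemma circ_lipschitz rho t s : 0 <= rho ->
  normc (circ rho t - circ rho s) <= 2 * rho * `|t - s|.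
Proof.
move=> r0; wlog st : t s / s <= t.
  move=> H; have [/H//|/ltW/H] := leP s t.
  by rewrite normc_distC distrC.
have Hc : pcont (fun t => 'i * circ rho t).
  by apply: pcontM; [exact: pcont_cst|exact: pcont_circ].
rewrite -(cint_FTC st Hc (pderiv_circ rho)) ger0_norm ?subr_ge0 //.
by apply: normc_cint_cst => // u _; rewrite normcM normc_i mul1r normc_circ.
Qed.

Lemma circ_sub_neq0 rho z t : normc z < rho -> circ rho t - z != 0.
Proof.
move=> zr; have r0 : 0 <= rho by rewrite (le_trans (normc_ge0 z)) // ltW.
rewrite -normc_gt0 (lt_le_trans _ (normc_triB _ _)) // normc_circ //.
by rewrite subr_gt0.
Qed.

Lemma normc_circ_sub rho z t : 0 <= rho -> rho - normc z <= normc (circ rho t - z).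
Proof. by move=> r0; rewrite -{1}(normc_circ t r0) normc_triB. Qed.

(** The kernel of Cauchy's formula: i times it, times dt, is dw / (w - z) on
    the circle of radius [rho]. *)
Definition ckernel rho z t : R[i] := circ rho t / (circ rho t - z).

Lemma pcont_ckernel rho z : normc z < rho -> pcont (ckernel rho z).
Proof.
move=> zr; apply: pcontM; first exact: pcont_circ.
apply: pcontV => [t|]; first exact: circ_sub_neq0.
by apply: pcontB; [exact: pcont_circ|exact: pcont_cst].
Qed.

Lemma normc_ckernel rho z t : normc z < rho ->
  normc (ckernel rho z t) <= rho / (rho - normc z).
Proof.
move=> zr; have r0 : 0 <= rho by rewrite (le_trans (normc_ge0 z)) // ltW.
rewrite /ckernel normcM normcV normc_circ // ler_wpM2l //.
rewrite lef_pV2 ?posrE ?subr_gt0 ?normc_circ_sub //.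
by rewrite normc_gt0 circ_sub_neq0.
Qed.

Definition cmean (F : R -> R[i]) : R[i] := ((2 * pi)^-1)%:C * cint 0 (2 * pi) F.

Lemma cmean_cst c : cmean (fun=> c) = c.
Proof.
rewrite /cmean cint_cst ?twopi_ge0 // subr0 mulrA -rmorphM /=.
by rewrite mulVf ?mul1r // gt_eqF // twopi_gt0.
Qed.

Lemma eq_cmean F G : (forall t, F t = G t) -> cmean F = cmean G.
Proof. by move=> FG; rewrite /cmean; congr (_ * _); apply: eq_cint => t _. Qed.

Lemma cmeanD F G : pcont F -> pcont G ->
  cmean (fun t => F t + G t) = cmean F + cmean G.
Proof. by move=> hF hG; rewrite /cmean cintD // mulrDr. Qed.

Lemma cmeanB F G : pcont F -> pcont G ->
  cmean (fun t => F t - G t) = cmean F - cmean G.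
Proof. by move=> hF hG; rewrite /cmean cintB // mulrBr. Qed.

Lemma cmeanZ c F : pcont F -> cmean (fun t => c * F t) = c * cmean F.
Proof. by move=> hF; rewrite /cmean cintZ // mulrCA. Qed.

Lemma normc_cmean F M : pcont F -> (forall t, 0 <= t <= 2 * pi -> normc (F t) <= M) ->
  normc (cmean F) <= 2 * M.
Proof.
move=> hF FM; rewrite /cmean normcM normc_real ger0_norm ?invr_ge0 ?twopi_ge0 //.
rewrite ler_pdivrMl ?twopi_gt0 //.
have := @normc_cint_cst _ 0 (2 * pi) F M twopi_ge0 hF FM.
by rewrite subr0 [X in _ -> _ <= X]mulrC.
Qed.

Lemma cont_bounded (u : R -> R) : continuous u ->
  exists M, forall t, 0 <= t <= 2 * pi -> u t <= M.
Proof.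
move=> cu; have [c _ Hc] := EVT_max twopi_ge0 (continuous_subspaceT cu).
by exists (u c) => t tp; apply: Hc; rewrite in_itv.
Qed.

Lemma pcont_bounded F : pcont F ->
  exists2 M, 0 <= M & forall t, 0 <= t <= 2 * pi -> normc (F t) <= M.
Proof.
move=> hF; have [M HM] := cont_bounded (pcont_normc hF); exists M => //.
by apply: le_trans (normc_ge0 (F 0)) (HM _ _); rewrite lexx twopi_ge0.
Qed.

Lemma cmean_deriv F D : pcont D -> (forall t, has_pderiv F t (D t)) ->
  F (2 * pi) = F 0 -> cmean D = 0.
Proof.
move=> hD FD F0; rewrite /cmean (cint_FTC twopi_ge0 hD FD) F0 subrr mulr0 //.
Qed.

Lemma pcontX F n : pcont F -> pcont (fun t => F t ^+ n).
Proof.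
move=> hF; elim: n => [|n IH]; first exact: pcont_cst.
by under eq_fun do rewrite exprS; exact: pcontM.
Qed.

Lemma pderiv_eq F t (a b : R[i]) : has_pderiv F t a -> a = b -> has_pderiv F t b.
Proof. by move=> h <-. Qed.

Lemma pderivX F t d n : has_pderiv F t d ->
  has_pderiv (fun s => F s ^+ n) t (n%:R * F t ^+ n.-1 * d).
Proof.
move=> hF; elim: n => [|n IH]; first by rewrite !mul0r; exact: pderiv_cst.
under eq_fun do rewrite exprS; apply: pderiv_eq (pderivM hF IH) _.
case: n {IH} => [|n]; first by rewrite /= expr0; ring.
by rewrite /= exprS -[in RHS]natr1; ring.
Qed.

Lemma cmean_cisVX n : (0 < n)%N -> cmean (fun t => (cis t)^-1 ^+ n) = 0.
Proof.
move=> n0; have c0 t := cis_neq0 t.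
have hc : pcont (fun t : R => (cis t)^-1) by apply: pcontV => //; exact: pcont_cis.
have n00 : - 'i * n%:R != 0 :> R[i].
  by rewrite mulf_neq0 ?pnatr_eq0 -?lt0n // -normc_gt0 normc_opp normc_i.
apply: (mulfI n00); rewrite mulr0 -cmeanZ; last exact: pcontX.
apply: (@cmean_deriv (fun t => (cis t)^-1 ^+ n)).
- by apply: pcontM; [exact: pcont_cst|exact: pcontX].
- move=> t; apply: pderiv_eq (pderivX n (pderiv_chain (cderiv_inv (c0 t)) (pderiv_cis t))) _.
  case: n n0 {n00} => // n _; rewrite [n.+1.-1]/= [in RHS]exprS.
  by set y := _ ^+ n; field; rewrite c0.
- by rewrite cis2pi cis0.
Qed.

(** With c = z / rho the kernel is 1 / (1 - c e^(-it)). The means of (c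
    e^(-it))^n times the kernel are equal for all n >= 1, because consecutive
    ones differ by the mean of a power of e^(-it); they tend to 0, so they
    vanish. This replaces an expansion into a series. *)
Lemma cmean_ckernel rho z : normc z < rho -> cmean (ckernel rho z) = 1.
Proof.
move=> zr; have r0 : 0 < rho := le_lt_trans (normc_ge0 z) zr.
have K0 := pcont_ckernel zr.
have hc : pcont (fun t : R => (cis t)^-1).
  by apply: pcontV => [t|]; [exact: cis_neq0|exact: pcont_cis].
pose c := z / rho%:C.
have hX n : pcont (fun t => (c * (cis t)^-1) ^+ n).
  by apply: pcontX; apply: pcontM => //; exact: pcont_cst.
pose I n := cmean (fun t => (c * (cis t)^-1) ^+ n * ckernel rho z t).
have IS n : (0 < n)%N -> I n.+1 = I n.
  move=> n0; apply/eqP; rewrite eq_sym -subr_eq0 -cmeanB; try exact: pcontM.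
  rewrite (@eq_cmean _ (fun t => c ^+ n * (cis t)^-1 ^+ n)) => [|t].
    by rewrite cmeanZ ?cmean_cisVX ?mulr0 //; exact: pcontX.
  rewrite -mulrBl -exprMn exprS -[X in (X - _) * _]mul1r -mulrBl mulrAC.
  rewrite -[RHS]mul1r; congr (_ * _); rewrite /ckernel circ.unlock /c.
  have := circ_sub_neq0 t zr; rewrite circ.unlock => h.
  have := cis_neq0 t; have : rho%:C != 0 :> R[i] by rewrite -normc_gt0 normc_real normr_gt0 gt_eqF.
  by move=> ? ?; field; apply/and3P.
have q01 : 0 <= normc z / rho < 1.
  by rewrite divr_ge0 ?normc_ge0 ?ltW //= ltr_pdivrMr // mul1r.
have In n : normc (I n) <= 2 * ((normc z / rho) ^+ n * (rho / (rho - normc z))).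
  apply: normc_cmean => [|t _]; first exact: pcontM.
  rewrite normcM normcX normcM normcV normc_cis invr1 mulr1 /c normcM normcV.
  rewrite normc_real (ger0_norm (ltW r0)) ler_wpM2l ?normc_ckernel //.
  by rewrite exprn_ge0 // divr_ge0 ?normc_ge0 // ltW.
have I1 : I 1%N = 0.
  have E n : I n.+1 = I 1%N by elim: n => // n <-; exact: IS.
  apply/eqP; rewrite -normc_eq0 eq_le normc_ge0 andbT; apply/ler_addgt0Pr => e e0; rewrite add0r.
  have C0 : 0 < 2 * (rho / (rho - normc z)) by rewrite mulr_gt0 // divr_gt0 // subr_gt0.
  have [n Hn] := cvg0_geometric q01 (divr_gt0 e0 C0).
  rewrite -(E n); apply: le_trans (In _) _; rewrite mulrCA.
  rewrite -ler_pdivlMr // (le_trans _ (ltW Hn)) // exprS ler_piMl ?exprn_ge0 //.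
    by case/andP: q01.
  by case/andP: q01 => _ /ltW.
rewrite -[RHS]addr0 -I1 -(cmean_cst 1) /I -cmeanD; [|exact: pcont_cst|].
  apply: eq_cmean => t; rewrite expr1 /ckernel circ.unlock /c.
  have := circ_sub_neq0 t zr; rewrite circ.unlock => h.
  have := cis_neq0 t; have : rho%:C != 0 :> R[i] by rewrite -normc_gt0 normc_real normr_gt0 gt_eqF.
  by move=> ? ?; field; apply/and3P.
by apply: pcontM.
Qed.

End Circle.

(** * Cauchy's formula *)

Section CauchyFormula.
Context {R : realType}.
Variables (g : R[i] -> R[i]) (rho : R) (z : R[i]).
Hypothesis zrho : normc z < rho.
Hypothesis g_deriv : forall w, normc w <= rho -> exists d, has_cderiv g w d.

Let rho0 : 0 < rho. Proof. exact: le_lt_trans (normc_ge0 z) zrho. Qed.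

Section Homotopy.
Variable eps : R.
Hypothesis eps01 : 0 < eps < 1.

(* Clamping the parameter keeps every integrand continuous on the whole line. *)
Let cl (t : R) : R := Num.max eps (Num.min t 1).
Let W (t th : R) : R[i] := z + (cl t)%:C * (circ rho th - z).

Let cl_id t : eps <= t <= 1 -> cl t = t.
Proof. by move=> /andP[t0 t1]; rewrite /cl (min_idPl t1) (max_idPr t0). Qed.

Let cl_gt0 t : 0 < cl t.
Proof. by rewrite /cl lt_max; case/andP: eps01 => ->. Qed.

Let cl_le1 t : cl t <= 1.
Proof. by rewrite /cl ge_max ge_min lexx orbT andbT; case/andP: eps01 => _ /ltW. Qed.

Let cl_ge t : eps <= cl t.
Proof. by rewrite /cl le_max lexx. Qed.

Let cl_cont : continuous cl.
Proof.
apply: cont_max; first exact: cst_continuous.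
by apply: cont_min => [t|]; [exact: cvg_id|exact: cst_continuous].
Qed.

Let normc_W t th : normc (W t th) <= rho.
Proof.
rewrite /W (_ : _ + _ = (1 - cl t)%:C * z + (cl t)%:C * circ rho th); last first.
  by rewrite rmorphB rmorph1; ring.
apply: le_trans (normcD _ _) _; rewrite !normcM !normc_real. rewrite normc_circ ?(ltW rho0) //.
rewrite !ger0_norm ?subr_ge0 ?cl_le1 ?(ltW (cl_gt0 t)) //.
by have := cl_le1 t; have := cl_gt0 t; move: (ltW zrho); nra.
Qed.

Let pcont_cl : pcont (fun t => (cl t)%:C : R[i]).
Proof. exact: pcont_real. Qed.

Let cl_neq0 t : (cl t)%:C != 0 :> R[i].
Proof. by rewrite -normc_gt0 normc_real normr_gt0 gt_eqF. Qed.

Let pcont_Wt th : pcont (W ^~ th).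
Proof. by apply: pcontD; [exact: pcont_cst|apply: pcontM => //; exact: pcont_cst]. Qed.

Let pcont_circz : pcont (fun th => circ rho th - z).
Proof. by apply: pcontB; [exact: pcont_circ|exact: pcont_cst]. Qed.

Let pcont_Wth t : pcont (W t).
Proof.
by apply: pcontD; [exact: pcont_cst|apply: pcontM => //; exact: pcont_cst].
Qed.

Let g_ccont w : normc w <= rho -> ccont g w.
Proof. by move=> /g_deriv[d]; exact: cderiv_ccont. Qed.

Let pcont_gWt th : pcont (fun t => g (W t th)).
Proof. by apply: pcont_comp => // t; exact: g_ccont. Qed.

Let pcont_gWth t : pcont (fun th => g (W t th)).
Proof. by apply: pcont_comp => // th; exact: g_ccont. Qed.

Let m th := 'i * ckernel rho z th.

Let pcont_m : pcont m.
Proof. by apply: pcontM; [exact: pcont_cst|exact: pcont_ckernel]. Qed.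

Let pcont_clV : pcont (fun t => (cl t)%:C^-1 : R[i]).
Proof. exact: pcontV. Qed.

(* The form G dw/(w - z) splits as G dt/t + G m(th) dth in the coordinates of
   the homotopy; its integrals along the two kinds of sides. *)
Let I (G : R -> R -> R[i]) t y y' := cint y y' (fun th => G t th * m th).
Let J (G : R -> R -> R[i]) th x x' := cint x x' (fun t => G t th * (cl t)%:C^-1).
Let bd G x x' y y' := I G x' y y' - I G x y y' - J G y' x x' + J G y x x'.

(** The form is exact against an affine function of w, so only the remainder
    of the first-order expansion of g contributes to the boundary integral. *)
Let bd_affine (al be : R[i]) r x x' y y' : x <= x' -> y <= y' ->
  eps <= x -> x' <= 1 ->
  (forall t, pcont (r t)) -> (forall th, pcont (r ^~ th)) ->
  (forall t th, g (W t th) = al + be * ((cl t)%:C * (circ rho th - z)) + r t th) ->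
  bd (fun t th => g (W t th)) x x' y y' = bd r x x' y y'.
Proof.
move=> xx' yy' ex x1 r1 r2 E.
have hI t : I (fun t th => g (W t th)) t y y' =
    al * cint y y' m + (be * (cl t)%:C) * (circ rho y' - circ rho y) + I r t y y'.
  rewrite -(cint_FTC yy' _ (pderiv_circ rho)); last first.
    by apply: pcontM; [exact: pcont_cst|exact: pcont_circ].
  have h1 : pcont (fun t : R => 'i * circ rho t).
    by apply: pcontM; [exact: pcont_cst|exact: pcont_circ].
  have h2 : pcont (fun th => al * m th) by apply: pcontM => //; exact: pcont_cst.
  have h3 : pcont (fun th => be * (cl t)%:C * ('i * circ rho th)).
    by apply: pcontM => //; exact: pcont_cst.
  rewrite -!cintZ // -!cintD //; [|exact: pcontD|exact: pcontM].
  apply: eq_cint => th _; rewrite E /m /ckernel.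
  by field; exact: circ_sub_neq0.
have hJ th : J (fun t th => g (W t th)) th x x' =
    al * cint x x' (fun t => (cl t)%:C^-1) + be * (x' - x)%:C * (circ rho th - z) + J r th x x'.
  have h2 : pcont (fun t => al * (cl t)%:C^-1) by apply: pcontM => //; exact: pcont_cst.
  have h3 : pcont (fun t : R => be * (circ rho th - z)) by exact: pcont_cst.
  rewrite -mulrA [_ * (circ _ _ - z)]mulrC mulrA [_ * (x' - x)%:C]mulrC -(cint_cst _ xx').
  rewrite -cintZ // -!cintD //; [|exact: pcontD|exact: pcontM].
  by apply: eq_cint => t _; rewrite E; field; exact: cl_neq0.
have e1 : eps <= x <= 1 by rewrite ex (le_trans xx').
have e2 : eps <= x' <= 1 by rewrite (le_trans ex xx').
by rewrite /bd !hI !hJ (cl_id e1) (cl_id e2) rmorphB; ring.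
Qed.

Let Km := rho / (rho - normc z).
Let Km_ge0 : 0 <= Km. Proof. by rewrite divr_ge0 ?subr_ge0 ?(ltW rho0) ?(ltW zrho). Qed.

Let bd_bound r x x' y y' M : x <= x' -> y <= y' -> eps <= x -> x' <= 1 ->
  (forall t, pcont (r t)) -> (forall th, pcont (r ^~ th)) ->
  (forall t th, x <= t <= x' -> y <= th <= y' -> normc (r t th) <= M) ->
  normc (bd r x x' y y') <= 4 * M * (Km * (y' - y) + (x' - x) / eps).
Proof.
move=> xx' yy' ex x1 r1 r2 rM.
have M0 : 0 <= M by apply: le_trans (normc_ge0 _) (rM x y _ _); rewrite ?lexx.
have hI t : x <= t <= x' -> normc (I r t y y') <= 2 * (M * Km) * (y' - y).
  move=> tx; apply: normc_cint_cst => // [|th thy]; first exact: pcontM.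
  rewrite normcM /m normcM normc_i mul1r.
  by rewrite ler_pM ?normc_ge0 ?normc_ckernel // rM.
have hJ th : y <= th <= y' -> normc (J r th x x') <= 2 * (M / eps) * (x' - x).
  move=> thy; apply: normc_cint_cst => // [|t tx]; first exact: pcontM.
  rewrite normcM normcV normc_real (ger0_norm (ltW (cl_gt0 t))).
  rewrite ler_pM ?normc_ge0 ?rM ?invr_ge0 ?(ltW (cl_gt0 t)) //.
  by rewrite lef_pV2 ?posrE //; case/andP: eps01.
have h1 := hI x'; have h2 := hI x; have h3 := hJ y'; have h4 := hJ y.
have {}h1 := h1 _; rewrite /bd.
have := normcD (I r x' y y' - I r x y y' - J r y' x x') (J r y x x').
have := normcB (I r x' y y' - I r x y y') (J r y' x x').
have := normcB (I r x' y y') (I r x y y').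
rewrite xx' yy' !lexx in h1 h2 h3 h4.
move: (h1 isT) (h2 isT) (h3 isT) (h4 isT); lra.
Qed.

(** The sides at angles 0 and 2 pi cancel by periodicity; a vanishing boundary
    integral therefore compares the circle with its contraction towards z by
    the factor eps. *)
Let cauchy_homotopy : I (fun t th => g (W t th)) 1 0 (2 * pi) =
  I (fun t th => g (W t th)) eps 0 (2 * pi).
Proof.
have [e0 e1] := andP eps01.
set G := fun t th => g (W t th).
pose a := 1 - eps; pose b : R := 2 * pi.
have a0 : 0 <= a by rewrite subr_ge0 ltW.
have b0 : 0 <= b := twopi_ge0.
pose Phi x y e := bd G x (x + a * e) y (y + b * e).
suff : Phi eps 0 1 = 0.
  rewrite /Phi /bd !mulr1 /a addrCA subrr addr0 add0r /J /G /W !circ2pi.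
  by rewrite addrNK => /eqP; rewrite subr_eq0 => /eqP.
apply: (goursat a0 b0) => [x y e e_gt0 x1 x2 y1 y2|u v ueps v0 r0 r0_gt0].
  have xe : x + a * e = x + a * (e / 2) + a * (e / 2) by field.
  have ye : y + b * e = y + b * (e / 2) + b * (e / 2) by field.
  have ae : 0 <= a * (e / 2) by rewrite mulr_ge0 // divr_ge0 // ltW.
  have be : 0 <= b * (e / 2) by rewrite mulr_ge0 // divr_ge0 // ltW.
  have sI t : I G t y (y + b * e) = I G t y (y + b * (e / 2)) +
      I G t (y + b * (e / 2)) (y + b * (e / 2) + b * (e / 2)).
    rewrite ye; apply: cint_split; rewrite ?lerDl //.
    by apply: pcontM => //; exact: pcont_gWth.
  have sJ th : J G th x (x + a * e) = J G th x (x + a * (e / 2)) +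
      J G th (x + a * (e / 2)) (x + a * (e / 2) + a * (e / 2)).
    rewrite xe; apply: cint_split; rewrite ?lerDl //.
    by apply: pcontM => //; exact: pcont_gWt.
  rewrite /Phi /bd !sI !sJ -xe -ye.
  do 6!move: (I _ _ _ _); do 6!move: (J _ _ _ _).
  by move=> *; ring.
have [d Hd] := g_deriv (normc_W u v); move/cderivE: Hd => Hd.
(* C e bounds the variation of W over a rectangle of scale e; a relative error
   eta of the first-order expansion of g then gives a boundary integral of at
   most eta C2 e^2 *)
pose C := a * (2 * rho) + 2 * rho * b + 1.
have C0 : 0 < C.
  have : 0 <= a * (2 * rho) by rewrite mulr_ge0 // mulr_ge0 // ltW.
  have : 0 <= 2 * rho * b by rewrite mulr_ge0 // mulr_ge0 // ltW.
  rewrite /C; lra.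
pose C2 := 4 * C * (Km * b + a / eps) + 1.
have C20 : 0 < C2.
  have k1 : 0 <= Km * b by exact: mulr_ge0.
  have k2 : 0 <= a / eps by rewrite divr_ge0 // ltW.
  have k3 : 0 <= 4 * C * (Km * b + a / eps) by rewrite mulr_ge0 ?addr_ge0 // mulr_ge0 // ltW.
  by rewrite /C2 ltr_wpDl.
have [s s0 Hs] := Hd _ (divr_gt0 r0_gt0 C20).
exists (s / C) => [|x y e /andP[e_gt0 es] x1 x2 y1 y2 ux vy]; first by rewrite divr_gt0.
pose be := d; pose al := g (W u v) - d * (W u v - z).
pose r t th := g (W t th) - (al + be * ((cl t)%:C * (circ rho th - z))).
have ae0 : 0 <= a * e by rewrite mulr_ge0 // ltW.
have be0 : 0 <= b * e by rewrite mulr_ge0 // ltW.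
have rt t : pcont (r t).
  apply: pcontB; first exact: pcont_gWth.
  apply: pcontD; first exact: pcont_cst.
  by apply: pcontM; [exact: pcont_cst|apply: pcontM => //; exact: pcont_cst].
have rth th : pcont (r ^~ th).
  apply: pcontB; first exact: pcont_gWt.
  apply: pcontD; first exact: pcont_cst.
  by apply: pcontM; [exact: pcont_cst|apply: pcontM => //; exact: pcont_cst].
have e1x : x + a * e <= 1 by move: x2; rewrite /a; lra.
rewrite /Phi (@bd_affine al be r) ?lerDl //; last first.
  by move=> t th; rewrite /r subrKC.
have rM t th : x <= t <= x + a * e -> y <= th <= y + b * e ->
    normc (r t th) <= r0 / C2 * (C * e).
  move=> tx thy.
  have -> : r t th = g (W u v + (W t th - W u v)) - g (W u v) - d * (W t th - W u v).
    rewrite [W u v + _]addrC subrK /r /al /be.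
    have -> : (cl t)%:C * (circ rho th - z) = W t th - z by rewrite /W addrAC subrr add0r.
    by move: (g (W t th)) (g (W u v)) (W t th) (W u v) => p1 p2 p3 p4; ring.
  have dW : normc (W t th - W u v) <= C * e.
    have -> : W t th - W u v = (t - u)%:C * (circ rho th - z) +
        u%:C * (circ rho th - circ rho v).
      have ut : eps <= u <= 1 by move: ueps; rewrite /a; lra.
      have tt : eps <= t <= 1 by move: tx; lra.
      by rewrite /W !cl_id // rmorphB; ring.
    apply: le_trans (normcD _ _) _; rewrite !normcM !normc_real.
    have h1 : normc (circ rho th - z) <= 2 * rho.
      apply: le_trans (normcB _ _) _; rewrite normc_circ ?(ltW rho0) //.
      move: (ltW zrho); lra.
    have h2 := circ_lipschitz th v (ltW rho0).
    have tu : `|t - u| <= a * e by rewrite ler_norml; move: tx ux; lra.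
    have tv : `|th - v| <= b * e by rewrite ler_norml; move: thy vy; lra.
    have u1 : `|u| <= 1.
      by rewrite ler_norml; move: ueps e0; rewrite /a; lra.
    have k1 : `|t - u| * normc (circ rho th - z) <= a * e * (2 * rho).
      by rewrite ler_pM ?normc_ge0.
    have k2 : `|u| * normc (circ rho th - circ rho v) <= 1 * (2 * rho * (b * e)).
      rewrite ler_pM ?normc_ge0 // (le_trans h2) // ler_wpM2l //.
      by rewrite mulr_ge0 // ltW.
    have H (a' b' : R) : a' * e * (2 * rho) + 1 * (2 * rho * (b' * e)) <=
        (a' * (2 * rho) + 2 * rho * b' + 1) * e 
      by rewrite -subr_ge0 (_ : _ - _ = e) ?(ltW e_gt0) //; ring.
    exact: (le_trans (lerD k1 k2) (H a b)).
  apply: le_trans (Hs _ _) _.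
    by apply: le_lt_trans dW _; rewrite mulrC -ltr_pdivlMr.
  by rewrite ler_wpM2l // divr_ge0 // ltW.
apply: le_trans (bd_bound _ _ _ _ rt rth rM) _; rewrite ?lerDl //.
rewrite [y + _ - y]addrAC [x + _ - x]addrAC !subrr !add0r.
have -> : 4 * (r0 / C2 * (C * e)) * (Km * (b * e) + a * e / eps) =
    (C2 - 1) / C2 * (r0 * e ^+ 2).
  have c20 : C2 != 0 by rewrite gt_eqF.
  have ep0 : eps != 0 by rewrite gt_eqF.
  have H (c2 c a' b' km : R) : c2 != 0 ->
      4 * (r0 / c2 * (c * e)) * (km * (b' * e) + a' * e / eps) =
      4 * c * (km * b' + a' / eps) / c2 * (r0 * e ^+ 2).
    by move=> c0; field; rewrite ?c0 ?ep0.
  have -> : C2 - 1 = 4 * C * (Km * b + a / eps) by rewrite /C2 addrK.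
  exact: H.
rewrite ler_piMl //; first by rewrite mulr_ge0 ?sqr_ge0 // ltW.
by rewrite ler_pdivrMr // mul1r gerBl.
Qed.

Lemma cauchy_homotopy_eps :
  cmean (fun th => g (circ rho th) * ckernel rho z th) =
  cmean (fun th => g (z + eps%:C * (circ rho th - z)) * ckernel rho z th).
Proof.
have [e0 e1] := andP eps01.
have H := cauchy_homotopy.
have i0 : 'i != 0 :> R[i] by rewrite -normc_gt0 normc_i.
have K := pcont_ckernel zrho.
rewrite /cmean; congr (_ * _); apply: (mulfI i0).
have W1 th : W 1 th = circ rho th.
  by rewrite /W cl_id ?lexx ?(ltW e1) // mul1r addrCA subrr addr0.
have We th : W eps th = z + eps%:C * (circ rho th - z).
  by rewrite /W cl_id ?lexx ?(ltW e1).
have c1 : pcont (fun th => g (circ rho th) * ckernel rho z th).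
  by apply: pcontM K; have := pcont_gWth 1; under eq_fun do rewrite W1.
have c2 : pcont (fun th => g (z + eps%:C * (circ rho th - z)) * ckernel rho z th).
  by apply: pcontM K; have := pcont_gWth eps; under eq_fun do rewrite We.
rewrite -!cintZ //; move: H; rewrite /I /m.
rewrite (@eq_cint _ _ _ _ (fun th => 'i * (g (circ rho th) * ckernel rho z th))); last first.
  by move=> t _; rewrite W1 mulrCA.
move=> ->; apply: eq_cint => t _; by rewrite We mulrCA.
Qed.

End Homotopy.

(** The factor eps of the contraction tends to 0: the circle shrinks to z,
    where g is continuous, and the kernel has mean 1. *)
Theorem cauchy_formula : cmean (fun th => g (circ rho th) * ckernel rho z th) = g z.
Proof.
have gc w : normc w <= rho -> ccont g w.
  by move=> /g_deriv[d]; exact: cderiv_ccont.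
have K := pcont_ckernel zrho.
have c1 : pcont (fun th => g (circ rho th)).
  apply: pcont_comp (pcont_circ rho) => t; apply: gc; by rewrite normc_circ ?(ltW rho0).
apply/eqP; rewrite -subr_eq0 -normc_eq0 eq_le normc_ge0 andbT.
apply/ler_addgt0Pr => e e_gt0; rewrite add0r.
pose Km := rho / (rho - normc z).
have Km_gt0 : 0 < Km by rewrite divr_gt0 // subr_gt0.
have [s s0 Hs] := gc z (ltW zrho) _ (divr_gt0 e_gt0 (mulr_gt0 (@ltr0n R 2) Km_gt0)).
have r20 : 0 < 2 * rho by rewrite mulr_gt0.
pose eps := Num.min 2^-1 (s / 2 / (2 * rho)).
have eps01 : 0 < eps < 1.
  rewrite lt_min invr_gt0 ltr0n /= !divr_gt0 //= gt_min invf_lt1 ?ltr1n //.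
have [eps0 eps1] := andP eps01.
have wr th : normc (z + eps%:C * (circ rho th - z)) <= rho.
  rewrite (_ : _ + _ = (1 - eps)%:C * z + eps%:C * circ rho th); last first.
    by rewrite rmorphB rmorph1; ring.
  apply: le_trans (normcD _ _) _; rewrite !normcM !normc_real normc_circ ?(ltW rho0) //.
  rewrite !ger0_norm ?subr_ge0 ?(ltW eps1) ?(ltW eps0) //.
  by move: (ltW zrho) eps0 eps1; nra.
have c2 : pcont (fun th => g (z + eps%:C * (circ rho th - z))).
  apply: (@pcont_comp _ g); first by move=> t; exact: gc.
  apply: pcontD; first exact: pcont_cst.
  apply: pcontM; first exact: pcont_cst.
  by apply: pcontB; [exact: pcont_circ|exact: pcont_cst].
rewrite (cauchy_homotopy_eps eps01) -[X in _ - X]mulr1 -(cmean_ckernel zrho) -cmeanZ //.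
have c3 : pcont (fun th => g z * ckernel rho z th) by apply: pcontM => //; exact: pcont_cst.
rewrite -cmeanB //; last exact: pcontM.
apply: le_trans (normc_cmean (M := e / (2 * Km) * Km) _ _) _.
- by apply: pcontB => //; exact: pcontM.
- move=> t _; rewrite -mulrBl normcM ler_pM ?normc_ge0 ?normc_ckernel //.
  apply/ltW/Hs; rewrite addrC addKr normcM normc_real ger0_norm ?(ltW eps0) //.
  have h1 : normc (circ rho t - z) <= 2 * rho.
    apply: le_trans (normcB _ _) _; rewrite normc_circ ?(ltW rho0) //.
    move: (ltW zrho); lra.
  apply: (@le_lt_trans _ _ (s / 2 / (2 * rho) * (2 * rho))).
    by rewrite ler_pM ?normc_ge0 ?(ltW eps0) // ge_min lexx orbT.
  by rewrite divfK ?gt_eqF // ltr_pdivrMr // ltr_pMr // ltr1n.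
- rewrite (_ : 2 * _ = e) //; field; rewrite gt_eqF //.
Qed.

End CauchyFormula.

(** * Taylor factorization and the derivative *)

Section Holomorphic.
Context {R : realType}.
Implicit Types (f g : R[i] -> R[i]) (rho : R) (z w : R[i]).

(** A quadratic remainder, uniform in t, makes differentiation under the
    integral sign elementary. *)
Lemma cderiv_cmean (K : R[i] -> R -> R[i]) (K' : R -> R[i]) z (r M : R) : 0 < r ->
  (forall h, normc h < r -> pcont (K (z + h))) -> pcont K' ->
  (forall t h, 0 <= t <= 2 * pi -> normc h < r ->
     normc (K (z + h) t - K z t - h * K' t) <= M * normc h ^+ 2) ->
  has_cderiv (fun w => cmean (K w)) z (cmean K').
Proof.
move=> r0 hK hK' KM; apply/cderivE => e e0.
have N0 : 0 < 2 * (`|M| + 1) by rewrite mulr_gt0 // ltr_wpDl.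
exists (Num.min r (e / (2 * (`|M| + 1)))) => [|h]; first by rewrite lt_min r0 divr_gt0.
rewrite lt_min => /andP[hr he].
have hz : pcont (K z) by have := hK 0; rewrite addr0 normc0; exact.
have hhK : pcont (fun t => h * K' t) by apply: pcontM => //; exact: pcont_cst.
have hzh := hK h hr.
rewrite [cmean K' * h]mulrC -cmeanZ // -!cmeanB //; last exact: pcontB.
have := @normc_cmean R (fun t => K (z + h) t - K z t - h * K' t) (M * normc h ^+ 2).
move=> /(_ (pcontB (pcontB hzh hz) hhK) (fun t tp => KM t h tp hr)) H.
apply: (le_trans H).
rewrite (_ : 2 * _ = normc h * (2 * M) * normc h); last by ring.
rewrite ler_wpM2r ?normc_ge0 //; rewrite ltr_pdivlMr // in he.
apply: le_trans (ltW he); rewrite ler_wpM2l ?normc_ge0 // ler_wpM2l //.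
by rewrite (le_trans (ler_norm M)) // lerDl.
Qed.

(** The case n = 1 differentiates Cauchy's formula and the case n = 2
    differentiates the result; in both the quadratic remainder is explicit. *)
Lemma cauchy_kernel_deriv n (phi : R -> R[i]) rho z : (0 < n < 3)%N -> pcont phi -> normc z < rho ->
  has_cderiv (fun w => cmean (fun t => phi t * (circ rho t - w)^-1 ^+ n)) z
    (cmean (fun t => n%:R * (phi t * (circ rho t - z)^-1 ^+ n.+1))).
Proof.
move=> n12 hphi zr; have rho0 : 0 < rho := le_lt_trans (normc_ge0 z) zr.
have [M M0 HM] := pcont_bounded hphi.
pose s := (rho - normc z) / 2.
have s0 : 0 < s by rewrite divr_gt0 // subr_gt0.
have zh h : normc h < s -> normc (z + h) < rho.
  by move=> hs; apply: le_lt_trans (normcD _ _) _; move: hs; rewrite /s; lra.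
have pc w : normc w < rho -> pcont (fun t => (circ rho t - w)^-1).
  move=> wr; apply: pcontV => [t|]; first exact: circ_sub_neq0.
  by apply: pcontB; [exact: pcont_circ|exact: pcont_cst].
have inv_le w t : normc w <= normc z + s -> normc w < rho ->
    normc ((circ rho t - w)^-1) <= s^-1.
  move=> ws wr; rewrite normcV lef_pV2 ?posrE ?normc_gt0 ?circ_sub_neq0 //.
  by apply: le_trans (normc_circ_sub _ _ (ltW rho0)); move: ws; rewrite /s; lra.
apply: (@cderiv_cmean _ _ _ s (M * (4 * s^-1 ^+ n.+2))) => //.
- move=> h hs; apply: pcontM => //; apply: pcontX; exact: pc (zh _ hs).
- by apply: pcontM; [exact: pcont_cst|apply: pcontM => //; apply: pcontX; exact: pc].
move=> t h tp hs.
pose a := (circ rho t - z)^-1; pose b := (circ rho t - (z + h))^-1.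
have na : normc a <= s^-1 by apply: inv_le => //; rewrite lerDl ltW.
have nb : normc b <= s^-1.
  by apply: inv_le (zh _ hs); apply: le_trans (normcD _ _) _; rewrite lerD2l ltW.
have c1 := circ_sub_neq0 t zr; have c2 := circ_sub_neq0 t (zh _ hs).
have s1 : 0 <= s^-1 by rewrite invr_ge0 ltW.
case: n n12 => [|[|[|//]]] // _.
- have -> : phi t * (circ rho t - (z + h))^-1 ^+ 1 - phi t * (circ rho t - z)^-1 ^+ 1 -
     h * (1%:R * (phi t * (circ rho t - z)^-1 ^+ 2)) = phi t * (a ^+ 2 * b) * h ^+ 2.
    by rewrite /a /b; field; apply/andP.
  rewrite normcM normcX ler_wpM2r ?sqr_ge0 // normcM ler_pM ?normc_ge0 ?HM //.
  rewrite normcM normcX [4 * _]mulrC [s^-1 ^+ 3]exprSr; apply: (@le_trans _ _ (s^-1 ^+ 2 * s^-1)).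
    by rewrite ler_pM ?normc_ge0 ?exprn_ge0 ?normc_ge0 // lerXn2r ?nnegrE ?normc_ge0.
  by rewrite ler_peMr ?mulr_ge0 ?exprn_ge0 // ler1n.
- have -> : phi t * (circ rho t - (z + h))^-1 ^+ 2 - phi t * (circ rho t - z)^-1 ^+ 2 -
     h * (2%:R * (phi t * (circ rho t - z)^-1 ^+ 3)) =
     phi t * (b ^+ 2 * a ^+ 2 + 2 * (a ^+ 3 * b)) * h ^+ 2.
    by rewrite /a /b; field; apply/andP.
  rewrite normcM normcX ler_wpM2r ?sqr_ge0 // normcM ler_pM ?normc_ge0 ?HM //.
  apply: (le_trans (normcD _ _)).
  rewrite (_ : 4 * s^-1 ^+ 4 = s^-1 ^+ 2 * s^-1 ^+ 2 + 2 * (s^-1 ^+ 3 * s^-1) + s^-1 ^+ 4); last by ring.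
  have n2 : normc (2 : R[i]) = 2 by rewrite -[2]/(2%:R) -(rmorph_nat (real_complex R)) normc_real ger0_norm.
  rewrite -[leLHS]addr0 lerD ?exprn_ge0 // lerD //.
    rewrite normcM !normcX.
    by rewrite ler_pM ?exprn_ge0 ?normc_ge0 // lerXn2r ?nnegrE ?normc_ge0.
  rewrite normcM n2 ler_wpM2l // normcM normcX ler_pM ?exprn_ge0 ?normc_ge0 //.
  by rewrite lerXn2r ?nnegrE ?normc_ge0.
Qed.

Definition cder g z : R[i] := xget 0 [set d | has_cderiv g z d].

Lemma cderP g z d : has_cderiv g z d -> has_cderiv g z (cder g z).
Proof. by move=> H; rewrite /cder; case: xgetP => [? -> //|/(_ d)]. Qed.

Lemma cderE g z d : has_cderiv g z d -> cder g z = d.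
Proof. by move=> H; apply: cderiv_unique (cderP H) H. Qed.

Lemma cderiv_shift g z z0 d : has_cderiv g (z0 + z) d ->
  has_cderiv (fun w => g (z0 + w)) z d.
Proof. by move=> /cderivE H; apply/cderivE => e /H[r r0 Hr]; exists r => // h /Hr; rewrite addrA. Qed.

Section Disc.
Variables (g : R[i] -> R[i]) (rho : R) (z0 : R[i]).
Hypothesis rho0 : 0 < rho.
Hypothesis gd : forall w, normc (w - z0) <= rho -> exists d, has_cderiv g w d.

Let phi t := g (z0 + circ rho t).

Let pphi : pcont phi.
Proof.
apply: (@pcont_comp _ (fun w => g (z0 + w))); last exact: pcont_circ.
move=> t; have [|d Hd] := gd (w := z0 + circ rho t).
  by rewrite addrC addKr normc_circ // ltW.
exact: cderiv_ccont (cderiv_shift Hd).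
Qed.

Lemma cauchy_disc z : normc (z - z0) < rho ->
  cmean (fun t => g (z0 + circ rho t) * ckernel rho (z - z0) t) = g z.
Proof.
move=> zr; rewrite (@cauchy_formula _ (fun w => g (z0 + w))) //.
  by congr g; rewrite addrC subrK.
move=> w wr; have [|d Hd] := gd (w := z0 + w); first by rewrite addrC addKr.
by exists d; exact: cderiv_shift.
Qed.

Lemma pcont_disc : pcont (fun t => g (z0 + circ rho t)).
Proof. exact: pphi. Qed.

(* Quotient in the Taylor expansion of order [n]. *)
Let q n z := cmean (fun t => phi t * (circ rho t)^-1 ^+ n * ckernel rho (z - z0) t).

Let circ0 t : circ rho t != 0.
Proof. by rewrite -normc_gt0 normc_circ // ltW. Qed.

Let pcV : pcont (fun t => (circ rho t)^-1).
Proof. by apply: pcontV => //; exact: pcont_circ. Qed.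

Let pq n : pcont (fun t => phi t * (circ rho t)^-1 ^+ n).
Proof. by apply: pcontM => //; exact: pcontX. Qed.

Let qS n z : normc (z - z0) < rho -> q n z = q n z0 + (z - z0) * q n.+1 z.
Proof.
move=> zr; have h0 : normc (z0 - z0) < rho by rewrite subrr normc0.
have k0 := pcont_ckernel h0; have k1 := pcont_ckernel zr.
rewrite /q -cmeanZ; last exact: pcontM.
rewrite -cmeanD; [|exact: pcontM|apply: pcontM; [exact: pcont_cst|exact: pcontM]].
apply: eq_cmean => t; rewrite /ckernel subrr subr0 exprS.
by have c1 := circ_sub_neq0 t zr; have := circ0 t => c2; field; apply/andP.
Qed.

Let q_deriv n z : normc (z - z0) < rho -> exists d, has_cderiv (q n) z d.
Proof.
move=> zr; have := @cauchy_kernel_deriv 1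
  (fun t => phi t * (circ rho t)^-1 ^+ n * circ rho t) rho (z - z0) isT.
move=> /(_ (pcontM (pq n) (pcont_circ rho)) zr).
set D := cmean _ => HD; exists D.
pose Q w := cmean (fun t => phi t * (circ rho t)^-1 ^+ n * circ rho t * (circ rho t - w)^-1 ^+ 1).
have -> : q n = fun w => Q (- z0 + w).
  apply/funext => w; apply: eq_cmean => t.
  by rewrite /ckernel expr1 mulrA [- z0 + w]addrC.
by apply: (@cderiv_shift Q); rewrite addrC.
Qed.

(** If some Taylor coefficient [q n z0] is nonzero, the first such n gives the
    factorization. Otherwise g = (z - z0)^n [q n] for all n, and g vanishes
    because [q n] = O(rho^(-n)). *)
Lemma local_factor :
  (forall z, normc (z - z0) < rho -> g z = 0) \/
  exists n (h : R[i] -> R[i]), [/\ h z0 != 0,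
    forall z, normc (z - z0) < rho -> exists d, has_cderiv h z d &
    forall z, normc (z - z0) < rho -> g z = (z - z0) ^+ n * h z].
Proof.
have g0 z : normc (z - z0) < rho -> g z = q 0 z.
  move=> zr; rewrite -cauchy_disc //; apply: eq_cmean => t.
  by rewrite expr0 mulr1.
have gq n : (forall m, (m < n)%N -> q m z0 = 0) ->
    forall z, normc (z - z0) < rho -> g z = (z - z0) ^+ n * q n z.
  elim: n => [|n IH] H z zr; first by rewrite mul1r g0.
  rewrite IH //; last by move=> m mn; apply: H; rewrite ltnS ltnW.
  by rewrite qS // H // add0r exprSr mulrA.
have [[n Hn]|/forallNP H] := pselect (exists n, q n z0 != 0); last first.
  left=> z zr.
  have Hq n : q n z0 = 0 by apply/eqP; rewrite -[_ == _]negbK; apply/negP; exact: H.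
  have [M M0 HM] := pcont_bounded pphi.
  apply/eqP; rewrite -normc_eq0 eq_le normc_ge0 andbT; apply/ler_addgt0Pr => e e0.
  rewrite add0r; pose x := normc (z - z0) / rho.
  have x01 : 0 <= x < 1 by rewrite divr_ge0 ?normc_ge0 ?(ltW rho0) //= ltr_pdivrMr // mul1r.
  pose C := 2 * (M * (rho / (rho - normc (z - z0)))) + 1.
  have C1 : 0 <= 2 * (M * (rho / (rho - normc (z - z0)))).
    by rewrite !mulr_ge0 // ?(ltW rho0) // invr_ge0 subr_ge0 ltW.
  have C0 : 0 < C by rewrite ltr_wpDl.
  have [n xn] := cvg0_geometric x01 (divr_gt0 e0 C0).
  rewrite (gq n) // normcM normcX.
  have qn : normc (q n z) <= 2 * (M * rho^-1 ^+ n * (rho / (rho - normc (z - z0)))).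
    apply: normc_cmean => [|t tp]; first by apply: pcontM => //; exact: pcont_ckernel.
    rewrite 2!normcM normcX normcV normc_circ ?(ltW rho0) //.
    rewrite ler_pM ?mulr_ge0 ?exprn_ge0 ?normc_ge0 ?invr_ge0 ?(ltW rho0) ?normc_ckernel //.
    by rewrite ler_wpM2r ?HM // exprn_ge0 // invr_ge0 (ltW rho0).
  apply: (@le_trans _ _ (x ^+ n * (2 * (M * (rho / (rho - normc (z - z0))))))).
    rewrite /x exprMn -[X in _ <= X]mulrA ler_wpM2l ?exprn_ge0 ?normc_ge0 //.
    by apply: (le_trans qn); rewrite le_eqVlt; apply/orP; left; apply/eqP; ring.
  apply: (@le_trans _ _ (x ^+ n * C)).
    by rewrite ler_wpM2l ?exprn_ge0 ?lerDl //; case/andP: x01.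
  by rewrite -ler_pdivlMr // ltW.
right; have ex : exists n, q n z0 != 0 by exists n.
case: (ex_minnP ex) => {Hn}n Hn nmin; exists n, (q n); split => //.
  by move=> z; exact: q_deriv.
apply: gq => m mn; apply/eqP; rewrite -[_ == _]negbK; apply/negP => /nmin.
by rewrite leqNgt mn.
Qed.

(** On the disc the derivative is the mean of a kernel, by the case n = 1 of
    [cauchy_kernel_deriv], and the case n = 2 applies to it. *)
Lemma cder_deriv z : normc (z - z0) < rho ->
  exists d, has_cderiv (cder g) z d.
Proof.
move=> zr.
pose Q w := cmean (fun t => phi t * circ rho t * (circ rho t - w)^-1 ^+ 2).
have pp : pcont (fun t => phi t * circ rho t) by apply: pcontM => //; exact: pcont_circ.
have gQ w : normc (w - z0) < rho -> cder g w = Q (- z0 + w).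
  move=> wr; apply: cderE.
  have := @cauchy_kernel_deriv 1 (fun t => phi t * circ rho t) rho (w - z0) isT pp wr.
  under eq_cmean do rewrite mul1r.
  rewrite [- z0 + w]addrC => HQ.
  pose Q1 w := cmean (fun t => phi t * circ rho t * (circ rho t - w)^-1 ^+ 1).
  have H : has_cderiv (fun w => Q1 (- z0 + w)) w (Q (w - z0)).
    by apply: (@cderiv_shift Q1); rewrite addrC.
  apply: (@cderiv_near _ _ _ _ _ (rho - normc (w - z0))) H; first by rewrite subr_gt0.
  move=> u uw; rewrite -cauchy_disc; last first.
    by apply: le_lt_trans (normc_distD _ w _) _; rewrite -ltrBrDr.
  by apply: eq_cmean => t; rewrite /ckernel expr1 mulrA [- z0 + u]addrC.
have := @cauchy_kernel_deriv 2 (fun t => phi t * circ rho t) rho (z - z0) isT pp zr.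
set D := cmean _ => HD; exists D.
have H : has_cderiv (fun w => Q (- z0 + w)) z D by apply: (@cderiv_shift Q); rewrite addrC.
apply: (@cderiv_near _ _ _ _ _ (rho - normc (z - z0))) H; first by rewrite subr_gt0.
move=> u uw; rewrite gQ //.
by apply: le_lt_trans (normc_distD _ z _) _; rewrite -ltrBrDr.
Qed.

End Disc.

End Holomorphic.

(** * Local form of a meromorphic function, identity theorem *)

Section Meromorphic.
Context {R : realType}.
Implicit Types (f g h : R[i] -> R[i]) (r : R) (z w a : R[i]) (m : int).

(** The function h is f divided by (. - z)^m, with the singularity at z
    removed. At z itself f may have any value. *)
Definition local_form f z m a := exists h (r : R), [/\ 0 < r, h z = a, a != 0,
  forall w, normc (w - z) < r -> h w != 0 /\ exists d, has_cderiv h w d &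
  forall w, normc (w - z) < r -> w != z -> f w = (w - z) ^ m * h w].

Lemma ccont_neq0 h z : ccont h z -> h z != 0 ->
  exists2 r, 0 < r & forall w, normc (w - z) < r ->
    normc (h z) / 2 < normc (h w) < normc (h z) * 2.
Proof.
move=> ch hz; have hz0 : 0 < normc (h z) by rewrite normc_gt0.
have [r r0 Hr] := ch (normc (h z) / 2) (divr_gt0 hz0 (@ltr0n R 2)).
exists r => // w /Hr wr.
have := normc_triB (h z) (h w); rewrite normc_distC.
by have := normc_triB (h w) (h z); move: wr; lra.
Qed.

Lemma normc_bounds_neq0 h z w : normc (h z) / 2 < normc (h w) < normc (h z) * 2 ->
  h w != 0.
Proof.
move=> /andP[H _]; rewrite -normc_gt0; apply: le_lt_trans H.
by rewrite divr_ge0 ?normc_ge0.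
Qed.

Lemma local_form_bounds f z m a : local_form f z m a ->
  exists2 r, 0 < r & forall w, normc (w - z) < r -> w != z ->
    exists2 b, normc a / 2 < normc b < normc a * 2 & f w = (w - z) ^ m * b.
Proof.
move=> [h [r [r0 hz a0 H1 H2]]].
have [|_ [d Hd]] := H1 z; first by rewrite subrr normc0.
have [|s s0 Hs] := ccont_neq0 (cderiv_ccont Hd); first by rewrite hz.
exists (Num.min r s) => [|w]; first by rewrite lt_min r0.
rewrite lt_min => /andP[wr ws] wz; exists (h w); last exact: H2.
by rewrite -hz; exact: Hs.
Qed.

Lemma hol_local f z : holomorphic_at f z ->
  (exists2 r, 0 < r & forall w, normc (w - z) < r -> f w = 0) \/
  exists n : nat, exists2 a, local_form f z n a & f z = 0 ^+ n * a.
Proof.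
move=> /holE[r r0 Hr].
have r20 : 0 < r / 2 by rewrite divr_gt0.
have [|H|[n [h [hz hd fh]]]] := @local_factor _ f (r / 2) z r20.
- by move=> w wr; apply: Hr; apply: le_lt_trans wr _; rewrite ltr_pdivrMr // ltr_pMr // ltr1n.
- by left; exists (r / 2).
have z0 : normc (z - z) < r / 2 by rewrite subrr normc0.
right; exists n, (h z); last by rewrite fh // subrr.
have [d Hd] := hd z z0.
have [s s0 Hs] := ccont_neq0 (cderiv_ccont Hd) hz.
exists h, (Num.min (r / 2) s); split => //; first by rewrite lt_min r20.
  move=> w; rewrite lt_min => /andP[wr ws]; split; last exact: hd.
  exact: normc_bounds_neq0 (Hs w ws).
by move=> w; rewrite lt_min => /andP[wr ws] _; rewrite fh.
Qed.

Lemma pole_normc f z : is_pole f z -> exists2 r, 0 < r & forall w,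
  normc (w - z) < r -> w != z -> exists d, has_cderiv f w d.
Proof.
move=> [/dnbhs_normc[r r0 Hr] _]; exists r => // w wr wz.
by exists ('D_1 (f : R[i]^o -> R[i]^o) w); apply: DeriveDef => //; exact: Hr.
Qed.

Lemma pole_infty f z (A : R) : is_pole f z -> exists2 r, 0 < r & forall w,
  normc (w - z) < r -> w != z -> A < normc (f w).
Proof. by move=> [_ /cvgryPgt/(_ A)] /dnbhs_normc. Qed.

(** The reciprocal of f tends to 0 at a pole; multiplied by (w - z) it becomes
    differentiable there, so that [local_factor] applies. *)
Lemma pole_local f z : is_pole f z -> exists n : nat, exists a, local_form f z (- n.+1%:Z) a.
Proof.
move=> fp; have [r1 r10 Hd] := pole_normc fp.
have [r2 r20 H1] := pole_infty 1 fp.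
pose r := Num.min r1 r2 / 2.
have r0 : 0 < r by rewrite divr_gt0 // lt_min r10.
have rr w : normc (w - z) <= r -> normc (w - z) < r1 /\ normc (w - z) < r2.
  move=> wr; apply/andP; rewrite -lt_min; apply: le_lt_trans wr _.
  by rewrite /r ltr_pdivrMr // ltr_pMr ?ltr1n // lt_min r10.
(* 1 / f tends to 0 at z, so v has derivative 0 there *)
pose v w := if w == z then 0 else (w - z) * (f w)^-1.
have f0 w : normc (w - z) <= r -> w != z -> f w != 0.
  move=> /rr[_ wr2] wz; rewrite -normc_gt0; exact: lt_trans (H1 w wr2 wz).
have vd w : normc (w - z) <= r -> exists d, has_cderiv v w d.
  move=> wr; have [->|wz] := eqVneq w z.
    exists 0; apply/cderivE => e e0; have [s s0 Hs] := pole_infty (e^-1) fp.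
    exists s => // u us; rewrite /v eqxx subr0 mul0r subr0.
    case: ifPn => [_|uz]; first by rewrite normc0 mulr_ge0 ?normc_ge0 // ltW.
    have zu : z + u - z = u by rewrite addrAC subrr add0r.
    have Hu := Hs (z + u); rewrite zu in Hu *.
    rewrite normcM normcV mulrC ler_wpM2r ?normc_ge0 //.
    have fu := Hu us uz; rewrite -[e]invrK lef_pV2 ?posrE ?invr_gt0 //; first exact: ltW.
    by apply: lt_trans fu; rewrite invr_gt0.
  have [d fd] := Hd w (proj1 (rr w wr)) wz.
  have := cderivM (cderivB (cderiv_id w) (cderiv_cst z w)) (cderivV (f0 w wr wz) fd).
  set D := _ + _ => HD; exists D.
  apply: (@cderiv_near _ _ _ _ _ (normc (w - z))) HD; first by rewrite normc_gt0 subr_eq0.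
  move=> u uw; rewrite /v; case: eqP => // uz.
  by rewrite uz normc_distC ltxx in uw.
have v0 w : normc (w - z) <= r -> w != z -> v w != 0.
  by move=> wr wz; rewrite /v (negbTE wz) mulf_neq0 ?subr_eq0 // invr_neq0 // f0.
have [H|[n [h [hz hd vh]]]] := local_factor r0 vd.
  have q0 : 0 < r / 2 by exact: divr_gt0.
  have wr : normc ((r / 2)%:C + z - z) < r.
    by rewrite addrK normc_real (gtr0_norm q0) ltr_pdivrMr // ltr_pMr // ltr1n.
  have wz : (r / 2)%:C + z != z.
    by rewrite -subr_eq0 addrK -normc_gt0 normc_real normr_gt0 gt_eqF.
  by have := v0 _ (ltW wr) wz; rewrite H // eqxx.
have zr : normc (z - z) < r by rewrite subrr normc0.
have h0 w : normc (w - z) < r -> h w != 0.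
  have [->//|wz wr] := eqVneq w z.
  have := v0 _ (ltW wr) wz; rewrite vh //; apply: contraNneq => ->.
  by rewrite mulr0.
case: n vh => [|[|n]] vh.
- by have := vh z zr; rewrite /v eqxx mul1r => hz0; rewrite -hz0 eqxx in hz.
- (* then f would stay bounded near its pole *)
  have [d hdz] := hd z zr; have [s s0 Hs] := ccont_neq0 (cderiv_ccont hdz) hz.
  have [t t0 Ht] := pole_infty ((normc (h z) / 2)^-1) fp.
  pose e := Num.min (Num.min s t) r / 2.
  have e0 : 0 < e by rewrite divr_gt0 // !lt_min s0 t0.
  have : normc (e%:C + z - z) < Num.min (Num.min s t) r.
    by rewrite addrK normc_real gtr0_norm // ltr_pdivrMr // ltr_pMr ?ltr1n // !lt_min s0 t0.
  have wz : e%:C + z != z.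
    by rewrite -subr_eq0 addrK -normc_gt0 normc_real normr_gt0 gt_eqF.
  move: (_ + z) wz => w wz; rewrite !lt_min => /andP[/andP[ws wt] wr].
  have := Ht w wt wz; have /andP[hw _] := Hs w ws.
  have -> : f w = (h w)^-1.
    have := vh w wr; rewrite /v (negbTE wz) expr1 => /mulfI; rewrite subr_eq0 => /(_ wz) <-.
    by rewrite invrK.
  rewrite normcV ltf_pV2 ?posrE ?divr_gt0 ?normc_gt0 ?h0 //.
  by move=> /(lt_trans hw); rewrite ltxx.
exists n, (h z)^-1, (fun w => (h w)^-1), r; split => //; first exact: invr_neq0.
  move=> w wr; split; first by rewrite invr_neq0 // h0.
  have [d Hdw] := hd w wr; exists (- (h w) ^- 2 * d); exact: cderivV (h0 w wr) Hdw.
move=> w wr wz; have := vh w wr; rewrite /v (negbTE wz) exprS -mulrA.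
move=> /mulfI; rewrite subr_eq0 => /(_ wz) /(congr1 GRing.inv).
by rewrite invrK => ->; rewrite invfM -exprnN.
Qed.

(** The point z is excluded because f may have any value at a pole. *)
Definition null_near f z :=
  exists2 r, 0 < r & forall w, normc (w - z) < r -> w != z -> f w = 0.

Lemma mero_local f z : meromorphic f ->
  null_near f z \/ exists m a, local_form f z m a.
Proof.
move=> /(_ z)[/hol_local[[r r0 H]|[n [a Ha _]]]|/pole_local[n [a Ha]]].
- by left; exists r => // w wr _; exact: H.
- by right; exists n, a.
- by right; exists (- n.+1%:Z), a.
Qed.

Lemma null_near_open f z : null_near f z ->
  exists2 r, 0 < r & forall w, normc (w - z) < r -> null_near f w.
Proof.
move=> [r r0 H]; exists r => // w wr.
have [->|wz] := eqVneq w z; first by exists r.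
have wz0 : 0 < normc (w - z) by rewrite normc_gt0 subr_eq0.
exists (Num.min (normc (w - z)) (r - normc (w - z))); first by rewrite lt_min wz0 subr_gt0.
move=> u; rewrite lt_min => /andP[u1 u2] uw; apply: H.
  by apply: le_lt_trans (normc_distD _ w _) _; rewrite -ltrBrDr.
by apply: contraTneq u1 => ->; rewrite normc_distC ltxx.
Qed.

Lemma local_form_not_null f z m a : local_form f z m a ->
  exists2 r, 0 < r & forall w, normc (w - z) < r -> ~ null_near f w.
Proof.
move=> [h [r [r0 hz a0 H1 H2]]]; exists r => // w wr [s s0 Hs].
pose q := Num.min s (r - normc (w - z)) / 2.
have M0 : 0 < Num.min s (r - normc (w - z)) by rewrite lt_min s0 subr_gt0.
have q0 : 0 < q by rewrite divr_gt0.
have qM : q < Num.min s (r - normc (w - z)) by rewrite ltr_pdivrMr // ltr_pMr // ltr1n.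
(* one of two nearby points differs from z *)
have [u [uz uw ur us]] : exists u, [/\ u != z, u != w, normc (u - z) < r & normc (u - w) < s].
  move: qM; rewrite lt_min => /andP[qs qr].
  have key (p : R[i]) : normc p = q -> w + p != z ->
      exists u, [/\ u != z, u != w, normc (u - z) < r & normc (u - w) < s].
    move=> pq pz; exists (w + p); rewrite pz addrAC [w + p - w]addrAC subrr add0r pq; split => //.
      by rewrite -subr_eq0 addrAC subrr add0r -normc_gt0 pq.
    by apply: le_lt_trans (normcD _ _) _; rewrite pq -ltrBrDl.
  have [e|/key] := eqVneq (w + q%:C) z; last by apply; rewrite normc_real gtr0_norm.
  apply: (key (- q%:C)); first by rewrite normc_opp normc_real gtr0_norm.
  rewrite -{}e -subr_eq0 opprD addrACA subrr add0r -opprD oppr_eq0 -rmorphD.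
  by rewrite -normc_gt0 normc_real normr_gt0 gt_eqF // addr_gt0.
have := Hs u us uw; rewrite H2 // => /eqP; rewrite mulf_eq0 expfz_eq0 subr_eq0.
by rewrite (negbTE uz) andbF (negbTE (proj1 (H1 u ur))).
Qed.

Lemma segment_open z d (P : R[i] -> Prop) :
  (forall w, P w -> exists2 r, 0 < r & forall u, normc (u - w) < r -> P u) ->
  open [set t : R | P (z + t%:C * d)].
Proof.
move=> HP; rewrite openE => t /= /HP[r r0 Hr]; apply/nbhs_ballP.
have d0 : 0 < normc d + 1 by rewrite ltr_wpDl ?normc_ge0.
exists (r / (normc d + 1)) => /=; first by rewrite divr_gt0.
move=> s; rewrite /ball /= => st; apply: Hr.
rewrite (_ : _ - _ = (s - t)%:C * d); last by rewrite rmorphB; ring.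
rewrite normcM normc_real distrC; rewrite ltr_pdivlMr // in st.
by apply: le_lt_trans st; rewrite ler_wpM2l // lerDl.
Qed.

(** Identity theorem: vanishing identically near a point is a condition both
    open and closed, so along a segment it propagates to a point at which f is
    holomorphic and nonzero. *)
Lemma mero_local_form f z : meromorphic f -> not_identically_zero f ->
  exists m a, local_form f z m a.
Proof.
move=> fm [z1 [f1 f1n0]]; have [Hz|//] := mero_local z fm; exfalso.
have n1 : ~ null_near f z1.
  have [[r r0 H]|[n [a Ha _]]] := hol_local f1.
    by rewrite H ?eqxx // ?subrr ?normc0 // in f1n0.
  have [r r0 H] := local_form_not_null Ha; apply: H.
  by rewrite subrr normc0.
pose d := z1 - z; pose C := [set t : R | null_near f (z + t%:C * d)].
have Co : open C by apply: segment_open => w; exact: null_near_open.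
have Cc : closed C.
  rewrite -openC (_ : ~` C = [set t : R | ~ null_near f (z + t%:C * d)]) //.
  apply: (@segment_open z d (fun w => ~ null_near f w)) => w Hw.
  have [//|[m [a Ha]]] := mero_local w fm; exact: local_form_not_null Ha.
have := @segment_connected R 0 1 (`[0, 1] `&` C).
have H0 : (`[0, 1] `&` C) 0.
  split; first by rewrite /= in_itv /= lexx ler01.
  by rewrite /C /= mul0r addr0.
move=> /(_ (ex_intro _ _ H0) (ex_intro2 _ _ C Co erefl) (ex_intro2 _ _ C Cc erefl)) E.
have : (`[0, 1] `&` C) 1 by rewrite E /= in_itv /= lexx ler01.
by move=> [_]; rewrite /C /= mul1r /d addrC subrK.
Qed.

End Meromorphic.

(** * Orders of zeros and poles *)

Section Order.
Context {R : realType}.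
Implicit Types (f g h : R[i] -> R[i]) (r : R) (z w a : R[i]) (m : int).

(** A nonzero power of t tends to 0 or to infinity at 0; orders of zeros and
    poles are compared in this way. *)
Lemma bounded_pow_eq0 (k : int) (c1 c2 r : R) : 0 < c1 -> 0 < r ->
  (forall t, 0 < t < r -> c1 <= t ^ k <= c2) -> k = 0.
Proof.
move=> c10 r0 H.
pose t := Num.min (Num.min r 1) (Num.min c1 (`|c2| + 1)^-1) / 2.
have M0 : 0 < Num.min (Num.min r 1) (Num.min c1 (`|c2| + 1)^-1).
  by rewrite !lt_min r0 ltr01 c10 invr_gt0 ltr_wpDl.
have t0 : 0 < t by rewrite divr_gt0.
have : t < Num.min (Num.min r 1) (Num.min c1 (`|c2| + 1)^-1).
  by rewrite ltr_pdivrMr // ltr_pMr ?ltr1n.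
rewrite !lt_min => /andP[/andP[tr t1] /andP[tc1 tc2]].
have := H t; rewrite t0 tr => /(_ isT) /andP[H1 H2].
have tn (n : nat) : t ^+ n.+1 <= t.
  by rewrite exprS ler_piMr ?(ltW t0) // exprn_ile1 // ltW.
case: k H1 H2 {H} => [[|n]|n] // H1 H2.
  by have := le_lt_trans (le_trans H1 (tn n)) tc1; rewrite ltxx.
have : (`|c2| + 1) < t ^ Negz n.
  rewrite NegzE -exprnN -[ltLHS]invrK ltf_pV2 ?posrE ?exprn_gt0 ?invr_gt0 ?ltr_wpDl //.
  exact: le_lt_trans (tn n) tc2.
move=> /lt_le_trans/(_ H2); have := ler_norm c2 => h1 h2; exfalso; lra.
Qed.

Lemma normcXz z (k : int) : normc (z ^ k) = normc z ^ k.
Proof. by case: k => n; rewrite ?NegzE -?exprnN ?normcV normcX. Qed.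

Lemma normc_real_shift z (t : R) : 0 < t -> normc (z + t%:C - z) = t /\ z + t%:C != z.
Proof.
move=> t0; have -> : normc (z + t%:C - z) = t.
  by rewrite addrAC subrr add0r normc_real gtr0_norm.
split=> //; rewrite -subr_eq0 addrAC subrr add0r -normc_gt0 normc_real normr_gt0.
by rewrite gt_eqF.
Qed.

Lemma cderivXz g w (d : R[i]) (k : int) : g w != 0 -> has_cderiv g w d ->
  exists d', has_cderiv (fun z => g z ^ k) w d'.
Proof.
move=> g0 gd; have hX (n : nat) : exists d, has_cderiv (fun w => g w ^+ n) w d.
  elim: n => [|n [d1 IH]]; first by exists 0; exact: cderiv_cst.
  by eexists; under eq_fun do rewrite exprS; exact: cderivM gd IH.
case: k => n; first exact: hX.
have [d1 Hd1] := hX n.+1; eexists; under eq_fun do rewrite NegzE -exprnN.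
by apply: cderivV Hd1; rewrite expf_neq0.
Qed.

Lemma local_form_order f z m m' a a' : local_form f z m a -> local_form f z m' a' ->
  m = m'.
Proof.
move=> Ha Ha'.
have [h [r [_ _ a0 _ _]]] := Ha; have [h' [r' [_ _ a0' _ _]]] := Ha'.
have [s s0 Hs] := local_form_bounds Ha; have [s' s0' Hs'] := local_form_bounds Ha'.
apply/eqP; rewrite -subr_eq0; apply/eqP.
have na : 0 < normc a by rewrite normc_gt0.
have na' : 0 < normc a' by rewrite normc_gt0.
apply: (@bounded_pow_eq0 _ (normc a' / 2 / (normc a * 2)) (normc a' * 2 / (normc a / 2)) (Num.min s s')).
- by rewrite !divr_gt0 // mulr_gt0.
- by rewrite lt_min s0.
move=> t; rewrite lt_min => /andP[t0 /andP[ts ts']].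
have [tn tz] := normc_real_shift z t0; move: (z + _) tn tz => w tn wz.
have [|b Hb fb] := Hs w _ wz; first by rewrite tn.
have [|b' Hb' fb'] := Hs' w _ wz; first by rewrite tn.
have t0' : t != 0 by rewrite gt_eqF.
have nb : 0 < normc b.
  by case/andP: Hb => + _; apply: lt_trans; rewrite divr_gt0.
have : t ^ m * normc b = t ^ m' * normc b'.
  by rewrite -tn -!normcXz -!normcM -fb fb'.
move=> E; have -> : t ^ (m - m') = normc b' / normc b.
  rewrite expfzDr // -[m in LHS]addr0; apply: (mulIf (lt0r_neq0 nb)).
  rewrite divfK ?gt_eqF // addr0 mulrAC E mulrAC -expfzDr // subrr mul1r.
  by [].
case/andP: Hb => b1 b2; case/andP: Hb' => b1' b2'.
rewrite ler_pdivlMr // ler_pdivrMr //; apply/andP; split.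
  apply: (@le_trans _ _ (normc a' / 2)); last exact: ltW.
  rewrite -[leLHS]mulrA ler_piMr ?divr_ge0 ?normc_ge0 // mulrC ler_pdivrMr ?mulr_gt0 //.
  by rewrite mul1r ltW.
apply: (@le_trans _ _ (normc a' * 2)); first exact: ltW.
rewrite -[leRHS]mulrA ler_peMr ?mulr_ge0 ?normc_ge0 // mulrC ler_pdivlMr ?divr_gt0 //.
by rewrite mul1r ltW.
Qed.

Lemma local_form_coef f z m a a' : local_form f z m a -> local_form f z m a' -> a = a'.
Proof.
move=> [h [r [r0 hz a0 H1 H2]]] [h' [r' [r0' hz' a0' H1' H2']]].
apply/eqP; rewrite -subr_eq0 -normc_eq0 eq_le normc_ge0 andbT.
apply/ler_addgt0Pr => e e0; rewrite add0r.
have e20 : 0 < e / 2 by rewrite divr_gt0.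
have [|_ [d Hd]] := H1 z; first by rewrite subrr normc0.
have [|_ [d' Hd']] := H1' z; first by rewrite subrr normc0.
have [s s0 Hs] := cderiv_ccont Hd e20; have [s' s0' Hs'] := cderiv_ccont Hd' e20.
pose t := Num.min (Num.min r r') (Num.min s s') / 2.
have M0 : 0 < Num.min (Num.min r r') (Num.min s s') by rewrite !lt_min r0 r0' s0.
have t0 : 0 < t by rewrite divr_gt0.
have : t < Num.min (Num.min r r') (Num.min s s') by rewrite ltr_pdivrMr // ltr_pMr ?ltr1n.
rewrite !lt_min => /andP[/andP[tr tr'] /andP[ts ts']].
have [tn tz] := normc_real_shift z t0; move: (z + _) tn tz => w tn wz.
have hh : h w = h' w.
  have := H2 w; rewrite H2' // tn => // /(_ tr wz) /mulfI ->//.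
  by rewrite expfz_neq0 // subr_eq0.
rewrite -hz -hz'; apply: le_trans (normc_distD _ (h w) _) _.
rewrite (splitr e) lerD //; first by rewrite normc_distC ltW // Hs // tn.
by rewrite hh ltW // Hs' // tn.
Qed.

(** The order of vanishing, negative at a pole. *)
Definition ord f z : int := xget 0 [set m | exists a, local_form f z m a].
(** The leading coefficient of the Laurent expansion. *)
Definition lc f z : R[i] := xget 0 [set a | local_form f z (ord f z) a].

Section MeroOrder.
Variable f : R[i] -> R[i].
Hypotheses (fm : meromorphic f) (f0 : not_identically_zero f).

Lemma ordP z : local_form f z (ord f z) (lc f z).
Proof.
have [m [a Ha]] := mero_local_form z fm f0.
have [b Hb] : exists b, local_form f z (ord f z) b.
  by rewrite /ord; case: xgetP => [m' -> //|/(_ m) H]; exfalso; apply: H; exists a.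
by rewrite /lc; case: xgetP => [c -> //|/(_ b)].
Qed.

Lemma lc_neq0 z : lc f z != 0.
Proof. by have [h [r []]] := ordP z. Qed.

Lemma ord_hol z : holomorphic_at f z ->
  exists2 n : nat, ord f z = n & f z = 0 ^+ n * lc f z.
Proof.
have Hz := ordP z; have [h [r [r0 hz a0 H1 H2]]] := Hz.
move=> /hol_local[[s s0 Hs]|[n [a Ha fz]]].
  exfalso; have [h' [r' [r0' _ _ _ _]]] := Hz.
  pose t := Num.min r s / 2; have M0 : 0 < Num.min r s by rewrite lt_min r0.
  have t0 : 0 < t by rewrite divr_gt0.
  have : t < Num.min r s by rewrite ltr_pdivrMr // ltr_pMr ?ltr1n.
  rewrite lt_min => /andP[tr ts].
  have [tn tz] := normc_real_shift z t0; move: (z + _) tn tz => w tn wz.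
  have := H2 w; rewrite Hs ?tn // => /(_ tr wz) /eqP; rewrite eq_sym mulf_eq0.
  rewrite expfz_eq0 subr_eq0 (negbTE wz) andbF /=.
  by have := H1 w; rewrite tn => /(_ tr)[/negbTE ->].
have E := local_form_order Hz Ha; exists n => //.
by rewrite fz; congr (_ * _); apply: local_form_coef Ha _; rewrite -E.
Qed.

Lemma ord_pole z : is_pole f z <-> ord f z < 0.
Proof.
split=> [/pole_local[n [a Ha]]|].
  by rewrite (local_form_order (ordP z) Ha).
by case: (fm z) => // /ord_hol[n ->].
Qed.

Lemma ord_eq0 z : ord f z = 0 -> holomorphic_at f z /\ f z = lc f z.
Proof.
move=> oz; case: (fm z) => [fz|/ord_pole]; last by rewrite oz.
split=> //; have [n] := ord_hol fz; rewrite oz => -[<-].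
by rewrite mul1r.
Qed.

Lemma ord_isolated z : exists2 r, 0 < r & forall w, normc (w - z) < r -> w != z ->
  ord f w = 0.
Proof.
have [h [r [r0 hz a0 H1 H2]]] := ordP z; exists r => // w wr wz.
have fw : holomorphic_at f w.
  apply/holE; have wz0 : 0 < normc (w - z) by rewrite normc_gt0 subr_eq0.
  exists (Num.min (normc (w - z)) (r - normc (w - z))); first by rewrite lt_min wz0 subr_gt0.
  move=> u; rewrite lt_min => /andP[u1 u2].
  have uz : u != z by apply: contraTneq u1 => ->; rewrite normc_distC ltxx.
  have ur : normc (u - z) < r.
    by apply: le_lt_trans (normc_distD _ w _) _; rewrite -ltrBrDr.
  (* f agrees near u with the product (. - z)^m h *)
  have [_ [d Hd]] := H1 u ur.
  have uz0 : u - z != 0 by rewrite subr_eq0.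
  have [d' Hd'] : exists d', has_cderiv (fun w => (w - z) ^ ord f z) u d'.
    exact: (@cderivXz (fun w => w - z) u _ _ uz0 (cderivB (cderiv_id u) (cderiv_cst z u))).
  eexists; apply: (@cderiv_near _ _ _ _ _ (Num.min (normc (u - z)) (r - normc (u - z)))) (cderivM Hd' Hd).
    by rewrite lt_min normc_gt0 uz0 subr_gt0.
  move=> v; rewrite lt_min => /andP[v1 v2]; rewrite H2 //.
    by apply: le_lt_trans (normc_distD _ u _) _; rewrite -ltrBrDr.
  by apply: contraTneq v1 => ->; rewrite normc_distC ltxx.
have [n on fwE] := ord_hol fw.
have : f w != 0.
  rewrite H2 // mulf_neq0 ?expfz_neq0 ?subr_eq0 //; exact: (proj1 (H1 w wr)).
by rewrite on fwE; case: n {on fwE} => // n; rewrite exprS !mul0r eqxx.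
Qed.

Lemma pole_orderE z : ord f z < 0 -> pole_order f z = `|ord f z|%N.
Proof.
move=> oz; have H := ordP z; have [h [r [r0 hz a0 H1 H2]]] := H.
have on : ord f z = - (`|ord f z|%N : int) by rewrite ltz0_abs ?opprK.
have [|_ [d Hd]] := H1 z; first by rewrite subrr normc0.
rewrite /pole_order; case: xgetP => [n _ [l l0 Hl]|/(_ `|ord f z|%N)]; last first.
  case; exists (lc f z) => //.
  apply/cvgrPdist_lt => e; case: e => e ei; rewrite ltcE /= => /andP[/eqP -> e0].
  apply/dnbhs_normc.
  have [s s0 Hs] := cderiv_ccont Hd e0.
  exists (Num.min r s) => [|w]; first by rewrite lt_min r0.
  rewrite lt_min => /andP[wr ws] wz; rewrite H2 //.
  have -> : (w - z) ^ ord f z = (w - z) ^- `|ord f z|%N by rewrite {1}on -exprnN.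
  rewrite mulVKf; last first.
    by rewrite expf_neq0 // subr_eq0.
  rewrite ltcE /= eqxx /= normc_distC -hz; exact: Hs.
have nl : 0 < normc l by rewrite normc_gt0.
have [s s0 Hs] : exists2 s, 0 < s & forall w, normc (w - z) < s -> w != z ->
    normc l / 2 < normc ((w - z) ^+ n * f w) < normc l * 2.
  have /cvgrPdist_lt/(_ (normc l / 2)%:C) := Hl.
  rewrite ltcE /= eqxx /= divr_gt0 // => /(_ isT) /dnbhs_normc[s s0 Hs].
  exists s => // w ws wz; have := Hs w ws wz; rewrite ltcE /= eqxx /=.
  have := normc_triB l ((w - z) ^+ n * f w).
  have := normc_triB ((w - z) ^+ n * f w) l; rewrite (normc_distC _ l).
  move: (normc (l - _)) (normc (_ * _)) => x y; lra.
have [s' s0' Hs'] := local_form_bounds H.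
have na : 0 < normc (lc f z) by rewrite normc_gt0.
suff E : (n : int) + ord f z = 0.
  by move/eqP: E; rewrite {1}on subr_eq0 eqz_nat => /eqP.
apply: (@bounded_pow_eq0 _ (normc l / 2 / (normc (lc f z) * 2))
  (normc l * 2 / (normc (lc f z) / 2)) (Num.min s s')).
- by rewrite !divr_gt0 // mulr_gt0.
- by rewrite lt_min s0.
move=> t; rewrite lt_min => /andP[t0 /andP[ts ts']].
have [tn tz] := normc_real_shift z t0; move: (z + _) tn tz => w tn wz.
have [|b Hb fb] := Hs' w _ wz; first by rewrite tn.
have := Hs w; rewrite tn fb => /(_ ts wz).
have t0' : t != 0 by rewrite gt_eqF.
have nb : 0 < normc b.
  by case/andP: Hb => + _; apply: lt_trans; rewrite divr_gt0.
rewrite mulrA normcM normcM normcX normcXz tn -(expfzDr n%:Z) //.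
move: (t ^ _) => x /andP[x1 x2]; case/andP: Hb => b1 b2.
rewrite ler_pdivrMr ?mulr_gt0 // ler_pdivlMr ?divr_gt0 //; apply/andP.
have x0 : 0 < x by rewrite -(pmulr_lgt0 _ nb); apply: lt_trans x1; rewrite divr_gt0.
split; first by apply/ltW/(lt_trans x1); rewrite ltr_pM2l.
by apply/ltW; apply: lt_trans x2; rewrite ltr_pM2l.
Qed.

(** Zeros and poles are isolated, hence finitely many on a compact square. *)
Lemma finite_ord (rho : R) : finite_set [set z | normc z <= rho /\ ord f z != 0].
Proof.
pose c (p : R * R) : R[i] := p.1 +i* p.2.
pose K := (`[- rho, rho]%classic `*` `[- rho, rho]%classic) : set (R * R).
have cK : compact K by apply: compact_setX; exact: segment_compact.
have [r Hr] := choice (fun z => let: ex_intro2 r r0 H := ord_isolated z in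
  ex_intro (fun r => 0 < r /\ forall w, normc (w - z) < r -> w != z -> ord f w = 0) r (conj r0 H)).
pose U (p : R * R) := [set q : R * R | normc (c q - c p) < r (c p)].
pose T : ptopologicalType := HB.pack (R * R)%type.
(* the subcover is extracted in the plane, seen as a pointed space *)
have cK' : @cover_compact T K by rewrite -compact_cover; exact: cK.
have [S finS HS] : exists2 S : set (R * R), finite_set S & K `<=` cover S U.
  have [||D _ HD] := cK' (R * R)%type setT U.
  - move=> p _; rewrite openE => q /= qp; apply/nbhs_ballP.
    have e0 : 0 < (r (c p) - normc (c q - c p)) / 2 by rewrite divr_gt0 // subr_gt0.
    exists ((r (c p) - normc (c q - c p)) / 2) => //= q' [/=]; rewrite /ball /= => h1 h2.
    apply: le_lt_trans (normc_distD _ (c q) _) _; rewrite -ltrBrDr.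
    apply: le_lt_trans (normc_le_ReIm _) _; rewrite cReD cReN cImD cImN /=.
    by rewrite (splitr (r (c p) - _)) ltrD // distrC.
  - move=> p _; exists p => //; change (normc (c p - c p) < r (c p)).
    by rewrite subrr normc0; case: (Hr (c p)).
  - by eexists; [|exact: HD]; exact: finite_fset.
apply: sub_finite_set (finite_image c finS).
move=> z [/= zr oz].
have : K (complex.Re z, complex.Im z).
  by rewrite /K /= !in_itv /= -!ler_norml (le_trans (normc_Re _)) // (le_trans (normc_Im _)).
move=> /HS[p pD] Uz.
have Hz : normc (c (complex.Re z, complex.Im z) - c p) < r (c p) := Uz.
exists p => //; apply/eqP; rewrite eq_sym; apply: contraNT oz => zp; apply/eqP.
have cz : c (complex.Re z, complex.Im z) = z by case: (z).
by rewrite cz in Hz; apply: (proj2 (Hr (c p))).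
Qed.

End MeroOrder.

End Order.

(** * The logarithm of the modulus of a zero-free function *)

Section RealMean.
Context {R : realType}.

Definition rmean (f : R -> R) : R := (2 * pi)^-1 * rint 0 (2 * pi) f.

Lemma Re_cmean (F : R -> R[i]) : complex.Re (cmean F) = rmean (fun t => complex.Re (F t)).
Proof. by rewrite /cmean cReCM. Qed.

Lemma eq_rmean (f g : R -> R) : (forall t, f t = g t) -> rmean f = rmean g.
Proof. by move=> fg; rewrite /rmean; congr (_ * _); apply: eq_rint. Qed.

Lemma rmean_cst (k : R) : rmean (fun=> k) = k.
Proof.
by rewrite /rmean rint_cst ?twopi_ge0 // subr0 mulrCA mulVf ?mulr1 // gt_eqF // twopi_gt0.
Qed.

Lemma rmeanD (f g : R -> R) : continuous f -> continuous g ->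
  rmean (fun t => f t + g t) = rmean f + rmean g.
Proof. by move=> cf cg; rewrite /rmean rintD // mulrDr. Qed.

Lemma rmeanB (f g : R -> R) : continuous f -> continuous g ->
  rmean (fun t => f t - g t) = rmean f - rmean g.
Proof. by move=> cf cg; rewrite /rmean rintB // mulrBr. Qed.

Lemma rmeanZ k (f : R -> R) : continuous f -> rmean (fun t => k * f t) = k * rmean f.
Proof. by move=> cf; rewrite /rmean rintZ // mulrCA. Qed.

Lemma rmean_le (f g : R -> R) : continuous f -> continuous g ->
  (forall t, 0 <= t <= 2 * pi -> f t <= g t) -> rmean f <= rmean g.
Proof.
by move=> cf cg fg; rewrite /rmean ler_wpM2l ?invr_ge0 ?twopi_ge0 // rint_le.
Qed.

Lemma cont_norm (f : R -> R) : continuous f -> continuous (fun t => `|f t|).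
Proof. by move=> cf t; apply: cvg_norm; exact: cf. Qed.

Lemma cont_mulr (f g : R -> R) : continuous f -> continuous g ->
  continuous (fun t => f t * g t).
Proof. by move=> cf cg t; apply: cvgM; [exact: cf|exact: cg]. Qed.

Lemma cont_add (f g : R -> R) : continuous f -> continuous g ->
  continuous (fun t => f t + g t).
Proof. by move=> cf cg t; apply: cvgD; [exact: cf|exact: cg]. Qed.

Lemma cont_sub (f g : R -> R) : continuous f -> continuous g ->
  continuous (fun t => f t - g t).
Proof. by move=> cf cg t; apply: cvgB; [exact: cf|exact: cg]. Qed.

Lemma rmean_abs (f : R -> R) M : continuous f ->
  (forall t, 0 <= t <= 2 * pi -> `|f t| <= M) -> `|rmean f| <= M.
Proof.
move=> cf fM; rewrite -(rmean_cst M) /rmean normrM ger0_norm ?invr_ge0 ?twopi_ge0 //.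
rewrite ler_wpM2l ?invr_ge0 ?twopi_ge0 //; apply: le_trans (rint_abs _ _ cf) _.
by apply: rint_le => //; [exact: cont_norm|exact: cst_continuous].
Qed.

Lemma normc_cmean_weight (u : R -> R) (K : R -> R[i]) M : continuous u -> pcont K ->
  (forall t, normc (K t) <= M) ->
  normc (cmean (fun t => (u t)%:C * K t)) <= 2 * M * rmean (fun t => `|u t|).
Proof.
move=> cu hK KM; have cn := cont_norm cu.
rewrite /cmean normcM normc_real ger0_norm ?invr_ge0 ?twopi_ge0 //.
rewrite /rmean mulrCA ler_wpM2l ?invr_ge0 ?twopi_ge0 // -mulrA -rintZ //.
apply: normc_cint.
- by apply: pcontM => //; exact: pcont_real.
- by apply: cont_mulr => //; exact: cst_continuous.
- by move=> t _; rewrite normcM normc_real mulrC ler_wpM2r.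
Qed.

(** Each of n equal steps contributes at most C / n^2. *)
Lemma quad_variation (psi : R -> R) (C : R) :
  (forall s s', 0 <= s <= 1 -> 0 <= s' <= 1 ->
     `|psi s' - psi s| <= C * (s' - s) ^+ 2) -> psi 1 = psi 0.
Proof.
move=> H; apply/eqP; rewrite -subr_eq0 -normr_eq0 eq_le normr_ge0 andbT.
have C0 : 0 <= C.
  have h0 : 0 <= (0 : R) <= 1 by rewrite lexx ler01.
  have h1 : 0 <= (1 : R) <= 1 by rewrite lexx ler01.
  have := H 0 1 h0 h1; rewrite subr0 expr1n mulr1.
  exact: le_trans.
apply/ler_addgt0Pr => e e0; rewrite add0r.
have [n Hn] : exists n : nat, C / e < n.+1%:R.
  exists (Num.truncn (C / e)).
  by have /andP[] := truncn_itv (divr_ge0 C0 (ltW e0)).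
have n0 : 0 < n.+1%:R :> R by rewrite ltr0n.
have step (k : nat) : (k <= n.+1)%N ->
    `|psi (k%:R / n.+1%:R) - psi 0| <= k%:R * (C / n.+1%:R ^+ 2).
  elim: k => [|k IH] kn; first by rewrite !mul0r subrr normr0.
  have -> : psi (k.+1%:R / n.+1%:R) - psi 0 = (psi (k%:R / n.+1%:R) - psi 0) +
      (psi (k.+1%:R / n.+1%:R) - psi (k%:R / n.+1%:R)) by rewrite [RHS]addrC addrA subrK.
  apply: le_trans (ler_normD _ _) _; rewrite -[k.+1%:R in leRHS]natr1 mulrDl mul1r lerD ?IH ?(ltnW kn) //.
  have b j : (j <= n.+1)%N -> 0 <= (j%:R / n.+1%:R : R) <= 1.
    by move=> jn; rewrite divr_ge0 //= ler_pdivrMr // mul1r ler_nat.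
  apply: le_trans (H _ _ (b _ (ltnW kn)) (b _ kn)) _.
  by rewrite -mulrBl -[k.+1%:R]natr1 addrAC subrr add0r mul1r exprVn.
have := step n.+1 (leqnn _); rewrite divff ?gt_eqF // => /le_trans; apply.
have n1 : n.+1%:R != 0 :> R by rewrite gt_eqF.
have -> : n.+1%:R * (C / n.+1%:R ^+ 2) = C / n.+1%:R by move: n1; move: n.+1%:R => x x0; field.
by rewrite ler_pdivrMr // mulrC -ler_pdivrMr // ltW.
Qed.

End RealMean.

Section Conjugate.
Context {R : realType}.
Implicit Types z w : R[i].

Lemma conjM z w : ((z * w)^*)%C = (z^*)%C * (w^*)%C.
Proof. exact: (rmorphM (@conjc R)). Qed.
Lemma conjB z w : ((z - w)^*)%C = (z^*)%C - (w^*)%C.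
Proof. exact: (rmorphB (@conjc R)). Qed.
Lemma conjV z : ((z^-1)^*)%C = ((z^*)%C)^-1.
Proof. exact: (fmorphV (@conjc R)). Qed.
End Conjugate.

Section ZeroFree.
Context {R : realType}.
Implicit Types (z w : R[i]).

Lemma ln_normcE z :
  ln (normc z) = 2^-1 * ln (complex.Re z ^+ 2 + complex.Im z ^+ 2) :> R.
Proof.
have [->|z0] := eqVneq z 0.
  by rewrite normc0 /= !expr0n /= addr0 ln0 // mulr0.
rewrite -sqr_normcE lnXn ?normc_gt0 //; move: (ln _) => x; by field.
Qed.

(** Locally log |g| is the real part of a logarithm of g. *)
Lemma is_derive_ln_normc g (gam : R -> R[i]) (t : R) a d :
  g (gam t) != 0 -> has_cderiv g (gam t) a -> has_pderiv gam t d ->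
  is_derive t 1 (fun s : R => ln (normc (g (gam s)))) (complex.Re (a / g (gam t) * d)).
Proof.
move=> g0 ga gd; have [H1 H2] := pderiv_chain ga gd.
under eq_fun do rewrite ln_normcE.
have q0 : 0 < complex.Re (g (gam t)) ^+ 2 + complex.Im (g (gam t)) ^+ 2.
  by rewrite -sqr_normcE exprn_gt0 // normc_gt0.
have Hq : is_derive t 1 (fun s : R => complex.Re (g (gam s)) ^+ 2 + complex.Im (g (gam s)) ^+ 2)
   (2 * (complex.Re (g (gam t)) * complex.Re (a * d) + complex.Im (g (gam t)) * complex.Im (a * d))).
  apply: is_derive_eq; rewrite /GRing.scale /=; ring.
have Hl : is_derive (complex.Re (g (gam t)) ^+ 2 + complex.Im (g (gam t)) ^+ 2) 1 (@ln R)
   (complex.Re (g (gam t)) ^+ 2 + complex.Im (g (gam t)) ^+ 2)^-1.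
  exact: is_derive1_ln.
have Hc := @is_derive1_comp R (@ln R) (fun s : R =>
  complex.Re (g (gam s)) ^+ 2 + complex.Im (g (gam s)) ^+ 2) t _ _ Hl Hq.
apply: is_derive_eq (@is_deriveZ _ _ _ _ 2^-1 t 1 _ Hc) _.
rewrite /GRing.scale /= !cReM; move: q0.
case: (g (gam t)) => x y /= q0; case: a d {ga gd H1 H2 Hq Hc} => a1 a2 [d1 d2] /=.
by field; rewrite gt_eqF.
Qed.

Variables (g : R[i] -> R[i]) (rho rho1 : R).
Hypotheses (rho0 : 0 < rho) (rho01 : rho < rho1).
Hypothesis g0 : forall w, normc w < rho1 -> g w != 0.
Hypothesis gd : forall w, normc w < rho1 -> exists d, has_cderiv g w d.

Let u w := ln (normc (g w)).
Let L w := cder g w / g w.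

Let L_deriv w : normc w < rho1 -> exists d, has_cderiv L w d.
Proof.
move=> wr; pose r := (normc w + rho1) / 2.
have wr' : normc (w - 0) < r by rewrite subr0 /r; lra.
have r0 : 0 < r by apply: le_lt_trans wr'; exact: normc_ge0.
have rd v : normc (v - 0) <= r -> exists d, has_cderiv g v d.
  by rewrite subr0 => vr; apply: gd; apply: le_lt_trans vr _; rewrite /r; lra.
have [d Hd] := cder_deriv r0 rd wr'.
have [d' Hd'] := gd wr.
by eexists; apply: cderivM Hd (cderivV (g0 wr) Hd').
Qed.

(** The segment from w to w' stays in the disc of radius max(|w|, |w'|). *)
Let u_mvt w w' : normc w < rho1 -> normc w' < rho1 ->
  exists2 x, normc (x - w) <= normc (w' - w) /\ normc x <= Num.max (normc w) (normc w') &
    u w' - u w = complex.Re (L x * (w' - w)).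
Proof.
move=> wr wr'.
pose ga (t : R) := w + t%:C * (w' - w).
have ga_le (t : R) : 0 <= t <= 1 -> normc (ga t) <= Num.max (normc w) (normc w').
  move=> /andP[t0 t1]; have -> : ga t = (1 - t)%:C * w + t%:C * w'.
    by rewrite /ga rmorphB rmorph1; ring.
  apply: le_trans (normcD _ _) _; rewrite !normcM !normc_real !ger0_norm ?subr_ge0 //.
  apply: (@le_trans _ _ ((1 - t) * Num.max (normc w) (normc w') + t * Num.max (normc w) (normc w'))).
    by rewrite lerD // ler_wpM2l ?subr_ge0 // le_max lexx ?orbT.
  by rewrite -mulrDl subrK mul1r.
have M1 : Num.max (normc w) (normc w') < rho1 by rewrite gt_max wr wr'.
have gad t : has_pderiv ga t (w' - w).
  have idd : has_pderiv (fun t : R => t%:C) t (1%:C).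
    by apply: (@pderiv_real _ id); exact: is_derive_id.
  have := pderivD (pderiv_cst w t) (pderivM idd (pderiv_cst (w' - w) t)).
  by move/pderiv_eq; apply; rewrite mulr0 addr0 add0r mul1r.
have ga1 (t : R) : 0 <= t <= 1 -> normc (ga t) < rho1.
  by move=> /ga_le ht; exact: le_lt_trans ht M1.
have du (t : R) : 0 <= t <= 1 ->
    is_derive t 1 (fun s : R => u (ga s)) (complex.Re (L (ga t) * (w' - w))).
  move=> /ga1 tr; have [d Hd] := gd tr.
  exact: is_derive_ln_normc (g0 tr) (cderP Hd) (gad t).
have cu : {within `[0, 1], continuous (fun s : R => u (ga s))}.
  by apply: derivable_within_continuous => t; rewrite in_itv /= => /du[].
have [|t t01] := @MVT R (fun s : R => u (ga s)) (fun t => complex.Re (L (ga t) * (w' - w))) 0 1 ltr01 _ cu.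
  by move=> t; rewrite in_itv /= => /andP[t0 t1]; apply: du; rewrite !ltW.
rewrite subr0 mulr1; have -> : ga 1 = w' by rewrite /ga mul1r addrC subrK.
have -> : ga 0 = w by rewrite /ga mul0r addr0.
rewrite in_itv /= in t01; case/andP: t01 => t0 t1.
have t01 : 0 <= t <= 1 by rewrite !ltW.
move=> E; exists (ga t) => //; split; last exact: ga_le.
rewrite /ga addrAC subrr add0r normcM normc_real ger0_norm ?(ltW t0) //.
by rewrite ler_piMl ?normc_ge0 // ltW.
Qed.

(** Cauchy's formula for L on a larger circle has a kernel that is Lipschitz
    in the centre. *)
Let L_lipschitz : exists2 C, 0 <= C & forall w w', normc w <= rho -> normc w' <= rho ->
  normc (L w - L w') <= C * normc (w - w').
Proof.
pose r := (rho + rho1) / 2.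
have rr : rho < r by move: rho01; rewrite /r; lra.
have r1 : r < rho1 by move: rho01; rewrite /r; lra.
have r0 : 0 < r by exact: lt_trans rr.
have Ld w : normc (w - 0) <= r -> exists d, has_cderiv L w d.
  by rewrite subr0 => wr; apply: L_deriv; exact: le_lt_trans wr r1.
have pL := pcont_disc r0 Ld.
have [M M0 HM] := pcont_bounded pL.
exists (2 * (M * (r / ((r - rho) * (r - rho))))) => [|w w' wr wr'].
  have h : 0 <= (r - rho) * (r - rho) by rewrite -expr2 sqr_ge0.
  exact: (mulr_ge0 (ler0n _ 2) (mulr_ge0 M0 (divr_ge0 (ltW r0) h))).
have wr1 := le_lt_trans wr rr; have wr1' := le_lt_trans wr' rr.
rewrite -[L w](cauchy_disc Ld) ?subr0 // -[L w'](cauchy_disc Ld) ?subr0 //.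
have k1 := pcont_ckernel wr1; have k2 := pcont_ckernel wr1'.
rewrite -cmeanB; try exact: pcontM.
rewrite -mulrA; apply: normc_cmean => [|t tp]; first by apply: pcontB; exact: pcontM.
have c1 := circ_sub_neq0 t wr1; have c2 := circ_sub_neq0 t wr1'.
have -> : L (0 + circ r t) * ckernel r w t - L (0 + circ r t) * ckernel r w' t =
   L (0 + circ r t) * (circ r t * ((circ r t - w)^-1 * (circ r t - w')^-1)) * (w - w').
  by rewrite /ckernel; field; apply/andP.
rewrite normcM ler_wpM2r ?normc_ge0 // normcM ler_pM ?normc_ge0 ?HM //.
rewrite normcM normc_circ ?(ltW r0) // ler_wpM2l ?(ltW r0) // normcM invfM.
rewrite !normcV ler_pM ?invr_ge0 ?normc_ge0 //.
  rewrite lef_pV2 ?posrE ?subr_gt0 ?normc_gt0 //.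
  by apply: le_trans (normc_circ_sub _ _ (ltW r0)); rewrite lerB.
rewrite lef_pV2 ?posrE ?subr_gt0 ?normc_gt0 //.
by apply: le_trans (normc_circ_sub _ _ (ltW r0)); rewrite lerB.
Qed.

Let circ_lt s t : 0 <= s <= 1 -> normc (s%:C * circ rho t) < rho1.
Proof.
move=> /andP[s0 s1]; rewrite normcM normc_real ger0_norm // normc_circ ?(ltW rho0) //.
by apply: le_lt_trans rho01; rewrite ler_piMl ?(ltW rho0).
Qed.

Let circ_lt1 t : normc (circ rho t) < rho1.
Proof. by rewrite normc_circ // ltW. Qed.

Let pcont_scirc s : pcont (fun t => s%:C * circ rho t).
Proof. by apply: pcontM; [exact: pcont_cst|exact: pcont_circ]. Qed.

Let pcont_L s : 0 <= s <= 1 -> pcont (fun t => L (s%:C * circ rho t)).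
Proof.
move=> s01; apply: pcont_comp => // t; have [d Hd] := L_deriv (circ_lt t s01).
exact: cderiv_ccont Hd.
Qed.

Lemma cont_ln_normc (F : R -> R[i]) : pcont F -> (forall t, normc (F t) < rho1) ->
  continuous (fun t => u (F t)).
Proof.
move=> hF Fr; have pg : pcont (fun t => g (F t)).
  by apply: pcont_comp => // t; have [d Hd] := gd (Fr t); exact: cderiv_ccont Hd.
move=> t; apply: (@continuous_comp _ _ _ (fun t => normc (g (F t))) (@ln R)).
  exact: pcont_normc.
by apply: continuous_ln; rewrite normc_gt0; exact: g0.
Qed.

(** The mean of log |g| over the circle of radius s rho does not depend on s:
    its derivative is the mean of Re (w g'/g) up to a factor, which vanishes
    by Cauchy's formula at 0. Instead of differentiating under the integral
    sign, the proof bounds the increments quadratically, by [L_lipschitz]. *)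
Lemma mean_ln_normc : rmean (fun t => ln (normc (g (circ rho t)))) = ln (normc (g 0)).
Proof.
have [C C0 HC] := L_lipschitz.
pose psi s := rmean (fun t => u (s%:C * circ rho t)).
have -> : rmean (fun t => ln (normc (g (circ rho t)))) = psi 1.
  by apply: eq_rmean => t; rewrite mul1r.
have -> : ln (normc (g 0)) = psi 0.
  by rewrite /psi -[LHS]rmean_cst; apply: eq_rmean => t; rewrite mul0r.
apply: (@quad_variation _ _ (rho * (C * rho))) => s s' s01 s01'.
have Z : rmean (fun t => complex.Re (circ rho t * L (s%:C * circ rho t))) = 0.
  rewrite -Re_cmean.
  have z0 : normc (0 : R[i]) < rho by rewrite normc0.
  suff dL w : normc w <= rho -> exists d, has_cderiv (fun w => w * L (s%:C * w)) w d.
    have := @cauchy_formula _ (fun w => w * L (s%:C * w)) rho 0 z0 dL.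
    rewrite mul0r (_ : cmean _ = cmean (fun t => circ rho t * L (s%:C * circ rho t))) => [->//|].
    apply: eq_cmean => t; rewrite /ckernel subr0 divff ?mulr1 //.
    by rewrite -normc_gt0 normc_circ // ltW.
  move=> wr.
  have sw : normc (s%:C * w) < rho1.
    case/andP: s01 => s0 s1; rewrite normcM normc_real ger0_norm //.
    by apply: le_lt_trans rho01; apply: le_trans wr; rewrite ler_piMl ?normc_ge0.
  have [d Hd] := L_deriv sw.
  have Hs : has_cderiv (fun w => s%:C * w) w (0 * w + s%:C * 1).
    exact: cderivM (cderiv_cst _ _) (cderiv_id w).
  have [d' Hd'] : exists d', has_cderiv (fun w => L (s%:C * w)) w d'.
    have [s0|s0] := eqVneq s 0.
      exists 0; rewrite s0; under eq_fun do rewrite mul0r; exact: cderiv_cst.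
    exists (s%:C * d); apply/cderivE => e e0; have /cderivE H := Hd.
    have ns : 0 < `|s| by rewrite normr_gt0.
    have [r r0 Hr] := H _ (divr_gt0 e0 ns).
    exists (r / `|s|) => [|h hr]; first by rewrite divr_gt0.
    have nh : normc (s%:C * h) = `|s| * normc h by rewrite normcM normc_real.
    have := Hr (s%:C * h); rewrite nh => Hk.
    have {}Hk := Hk _; have /Hk : `|s| * normc h < r by rewrite mulrC -ltr_pdivlMr.
    by rewrite [e / _ * _]mulrA divfK ?gt_eqF // mulrDr [s%:C * d]mulrC -[d * _ * h]mulrA.
  by eexists; exact: cderivM (cderiv_id w) Hd'.
have cu1 := cont_ln_normc (pcont_scirc s) (fun t => circ_lt t s01).
have cu2 := cont_ln_normc (pcont_scirc s') (fun t => circ_lt t s01').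
have cL : continuous (fun t => complex.Re (circ rho t * L (s%:C * circ rho t))).
  have [] := pcontM (pcont_circ rho) (pcont_L s01); by [].
have cL' : continuous (fun t => (s' - s) * complex.Re (circ rho t * L (s%:C * circ rho t))).
  by apply: cont_mulr => //; exact: cst_continuous.
have -> : psi s' - psi s = rmean (fun t => u (s'%:C * circ rho t) - u (s%:C * circ rho t)
    - (s' - s) * complex.Re (circ rho t * L (s%:C * circ rho t))).
  by rewrite rmeanB ?rmeanZ ?rmeanB ?Z ?mulr0 ?subr0 //; exact: cont_sub.
apply: rmean_abs => [|t _]; first by apply: cont_sub => //; exact: cont_sub.
have [x [x1 x2] ->] := u_mvt (circ_lt t s01) (circ_lt t s01').
have e1 : s'%:C * circ rho t - s%:C * circ rho t = (s' - s)%:C * circ rho t.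
  by rewrite rmorphB mulrBl.
have sr (a : R) : 0 <= a <= 1 -> normc (a%:C * circ rho t) <= rho.
  move=> /andP[a0 a1]; rewrite normcM normc_real ger0_norm // normc_circ ?(ltW rho0) //.
  by rewrite ler_piMl // ltW.
rewrite e1 in x1 *.
rewrite -cReCM -cReN -cReD.
apply: le_trans (normc_Re _) _.
have -> : L x * ((s' - s)%:C * circ rho t) - (s' - s)%:C * (circ rho t * L (s%:C * circ rho t))
  = ((s' - s)%:C * circ rho t) * (L x - L (s%:C * circ rho t)) by ring.
have n1 : normc ((s' - s)%:C * circ rho t) = `|s' - s| * rho.
  by rewrite normcM normc_real normc_circ // ltW.
rewrite normcM n1.
apply: (@le_trans _ _ (`|s' - s| * rho * (C * (`|s' - s| * rho)))).
  rewrite ler_wpM2l ?mulr_ge0 ?(ltW rho0) //; apply: le_trans (HC _ _ _ (sr _ s01)) _.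
    by apply: le_trans x2 _; rewrite ge_max !sr.
  by rewrite ler_wpM2l // (le_trans x1) // n1.
rewrite -(@real_normK _ (s' - s)) ?num_real //.
by rewrite le_eqVlt; apply/orP; left; apply/eqP; ring.
Qed.

Let U := rmean (fun t => `|u (circ rho t)|).

Let cont_uc : continuous (fun t => u (circ rho t)).
Proof. exact: (cont_ln_normc (pcont_circ rho)). Qed.

(** Cauchy's formula for w g'/g, whose boundary values have the tangential
    derivative of log |g| as imaginary part up to sign. The conjugate of the
    boundary values contributes nothing, and an integration by parts removes
    the derivative. *)
Let log_deriv_formula z : normc z < rho -> z != 0 ->
  L z = 2 * cmean (fun t => (u (circ rho t))%:C * (circ rho t * (circ rho t - z)^-1 ^+ 2)).
Proof.
move=> zr z0.
pose p t := circ rho t * L (circ rho t).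
have h01 : 0 <= (1 : R) <= 1 by rewrite lexx ler01.
have pp : pcont p.
  apply: pcontM; first exact: pcont_circ.
  by have := pcont_L h01; under eq_fun do rewrite mul1r.
have Pd w : normc w <= rho -> exists d, has_cderiv (fun w => w * L w) w d.
  move=> wr; have [d Hd] := L_deriv (le_lt_trans wr rho01).
  by eexists; exact: cderivM (cderiv_id w) Hd.
have c0 t := circ_sub_neq0 t zr.
have cc0 t : circ rho t != 0 by rewrite -normc_gt0 normc_circ // ltW.
have K0 := pcont_ckernel zr.
have pc : pcont (fun t => (circ rho t - z)^-1).
  by apply: pcontV => //; apply: pcontB; [exact: pcont_circ|exact: pcont_cst].
have E1 : cmean (fun t => p t * ckernel rho z t) = z * L z.
  exact: (@cauchy_formula _ (fun w => w * L w) rho z zr Pd).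
have E2 : cmean (fun t => ((p t)^*)%C * ckernel rho z t) = 0.
  have zc w : normc w <= rho -> (rho ^+ 2)%:C - (z^*)%C * w != 0.
    move=> wr; rewrite -normc_gt0; apply: lt_le_trans (normc_triB _ _).
    rewrite normc_real normcM normc_conj ger0_norm ?sqr_ge0 // subr_gt0 expr2.
    apply: (@le_lt_trans _ _ (normc z * rho)); first by rewrite ler_wpM2l ?normc_ge0.
    by rewrite ltr_pM2r.
  pose h w := w * L w * ((rho ^+ 2)%:C / ((rho ^+ 2)%:C - (z^*)%C * w)).
  have hd w : normc w <= rho -> exists d, has_cderiv h w d.
    move=> wr; have [d Hd] := Pd w wr; eexists; apply: cderivM Hd _.
    apply: cderivM; first exact: cderiv_cst.
    apply: (cderivV (f := fun w => (rho ^+ 2)%:C - (z^*)%C * w)); first exact: zc.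
    apply: cderivB; first exact: cderiv_cst.
    by apply: cderivM; [exact: cderiv_cst|exact: cderiv_id].
  have z00 : normc (0 : R[i]) < rho by rewrite normc0.
  have H := @cauchy_formula _ h rho 0 z00 hd.
  have cj (F : R -> R[i]) : pcont F -> cmean (fun t => ((F t)^*)%C) = ((cmean F)^*)%C.
    by move=> hF; rewrite /cmean cint_conj // conjM /= oppr0.
  have phc : pcont (fun t => h (circ rho t)).
    apply: pcontM => //; apply: pcontM; first exact: pcont_cst.
    apply: pcontV => [t|]; first by apply: zc; rewrite normc_circ // ltW.
    apply: pcontB; first exact: pcont_cst.
    by apply: pcontM; [exact: pcont_cst|exact: pcont_circ].
  have -> : cmean (fun t => ((p t)^*)%C * ckernel rho z t) =
      cmean (fun t => ((h (circ rho t))^*)%C).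
    apply: eq_cmean => t; rewrite /h conjM -/(p t); congr (_ * _).
    have -> : (rho ^+ 2)%:C = circ rho t * ((circ rho t)^*)%C.
      have := normc_circ t (ltW rho0); case: (circ rho t) => x y H0.
      apply: complex_ext; rewrite ?cReM ?cImM /=; last by ring.
      by rewrite mulrN opprK -!expr2 -H0 sqr_normcE.
    rewrite conjM conjV conjB !conjM !conjcK /ckernel.
    have c1 : ((circ rho t)^*)%C != 0 by rewrite -normc_gt0 normc_conj normc_gt0.
    by field; rewrite c0 andbT [X in X - _]mulrC -mulrBl mulf_neq0 // c0.
  rewrite cj // (_ : cmean (fun t => h (circ rho t)) = 0) ?rmorph0 //.
  have := H; rewrite {2}/h mul0r mul0r => <-; apply: eq_cmean => t.
  by rewrite /ckernel subr0 divff ?mulr1.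
(* tangential derivative of log |g| *)
pose ut t := complex.Re ('i * p t).
have utE t : (ut t)%:C = 2^-1 * ('i * p t - 'i * ((p t)^*)%C).
  rewrite /ut; case: (p t) => x y; apply: complex_ext; rewrite /=; by field.
have ud (t : R) : is_derive t 1 (fun s : R => u (circ rho s)) (ut t).
  have [d Hd] := gd (circ_lt1 t).
  have := is_derive_ln_normc (g0 (circ_lt1 t)) (cderP Hd) (pderiv_circ rho t).
  by move/is_derive_eq; apply; rewrite /ut /p /L; congr complex.Re; ring.
have pu : pcont (fun t => (u (circ rho t))%:C) by exact: pcont_real.
have put : pcont (fun t => (ut t)%:C).
  under eq_fun do rewrite utE.
  apply: pcontM; first exact: pcont_cst.
  apply: pcontB; apply: pcontM; [exact: pcont_cst|exact: pp|exact: pcont_cst|].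
  exact: pcont_conj.
have E3 : 'i * (z * L z) = 2 * cmean (fun t => (ut t)%:C * ckernel rho z t).
  rewrite -cmeanZ; last exact: pcontM.
  rewrite (@eq_cmean _ _ (fun t => 'i * (p t * ckernel rho z t) -
    'i * (((p t)^*)%C * ckernel rho z t))); last first.
    by move=> t; rewrite utE; field.
  have a1 : pcont (fun t => p t * ckernel rho z t) by exact: pcontM.
  have a2 : pcont (fun t => ((p t)^*)%C * ckernel rho z t).
    by apply: pcontM => //; exact: pcont_conj.
  rewrite cmeanB; try (apply: pcontM => //; exact: pcont_cst).
  by rewrite !cmeanZ // E1 E2 mulr0 subr0.
pose k2 t := circ rho t * (circ rho t - z)^-1 ^+ 2.
have pk2 : pcont k2 by apply: pcontM; [exact: pcont_circ|exact: pcontX].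
have Kd t : has_pderiv (ckernel rho z) t (- ('i * z) * k2 t).
  have h1 := pderivD (pderiv_circ rho t) (pderiv_cst (- z) t).
  have h2 := pderiv_chain (cderiv_inv (c0 t)) h1.
  apply: pderiv_eq (pderivM (pderiv_circ rho t) h2) _.
  by rewrite /k2; field; exact: c0.
have E4 : cmean (fun t => (ut t)%:C * ckernel rho z t + (u (circ rho t))%:C * (- ('i * z) * k2 t)) = 0.
  apply: (@cmean_deriv _ (fun t => (u (circ rho t))%:C * ckernel rho z t)).
  - by apply: pcontD; apply: pcontM => //; apply: pcontM => //; exact: pcont_cst.
  - by move=> t; exact: pderivM (pderiv_real (ud t)) (Kd t).
  - by rewrite /ckernel circ2pi.
move: E4; rewrite cmeanD; [|exact: pcontM|by apply: pcontM => //; apply: pcontM => //; exact: pcont_cst].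
rewrite (@eq_cmean _ (fun t => (u (circ rho t))%:C * (- ('i * z) * k2 t))
  (fun t => - ('i * z) * ((u (circ rho t))%:C * k2 t))); last first.
  by move=> t; rewrite mulrCA.
rewrite cmeanZ; last exact: pcontM.
move=> /eqP; rewrite mulNr subr_eq0 => /eqP E4.
have i0 : ('i%R : R[i]) != 0 by rewrite -normc_gt0 normc_i.
apply: (mulfI z0); apply: (mulfI i0); rewrite E3 E4 -/(k2 _).
rewrite (_ : cmean (fun t => (u (circ rho t))%:C * (circ rho t * (circ rho t - z)^-1 ^+ 2)) =
  cmean (fun t => (u (circ rho t))%:C * k2 t)) //.
move: (cmean _) => c; ring.
Qed.

Let U_ge0 : 0 <= U.
Proof.
rewrite /U -(rmean_cst 0); apply: rmean_le => //; first exact: cst_continuous.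
exact: cont_norm.
Qed.

Let L_bound z : normc z <= rho / 2 -> normc (L z) <= 16 / rho * U.
Proof.
have half w : normc w <= rho / 2 -> normc w < rho.
  by move=> /le_lt_trans; apply; rewrite ltr_pdivrMr // ltr_pMr // ltr1n.
have nz w : normc w < rho -> w != 0 ->
    normc (L w) <= 2 * (2 * (rho * (rho - normc w)^-1 ^+ 2) * U).
  move=> wr w0.
  have n2 : normc (2 : R[i]) = 2 by rewrite -(rmorph_nat (real_complex R)) normc_real ger0_norm.
  rewrite log_deriv_formula // normcM n2 ler_wpM2l //.
  have pc : pcont (fun t => (circ rho t - w)^-1).
    apply: pcontV => [t|]; first exact: circ_sub_neq0.
    by apply: pcontB; [exact: pcont_circ|exact: pcont_cst].
  apply: normc_cmean_weight => [//||t].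
    by apply: pcontM; [exact: pcont_circ|exact: pcontX].
  rewrite normcM normc_circ ?(ltW rho0) // ler_wpM2l ?(ltW rho0) // normcX normcV.
  rewrite lerXn2r ?nnegrE ?invr_ge0 ?normc_ge0 ?subr_ge0 ?(ltW wr) //.
  rewrite lef_pV2 ?posrE ?subr_gt0 ?normc_gt0 ?circ_sub_neq0 //.
  by apply: normc_circ_sub; exact: ltW.
have nz2 w : normc w <= rho / 2 -> w != 0 -> normc (L w) <= 16 / rho * U.
  move=> wr w0; apply: le_trans (nz w (half w wr) w0) _.
  rewrite (_ : 16 / rho * U = 2 * (2 * (rho * (rho / 2)^-1 ^+ 2) * U)); last first.
    by field; rewrite gt_eqF.
  rewrite ler_wpM2l // ler_wpM2r // ler_wpM2l // ler_wpM2l ?(ltW rho0) //.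
  have h : rho / 2 <= rho - normc w by move: wr; lra.
  rewrite lerXn2r ?nnegrE ?invr_ge0 ?divr_ge0 ?(ltW rho0) ?subr_ge0 ?(ltW (half w wr)) //.
  by rewrite lef_pV2 ?posrE ?divr_gt0 // subr_gt0 half.
have [->|z0] := eqVneq z 0; last by move=> zr; exact: nz2.
move=> _; apply/ler_addgt0Pr => e e0.
(* the formula does not determine L 0, which is reached by continuity *)
have z00 : normc (0 : R[i]) < rho1 by rewrite normc0 (lt_trans rho0).
have [d Hd] := L_deriv z00; have [r r0 Hr] := cderiv_ccont Hd e0.
pose s := Num.min r rho / 2.
have M0 : 0 < Num.min r rho by rewrite lt_min r0.
have s0 : 0 < s by rewrite divr_gt0.
have sn : normc (s%:C : R[i]) = s by rewrite normc_real gtr0_norm.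
have sM : s < Num.min r rho by rewrite ltr_pdivrMr // ltr_pMr // ltr1n.
have sr : normc (s%:C - 0 : R[i]) < r.
  by rewrite subr0 sn; apply: lt_le_trans sM _; rewrite ge_min lexx.
have := Hr _ sr; have := normc_triB (L 0) (L s%:C); rewrite normc_distC.
have : normc (L s%:C) <= 16 / rho * U.
  apply: nz2; last by rewrite -normc_gt0 sn.
  by rewrite sn /s ler_wpM2r // ge_min lexx orbT.
lra.
Qed.

(** A gradient estimate: the constant comes from the bound rho / (rho - |z|)^2
    of the kernel of [log_deriv_formula] for |z| <= rho / 2. *)
Lemma ln_normc_diff w w' : normc w <= rho / 2 -> normc w' <= rho / 2 ->
  `|ln (normc (g w')) - ln (normc (g w))| <=
  16 / rho * rmean (fun t => `|ln (normc (g (circ rho t)))|) * normc (w' - w).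
Proof.
move=> wr wr'.
have half v : normc v <= rho / 2 -> normc v < rho1.
  by move=> /le_lt_trans; apply; apply: lt_trans rho01; rewrite ltr_pdivrMr // ltr_pMr // ltr1n.
have [x [_ x2] E] := u_mvt (half w wr) (half w' wr').
rewrite -/(u w') -/(u w) E; apply: le_trans (normc_Re _) _; rewrite normcM.
rewrite ler_wpM2r ?normc_ge0 // L_bound //.
by apply: le_trans x2 _; rewrite ge_max wr wr'.
Qed.

End ZeroFree.

(** * Jensen's formula *)

Section Jensen.
Context {R : realType}.
Implicit Types (z w a : R[i]) (rho : R) (s : seq R[i]).

Lemma ln_exprz (x : R) (k : int) : 0 < x -> ln (x ^ k) = k%:~R * ln x.
Proof.
move=> x0; case: k => n; first by rewrite -exprnP lnXn // mulr_natl.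
by rewrite NegzE -exprnN lnV ?posrE ?exprn_gt0 // lnXn // mulrNz mulNr mulr_natl.
Qed.

Lemma ln_prod (I : eqType) (s : seq I) (P : pred I) (F : I -> R) :
  (forall i, i \in s -> P i -> 0 < F i) ->
  ln (\prod_(i <- s | P i) F i) = \sum_(i <- s | P i) ln (F i) /\
  0 < \prod_(i <- s | P i) F i.
Proof.
elim: s => [|i s IH] H; first by rewrite !big_nil ln1.
have [|E p] := IH; first by move=> j js; apply: H; rewrite inE js orbT.
rewrite !big_cons; case: ifP => // Pi; have Fi := H i (mem_head _ _) Pi.
by rewrite lnM ?posrE // E mulr_gt0.
Qed.

Lemma normc_prod (I : Type) (s : seq I) (P : pred I) (F : I -> R[i]) :
  normc (\prod_(i <- s | P i) F i) = \prod_(i <- s | P i) normc (F i).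
Proof. by apply: (big_morph (@normc R)); [move=> x y; exact: normcM|exact: normc1]. Qed.

Lemma cderiv_prod (I : eqType) (s : seq I) (P : pred I) (F : I -> R[i] -> R[i]) w :
  (forall i, i \in s -> P i -> exists d, has_cderiv (F i) w d) ->
  exists d, has_cderiv (fun z => \prod_(i <- s | P i) F i z) w d.
Proof.
elim: s => [|i s IH] H.
  by exists 0; under eq_fun do rewrite big_nil; exact: cderiv_cst.
have [|d Hd] := IH; first by move=> j js; apply: H; rewrite inE js orbT.
have -> : (fun z => \prod_(j <- i :: s | P j) F j z) = (fun z => if P i then
    F i z * \prod_(j <- s | P j) F j z else \prod_(j <- s | P j) F j z).
  by apply/funext => z; rewrite big_cons.
case Pi: (P i); last by exists d.
by have [d1 Hd1] := H i (mem_head _ _) Pi; eexists; exact: cderivM Hd1 Hd.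
Qed.

(** Symmetric in x and y, at the cost of one superfluous term. *)
Lemma ln_dist (x y : R) : 0 < x -> 0 < y -> `|ln y - ln x| <= `|y - x| * (x^-1 + y^-1).
Proof.
have half (x1 y1 : R) : 0 < x1 -> 0 < y1 -> ln y1 - ln x1 <= `|y1 - x1| * (x1^-1 + y1^-1).
  move=> x0 y0; rewrite -ln_div ?posrE //.
  have -> : y1 / x1 = 1 + (y1 - x1) / x1 by rewrite mulrBl divff ?gt_eqF // addrC subrK.
  apply: (@le_trans _ _ ((y1 - x1) / x1)).
    by apply: le_ln1Dx; rewrite mulrBl divff ?gt_eqF // ltrBrDr addrC subrr divr_gt0.
  apply: (@le_trans _ _ (`|y1 - x1| / x1)); first by rewrite ler_wpM2r ?invr_ge0 ?ler_norm // ltW.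
  by rewrite ler_wpM2l // lerDl invr_ge0 ltW.
move=> x0 y0; rewrite ler_norml half // andbT lerNl opprB.
by apply: le_trans (half _ _ y0 x0) _; rewrite distrC [y^-1 + _]addrC.
Qed.

Variable f : R[i] -> R[i].
Hypotheses (fm : meromorphic f) (f0 : not_identically_zero f).

Lemma specials_ex rho : exists s, uniq s /\
  forall z, (z \in s) = (normc z <= rho) && (ord f z != 0).
Proof.
have /finite_seqP[s Hs] := finite_ord fm f0 rho.
exists (undup s); split; first exact: undup_uniq.
move=> z; rewrite mem_undup; apply/idP/andP => [zs|H].
  by have : [set` s] z by []; rewrite -Hs => -[].
by have : [set z | normc z <= rho /\ ord f z != 0] z by []; rewrite Hs.
Qed.

(** The zeros and poles of f in a closed disc. *)
Definition specials rho : seq R[i] := projT1 (cid (specials_ex rho)).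

Lemma specials_uniq rho : uniq (specials rho).
Proof. by rewrite /specials; case: cid => s /= []. Qed.

Lemma mem_specials rho z :
  (z \in specials rho) = (normc z <= rho) && (ord f z != 0).
Proof. by rewrite /specials; case: cid => s /= []. Qed.

Definition generic rho := forall z, normc z = rho -> ord f z = 0.

Lemma ex_notin (s : seq R) (x y : R) : x < y -> exists2 r, x < r < y & r \notin s.
Proof.
elim: s x y => [|a s IH] x y xy.
  by exists ((x + y) / 2) => //; rewrite ltr_pdivlMr // ltr_pdivrMr //; lra.
have xm : x < (x + y) / 2 by rewrite ltr_pdivlMr //; lra.
have my : (x + y) / 2 < y by rewrite ltr_pdivrMr //; lra.
have [am|ma] := leP a ((x + y) / 2).
  have [r /andP[r1 r2] rs] := IH _ _ my; exists r; first by rewrite (lt_trans xm).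
  by rewrite inE negb_or rs andbT; apply: contraTneq r1 => ->; rewrite -leNgt.
have [r /andP[r1 r2] rs] := IH _ _ xm; exists r; first by rewrite r1 (lt_trans r2).
rewrite inE negb_or rs andbT; apply: contraTneq (lt_trans r2 ma) => ->.
by rewrite ltxx.
Qed.

Lemma ex_generic (x y : R) : x < y -> exists2 rho, x < rho < y & generic rho.
Proof.
move=> xy; have [r rxy rs] := ex_notin (map (@normc R) (specials y)) xy.
exists r => // z zr; apply/eqP; apply: contraNT rs => oz; apply/mapP.
by exists z; rewrite // mem_specials zr oz andbT; case/andP: rxy => _ /ltW.
Qed.

Lemma ex_gap (s : seq R) (x : R) : (forall y, y \in s -> x < y) ->
  exists2 r, x < r & forall y, y \in s -> r <= y.
Proof.
elim: s => [|a s IH] H; first by exists (x + 1); rewrite // ltrDl.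
have [|r r0 Hr] := IH; first by move=> y ys; apply: H; rewrite inE ys orbT.
exists (Num.min a r); first by rewrite lt_min r0 H // mem_head.
move=> y; rewrite inE => /predU1P[->|/Hr ry]; first by rewrite ge_min lexx.
by rewrite ge_min ry orbT.
Qed.

Section Generic.
Variable rho : R.
Hypotheses (rho1 : 1 <= rho) (rho_gen : generic rho).

Let rho0 : 0 < rho. Proof. exact: lt_le_trans rho1. Qed.

Let s := specials rho.

(* The denominator of the Blaschke factor of a, scaled by the radius. *)
Let bl a z : R[i] := ((rho ^+ 2)%:C - (a^*)%C * z) / rho%:C.

(** f divided by the Blaschke products of its zeros and poles. The factor of z
    itself and f(z) are replaced by the leading coefficient of f at z, so that
    the formula has no singularity. *)
Definition zero_free_part z : R[i] := lc f z *
  \prod_(a <- s | a != z) (z - a) ^ (- ord f a) * \prod_(a <- s) bl a z ^ ord f a.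

Let s_lt a : a \in s -> normc a < rho.
Proof.
rewrite mem_specials lt_def => /andP[-> oa]; rewrite andbT.
by apply: contraNneq oa => h; rewrite rho_gen.
Qed.

Let bl_neq0 a z : a \in s -> normc a * normc z < rho ^+ 2 -> bl a z != 0.
Proof.
move=> _ az; rewrite /bl mulf_neq0 //.
  rewrite -normc_gt0; apply: lt_le_trans (normc_triB _ _).
  by rewrite normc_real normcM normc_conj ger0_norm ?sqr_ge0 // subr_gt0.
by rewrite invr_neq0 // -normc_gt0 normc_real normr_gt0 gt_eqF.
Qed.

(** The zero-free part is well behaved slightly beyond the circle: up to the
    next zero or pole of f, and up to the reflected points, of modulus rho^2 /
    |a|. *)
Let ex_rho' : exists2 rho', rho < rho' & forall z, normc z < rho' ->
  (ord f z != 0 -> z \in s) /\ forall a, a \in s -> normc a * normc z < rho ^+ 2.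
Proof.
pose t := specials (rho + 1).
pose l1 := [seq normc a | a <- t & rho < normc a].
pose l2 := [seq rho ^+ 2 / normc a | a <- s & 0 < normc a].
have [|r r0 Hr] := @ex_gap (rho + 1 :: l1 ++ l2) rho.
  move=> y; rewrite inE mem_cat => /or3P[/eqP->|/mapP[a]|/mapP[a]].
  - by rewrite ltrDl.
  - by rewrite mem_filter => /andP[ra _] ->.
  rewrite mem_filter => /andP[a0 /s_lt ar] ->.
  by rewrite ltr_pdivlMr // expr2 ltr_pM2l.
exists r => // z zr; split=> [oz|a as_].
  have zt : z \in t.
    rewrite mem_specials oz andbT; apply: le_trans (ltW zr) _; apply: Hr.
    by rewrite mem_head.
  rewrite mem_specials oz andbT leNgt; apply/negP => rz.
  have : r <= normc z.
    apply: Hr; rewrite inE mem_cat; apply/or3P; apply: Or32; apply/mapP.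
    by exists z => //; rewrite mem_filter rz.
  by rewrite leNgt zr.
have [->|a0] := eqVneq a 0; first by rewrite normc0 mul0r exprn_gt0.
have na : 0 < normc a by rewrite normc_gt0.
rewrite mulrC -ltr_pdivlMr //; apply: lt_le_trans zr _; apply: Hr.
rewrite inE mem_cat; apply/or3P; apply: Or33; apply/mapP.
by exists a => //; rewrite mem_filter na.
Qed.

Let rho' := s2val (cid2 ex_rho').
Let rho'_gt : rho < rho'. Proof. exact: s2valP (cid2 ex_rho'). Qed.
Let rho'P z : normc z < rho' ->
  (ord f z != 0 -> z \in s) /\ forall a, a \in s -> normc a * normc z < rho ^+ 2.
Proof. exact: s2valP' (cid2 ex_rho') z. Qed.

Let g_neq0 z : normc z < rho' -> zero_free_part z != 0.
Proof.
move=> /rho'P[_ H]; rewrite /zero_free_part !mulf_neq0 ?lc_neq0 //.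
  rewrite prodf_seq_neq0; apply/allP => a _; apply/implyP => az.
  by rewrite expfz_neq0 // subr_eq0 eq_sym.
rewrite prodf_seq_neq0; apply/allP => a as_; apply/implyP => _.
by rewrite expfz_neq0 // bl_neq0 // H.
Qed.

Let g_deriv z : normc z < rho' -> exists d, has_cderiv zero_free_part z d.
Proof.
move=> zr; have [zs zb] := rho'P zr.
have [h [r [r0 hz a0 H1 H2]]] := ordP fm f0 z.
have [r1 r10 Hr1] := ord_isolated fm f0 z.
have [_ [d Hd]] : h z != 0 /\ exists d, has_cderiv h z d.
  by apply: H1; rewrite subrr normc0.
pose G w := h w * \prod_(a <- s | a != z) (w - a) ^ (- ord f a) *
  \prod_(a <- s) bl a w ^ ord f a.
have [d' Gd] : exists d', has_cderiv G z d'.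
  have [|d1 Hd1] := @cderiv_prod _ s (fun a => a != z) (fun a w => (w - a) ^ (- ord f a)) z.
    move=> a as_ az; apply: cderivXz; first by rewrite subr_eq0 eq_sym.
    by apply: cderivB; [exact: cderiv_id|exact: cderiv_cst].
  have [|d2 Hd2] := @cderiv_prod _ s xpredT (fun a w => bl a w ^ ord f a) z.
    move=> a as_ _; apply: cderivXz; first by rewrite bl_neq0 // zb.
    apply: cderivM; last exact: cderiv_cst.
    apply: cderivB; first exact: cderiv_cst.
    by apply: cderivM; [exact: cderiv_cst|exact: cderiv_id].
  by eexists; exact: (cderivM (cderivM Hd Hd1) Hd2).
exists d'; apply: (@cderiv_near _ _ _ _ _ (Num.min r r1)) Gd; first by rewrite lt_min r0.
move=> w; rewrite lt_min => /andP[wr wr1]; rewrite /G /zero_free_part; congr (_ * _).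
have [->|wz] := eqVneq w z; first by rewrite hz.
have ow := Hr1 w wr1 wz; have [_ fw] := ord_eq0 fm f0 ow.
have ws : w \notin s by rewrite mem_specials ow eqxx andbF.
have -> : \prod_(a <- s | a != w) (w - a) ^ (- ord f a) = \prod_(a <- s) (w - a) ^ (- ord f a).
  rewrite big_seq_cond [RHS]big_seq; apply: eq_bigl => a.
  by case: (boolP (a \in s)) => //= as_; apply: contraNneq ws => <-.
rewrite -fw H2 // mulrAC [h w * _]mulrC; congr (_ * _).
have wz0 : w - z != 0 by rewrite subr_eq0.
have [zin|zout] := boolP (z \in s).
  rewrite [in RHS](bigD1_seq z) //=; last exact: specials_uniq.
  by rewrite mulrA -expfzDr // subrr mul1r.
have -> : ord f z = 0 by apply/eqP; apply: contraNT zout => /zs.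
rewrite mul1r big_seq_cond [RHS]big_seq; apply: eq_bigl => a.
by case: (boolP (a \in s)) => //= as_; apply: contraNneq zout => <-.
Qed.

Let g_circle z : normc z = rho -> normc (zero_free_part z) = normc (f z).
Proof.
move=> zr; have [_ fz] := ord_eq0 fm f0 (rho_gen zr).
rewrite /zero_free_part -fz -mulrA normcM -[RHS]mulr1; congr (_ * _).
have zs : z \notin s by rewrite mem_specials rho_gen ?eqxx ?andbF.
have -> : \prod_(a <- s | a != z) (z - a) ^ (- ord f a) = \prod_(a <- s) (z - a) ^ (- ord f a).
  rewrite big_seq_cond [RHS]big_seq; apply: eq_bigl => a.
  by case: (boolP (a \in s)) => //= as_; apply: contraNneq zs => <-.
rewrite -big_split /= normc_prod big1_seq // => a /andP[_ as_].
rewrite normcM !normcXz.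
have za : 0 < normc (z - a).
  by rewrite normc_gt0 subr_eq0; apply: contraNneq zs => ->.
have -> : normc (bl a z) = normc (z - a).
  have zz : (rho ^+ 2)%:C = (z^*)%C * z.
    move: zr; case: (z) => x y H0.
    apply: complex_ext; rewrite ?cReM ?cImM /=; last by ring.
    by rewrite mulNr opprK -!expr2 -H0 sqr_normcE.
  rewrite /bl zz -mulrBl -conjB normcM normcM normc_conj normcV normc_real.
  by rewrite zr (gtr0_norm rho0) mulfK // gt_eqF.
by rewrite -expfzDr ?gt_eqF // addNr expr0z.
Qed.

(** The weight of a in Jensen's formula. At the origin it is log r, since
    there the leading coefficient of f takes the place of f(0). *)
Definition jweight (r : R) a : R := if a == 0 then ln r else ln (r / normc a).

Lemma jweight_ge0 a : a \in s -> 0 <= jweight rho a.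
Proof.
move=> /s_lt ar; rewrite /jweight; case: eqP => [_|/eqP a0]; first exact: ln_ge0.
by apply: ln_ge0; rewrite ler_pdivlMr ?normc_gt0 // mul1r ltW.
Qed.

Let ln_bl a z : a \in s -> normc z <= rho -> 0 < normc (bl a z).
Proof.
move=> as_ zr; rewrite normc_gt0 bl_neq0 // expr2.
apply: (@le_lt_trans _ _ (normc a * rho)); first by rewrite ler_wpM2l ?normc_ge0.
by rewrite ltr_pM2r // s_lt.
Qed.

Lemma cont_ln_f_circ : continuous (fun t => ln (normc (f (circ rho t)))).
Proof.
have g0 w : normc w < rho' -> zero_free_part w != 0 by exact: g_neq0.
have := cont_ln_normc g0 g_deriv (pcont_circ rho).
have h t : normc (circ rho t) = rho by rewrite normc_circ // ltW.
under [X in _ -> continuous X]eq_fun do rewrite -g_circle //.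
by apply=> t; rewrite h.
Qed.

(** The mean value property of the zero-free part, whose value at 0 carries a
    factor rho / |a| for every zero or pole a. *)
Lemma jensen : rmean (fun t => ln (normc (f (circ rho t)))) =
  ln (normc (lc f 0)) + \sum_(a <- s) (ord f a)%:~R * jweight rho a.
Proof.
have h t : normc (circ rho t) = rho by rewrite normc_circ // ltW.
rewrite -(eq_rmean (f := fun t => ln (normc (zero_free_part (circ rho t))))); last first.
  by move=> t; rewrite g_circle.
rewrite (mean_ln_normc rho0 rho'_gt g_neq0 g_deriv) /zero_free_part.
rewrite -mulrA normcM lnM ?posrE ?normc_gt0 ?lc_neq0 //; last first.
  have := g_neq0 (z := 0); rewrite normc0 => /(_ (lt_trans rho0 rho'_gt)).
  by rewrite /zero_free_part -mulrA mulf_eq0 negb_or => /andP[].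
congr (_ + _); rewrite normcM !normc_prod.
have p1 a : a \in s -> a != 0 -> 0 < normc ((0 - a) ^ (- ord f a)).
  by move=> _ a0; rewrite normc_gt0 expfz_neq0 // sub0r oppr_eq0.
have p2 a : a \in s -> xpredT a -> 0 < normc (bl a 0 ^ ord f a).
  move=> as_ _; rewrite normc_gt0 expfz_neq0 // -normc_gt0 ln_bl // normc0 ltW //.
have [e1 q1] := ln_prod p1; have [e2 q2] := ln_prod p2.
rewrite lnM ?posrE // e1 e2 big_mkcond /= -big_split /=; apply: eq_big_seq => a as_.
have b0 : normc (bl a 0) = rho.
  rewrite /bl mulr0 subr0 normcM normcV !normc_real ger0_norm ?sqr_ge0 // gtr0_norm //.
  by rewrite expr2 mulfK // gt_eqF.
rewrite !normcXz b0 (ln_exprz _ rho0) /jweight; case: (eqVneq a 0) => [_|a0].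
  by rewrite /= add0r.
rewrite /= sub0r normc_opp ln_exprz ?normc_gt0 // ln_div ?posrE ?normc_gt0 //.
by rewrite mulrNz; ring.
Qed.

(** The zero-free part contributes the gradient estimate [ln_normc_diff]. In
    each Blaschke factor, log |z - a| contributes the inverse distances, and
    the denominator, of modulus at least rho / 2, contributes 4 / rho. *)
Lemma ln_normc_f_diff z z' : normc z <= rho / 2 -> normc z' <= rho / 2 ->
  ord f z = 0 -> ord f z' = 0 ->
  `|ln (normc (f z')) - ln (normc (f z))| <= normc (z' - z) *
   (16 / rho * rmean (fun t => `|ln (normc (f (circ rho t)))|) +
    \sum_(a <- s) `|ord f a|%:~R *
      ((normc (z - a))^-1 + (normc (z' - a))^-1 + 4 / rho)).
Proof.
have half w : normc w <= rho / 2 -> normc w < rho.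
  by move=> /le_lt_trans; apply; rewrite ltr_pdivrMr // ltr_pMr // ltr1n.
have key w : normc w <= rho / 2 -> ord f w = 0 ->
  [/\ forall a, a \in s -> 0 < normc (w - a) &
   ln (normc (f w)) = ln (normc (zero_free_part w)) +
    \sum_(a <- s) (ord f a)%:~R * (ln (normc (w - a)) - ln (normc (bl a w)))].
  move=> wr ow; have [_ fw] := ord_eq0 fm f0 ow.
  have ws : w \notin s by rewrite mem_specials ow eqxx andbF.
  have wa a : a \in s -> 0 < normc (w - a).
    by move=> as_; rewrite normc_gt0 subr_eq0; apply: contraNneq ws => ->.
  split=> //.
  have g0 := g_neq0 (lt_trans (half w wr) rho'_gt).
  have gE : zero_free_part w = f w * (\prod_(a <- s) ((w - a) ^ (- ord f a) * bl a w ^ ord f a)).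
    rewrite /zero_free_part -fw -mulrA big_split /=; congr (_ * (_ * _)).
    rewrite big_seq_cond [RHS]big_seq; apply: eq_bigl => a.
    by case: (boolP (a \in s)) => //= as_; apply: contraNneq ws => <-.
  have p a : a \in s -> xpredT a -> 0 < normc ((w - a) ^ (- ord f a) * bl a w ^ ord f a).
    move=> as_ _; rewrite normcM !normcXz mulr_gt0 // exprz_gt0 //; first exact: wa.
    by apply: ln_bl => //; exact/ltW/half.
  have [e q] := ln_prod p.
  have fw0 : 0 < normc (f w) by rewrite fw normc_gt0 lc_neq0.
  rewrite gE normcM normc_prod lnM ?posrE // e -addrA -big_split /= big1_seq ?addr0 //.
  move=> a /andP[_ as_]; have wa0 := wa a as_.
  have b0 : 0 < normc (bl a w) by apply: ln_bl => //; exact/ltW/half.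
  rewrite normcM !normcXz lnM ?posrE ?exprz_gt0 // !ln_exprz // mulrNz; ring.
move=> zr zr' oz oz'; have [za ->] := key z zr oz; have [za' ->] := key z' zr' oz'.
have ndist (x y : R[i]) : `|normc x - normc y| <= normc (x - y).
  by rewrite ler_norml normc_triB andbT lerNl opprB normc_distC normc_triB.
set u := zero_free_part.
rewrite (_ : _ - _ = (ln (normc (u z')) - ln (normc (u z))) +
    \sum_(a <- s) (ord f a)%:~R * ((ln (normc (z' - a)) - ln (normc (z - a))) -
       (ln (normc (bl a z')) - ln (normc (bl a z))))); last first.
  rewrite opprD addrACA -sumrB; congr (_ + _); apply: eq_bigr => a _; ring.
apply: le_trans (ler_normD _ _) _; rewrite mulrDr lerD //.
  rewrite mulrC.
  have -> : rmean (fun t => `|ln (normc (f (circ rho t)))|) =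
            rmean (fun t => `|ln (normc (u (circ rho t)))|).
    by apply: eq_rmean => t; rewrite /u g_circle // normc_circ // ltW.
  exact: (ln_normc_diff rho0 rho'_gt g_neq0 g_deriv).
apply: le_trans (ler_norm_sum _ _ _) _; rewrite mulr_sumr big_seq [leRHS]big_seq.
apply: ler_sum => a as_; rewrite normrM mulrCA -intr_norm ler_wpM2l ?ler0z //.
apply: le_trans (ler_normB _ _) _; rewrite mulrDr lerD //.
  apply: le_trans (ln_dist _ _) _; [exact: za|exact: za'|].
  rewrite ler_wpM2r ?addr_ge0 ?invr_ge0 ?normc_ge0 //.
  by apply: le_trans (ndist _ _) _; rewrite opprB addrA subrK.
have bz w : normc w <= rho / 2 -> 0 < normc (bl a w) /\ (normc (bl a w))^-1 <= 2 / rho.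
  move=> wr; have b0 : 0 < normc (bl a w) by apply: ln_bl => //; exact/ltW/half.
  split=> //; rewrite -[2 / rho]invrK lef_pV2 ?posrE ?invr_gt0 ?divr_gt0 //.
  rewrite invf_div /bl normcM normcV normc_real (gtr0_norm rho0) ler_pdivlMr //.
  apply: le_trans (normc_triB _ _); rewrite normc_real normcM normc_conj.
  rewrite ger0_norm ?sqr_ge0 //.
  have : normc a * normc w <= rho * (rho / 2).
    by rewrite ler_pM ?normc_ge0 // ltW // s_lt.
  by rewrite expr2; lra.
have [b1 c1] := bz z zr; have [b2 c2] := bz z' zr'.
apply: le_trans (ln_dist b1 b2) _; rewrite ler_pM ?addr_ge0 ?invr_ge0 ?normc_ge0 //.
  apply: le_trans (ndist _ _) _.
  have -> : bl a z' - bl a z = - ((a^*)%C * (z' - z) / rho%:C) by rewrite /bl; ring.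
  rewrite normc_opp 2!normcM normcV normc_real (gtr0_norm rho0) normc_conj.
  rewrite ler_pdivrMr // mulrC ler_wpM2l ?normc_ge0 // ltW // s_lt //.
by apply: le_trans (lerD c1 c2) _; rewrite -mulrDl -natrD.
Qed.

End Generic.

End Jensen.

(** * The Nevanlinna characteristic *)

Section MoreIntegrals.
Context {R : realType}.
Notation mu := (@lebesgue_measure R).

Lemma rint_FTC_within (a b : R) (f F : R -> R) : a <= b ->
  {within `[a, b], continuous f} ->
  (forall t : R, a <= t <= b -> is_derive t 1 F (f t)) -> rint a b f = F b - F a.
Proof.
rewrite le_eqVlt => /predU1P[->|ab] cf HF.
  by rewrite /rint set_itv1 Rintegral_set1 subrr.
rewrite /rint /Rintegral (@continuous_FTC2 R f F) //.
- have dF (t : R) : a <= t <= b -> {for t, continuous F}.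
    by move=> /HF[dF _]; apply: differentiable_continuous; apply/derivable1_diffP.
  split; first by move=> t /andP[t1 t2]; case: (HF t) => //; rewrite !ltW.
  + by apply: cvg_at_right_filter; apply: dF; rewrite lexx ltW.
  + by apply: cvg_at_left_filter; apply: dF; rewrite lexx ltW.
- move=> t; rewrite in_itv /= => /andP[t1 t2].
  by rewrite derive1E; case: (HF t) => //; rewrite !ltW.
Qed.

Lemma within_cont_inv (a b c : R) (s : R) : (forall t, a <= t <= b -> c + s * t != 0) ->
  {within `[a, b], continuous (fun t : R => (c + s * t)^-1)}.
Proof.
move=> H; apply: derivable_within_continuous => t; rewrite in_itv /= => tab.
have h : derivable (fun t : R => c + s * t) t 1 by [].
by apply: derivableV => //; exact: H.
Qed.

Lemma integrable_sum (I : eqType) (s : seq I) (D : set (measurableTypeR R)) (F : I -> R -> R) :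
  measurable D ->
  (forall i, i \in s -> mu.-integrable D (EFin \o F i)) ->
  mu.-integrable D (EFin \o (fun t => \sum_(i <- s) F i t)) /\
  (\int[mu]_(t in D) (\sum_(i <- s) F i t) = \sum_(i <- s) \int[mu]_(t in D) F i t)%R.
Proof.
move=> mD; elim: s => [|i s IH] H.
  under [X in EFin \o X]eq_fun do rewrite big_nil.
  under eq_Rintegral do rewrite big_nil.
  rewrite big_nil; split; last by rewrite /Rintegral integral0.
  by have := integrable0 mu D; congr integrable.
have [|I1 I2] := IH; first by move=> j js; apply: H; rewrite inE js orbT.
have Hi := H i (mem_head _ _).
have -> : (fun t => \sum_(j <- i :: s) F j t) = (fun t => F i t + \sum_(j <- s) F j t).
  by apply/funext => t; rewrite big_cons.
rewrite big_cons -I2; split; last exact: RintegralD.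
by have := integrableD mD Hi I1; apply: eq_integrable.
Qed.

(** The contribution of a pole of modulus x to the counting integral. *)
Lemma Rintegral_inv_tail (x y : R) : 0 < x -> x <= y ->
  let k := fun t : R => if x <= t then t^-1 else 0 in
  mu.-integrable `]0, y] (EFin \o k) /\
  (\int[mu]_(t in `]0, y]) k t)%R = ln (y / x).
Proof.
move=> x0 xy k.
have kE : k = (fun t : R => t^-1) \_ `[x, +oo[.
  apply/funext => t; rewrite /k patchE mem_setE in_itv /= andbT.
  by [].
have DE : `]0, y]%classic `&` `[x, +oo[ = `[x, y]%classic.
  apply/seteqP; split => t; rewrite /= !in_itv /= ?andbT.
    by move=> [/andP[_ ->] ->].
  by move=> /andP[xt ->]; rewrite xt (lt_le_trans x0 xt).
have cV : {within `[x, y], continuous (fun t : R => t^-1)}.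
  have -> : (fun t : R => t^-1) = (fun t : R => (0 + 1 * t)^-1).
    by apply/funext => t; rewrite add0r mul1r.
  apply: within_cont_inv => t /andP[xt _].
  by rewrite add0r mul1r gt_eqF // (lt_le_trans x0).
split.
  have -> : EFin \o k = (EFin \o (fun t : R => t^-1)) \_ `[x, +oo[.
    by apply/funext => t; rewrite kE /= !patchE; case: ifP.
  apply/integrable_restrict => //; rewrite DE.
  by apply: continuous_compact_integrable => //; exact: segment_compact.
rewrite kE -Rintegral_mkcondr DE.
have y0 := lt_le_trans x0 xy.
rewrite ln_div ?posrE //; apply: rint_FTC_within => // t /andP[xt _].
by apply: is_derive1_ln; exact: lt_le_trans x0 xt.
Qed.

End MoreIntegrals.

Section NevanlinnaBounds.
Context {R : realType}.
Implicit Types (z w a : R[i]) (rho : R).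
Variable f : R[i] -> R[i].
Hypotheses (fm : meromorphic f) (f0 : not_identically_zero f).

(** The multiplicity of a as a pole. *)
Let np a : nat := if ord f a < 0 then `|ord f a|%N else 0%N.

Local Notation specials := (specials fm f0).

Lemma pole_countE rho t : t <= rho ->
  pole_count f t = (\sum_(a <- specials rho | (normc a <= t)%R) np a)%N.
Proof.
move=> tr; rewrite /pole_count.
pose s := [seq a <- specials rho | (ord f a < 0) && (normc a <= t)].
have -> : [set z | is_pole f z /\ normc z <= t] = [set` s].
  apply/seteqP; split => a /=.
    move=> [/(ord_pole fm f0) oa at_]; rewrite mem_filter oa at_ mem_specials.
    by rewrite (le_trans at_ tr) lt_eqF.
  by rewrite mem_filter => /andP[/andP[oa at_] _]; split => //; apply/(ord_pole fm f0).
rewrite -fsbig_seq; last by rewrite filter_uniq // specials_uniq.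
rewrite big_filter big_mkcond [RHS]big_mkcond /=; apply: eq_bigr => a _.
rewrite /np; case: ifP => [/andP[oa ->]|]; first by rewrite oa (pole_orderE fm f0).
by move=> H; case: ifP => // at_; move: H; rewrite at_ andbT => ->.
Qed.

Section AtRadius.
Variable rho : R.
Hypotheses (rho1 : 1 <= rho) (rho_gen : generic f rho).
Let rho0 : 0 < rho. Proof. exact: lt_le_trans rho1. Qed.

(** A pole a different from 0 is counted from the radius |a| on; exchanging
    the sum and the integral gives its weight in Jensen's formula. *)
Lemma counting_integralE :
  counting_integral f rho = \sum_(a <- specials rho) (np a)%:R * jweight rho a.
Proof.
set s := specials rho.
pose k a (t : R) : R := if a == 0 then 0 else (np a)%:R * (if normc a <= t then t^-1 else 0).
have pc0 : pole_count f 0 = (\sum_(a <- s) if (a == 0)%R then np a else 0)%N.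
  rewrite (pole_countE (ltW rho0)) big_mkcond /=; apply: eq_bigr => a _.
  by rewrite [normc a <= 0]le_eqVlt ltNge normc_ge0 orbF normc_eq0.
have E t : t \in `]0, rho]%classic ->
    ((pole_count f t)%:R - (pole_count f 0)%:R) / t = \sum_(a <- s) k a t.
  rewrite inE /= in_itv /= => /andP[t0 tr].
  rewrite (pole_countE tr) big_mkcond pc0 !natr_sum -sumrB mulr_suml.
  apply: eq_bigr => a _; rewrite /k; case: eqP => [->|_].
    by rewrite normc0 (ltW t0) subrr mul0r.
  by rewrite subr0; case: ifP => _; rewrite ?mul0r ?mulr0.
have Hk a : a \in s -> lebesgue_measure.-integrable `]0, rho] (EFin \o k a) /\
    (\int[lebesgue_measure]_(t in `]0%R, rho]) k a t)%R =
    if a == 0 then 0 else (np a)%:R * ln (rho / normc a).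
  move=> as_; rewrite /k; case: eqP => [_|/eqP a0].
    split; last by rewrite /Rintegral integral0.
    exact: integrable0.
  have na : 0 < normc a by rewrite normc_gt0.
  have ar : normc a <= rho by move: as_; rewrite mem_specials => /andP[].
  have [I1 I2] := Rintegral_inv_tail na ar.
  split; last by rewrite RintegralZl // I2.
  have := @integrableZl _ _ _ lebesgue_measure `]0%R, rho]%classic (measurable_itv _) (np a)%:R _ I1.
  by apply: eq_integrable.
rewrite /counting_integral.
have -> : (\int[lebesgue_measure]_(t in `]0%R, rho]) (((pole_count f t)%:R - (pole_count f 0)%:R) / t))%R =
    (\int[lebesgue_measure]_(t in `]0%R, rho]) (\sum_(a <- s) k a t))%R.
  by apply: eq_Rintegral => t; exact: E.
have [|_ ->] := @integrable_sum R _ s `]0, rho]%classic k (measurable_itv _).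
  by move=> a /Hk[].
rewrite pc0 natr_sum mulr_suml -big_split /= !big_seq; apply: eq_bigr => a as_.
have [_ ->] := Hk a as_; rewrite /jweight; case: ifP => _; first by rewrite add0r.
by rewrite mul0r addr0.
Qed.

Lemma proximityE : proximity f rho = rmean (fun t => log_plus (normc (f (circ rho t)))).
Proof.
rewrite /proximity /rmean /rint; congr (_ * _); apply: eq_Rintegral => t _.
congr (log_plus (normc (f _))); rewrite circ.unlock; apply: complex_ext.
  by rewrite cReCM.
by rewrite cImCM.
Qed.

Lemma log_plusE (x : R) : log_plus x = 2^-1 * (`|ln x| + ln x).
Proof.
rewrite /log_plus; case: (leP 0 (ln x)) => lx; first by rewrite ger0_norm //; lra.
by rewrite ltr0_norm // addNr mulr0.
Qed.

(** T is the mean of log+ |f| plus the sum P over the poles, and by Jensen's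
    formula the sum Z over the zeros minus P is the mean of log |f|, up to the
    constant log |lc f 0|. Both left-hand sides, Z + P being the second, are
    combinations of these quantities: this is the first main theorem. *)
Lemma nevanlinna_bounds :
  let K := `|ln (normc (lc f 0))| in
  rmean (fun t => `|ln (normc (f (circ rho t)))|) <= 2 * nevanlinna_T f rho + K /\
  \sum_(a <- specials rho) `|ord f a|%:~R * jweight rho a <= 2 * nevanlinna_T f rho + K.
Proof.
move=> K; set s := specials rho; set U := rmean _.
have cl := cont_ln_f_circ fm f0 rho1 rho_gen.
have jen := jensen fm f0 rho1 rho_gen.
set J := rmean _ in jen.
pose Z := \sum_(a <- s) (if ord f a < 0 then 0 else (ord f a)%:~R) * jweight rho a.
pose P := \sum_(a <- s) (np a)%:R * jweight rho a.
have np0 a : (np a)%:R = if ord f a < 0 then `|ord f a|%:~R else 0 :> R.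
  by rewrite /np; case: ifP => // _; rewrite pmulrn abszE.
have ZP : \sum_(a <- s) (ord f a)%:~R * jweight rho a = Z - P.
  rewrite -sumrB; apply: eq_bigr => a _; rewrite -mulrBl np0; congr (_ * _).
  by case: ifP => oa; [rewrite sub0r ltr0_norm // mulrNz opprK|rewrite subr0].
have ZaP : \sum_(a <- s) `|ord f a|%:~R * jweight rho a = Z + P.
  rewrite -big_split /=; apply: eq_bigr => a _; rewrite -mulrDl np0; congr (_ * _).
  case: ifP => oa; [by rewrite add0r|rewrite addr0 ger0_norm //].
  by rewrite leNgt oa.
have w0 a : a \in s -> 0 <= jweight rho a by exact: jweight_ge0.
have Z0 : 0 <= Z.
  rewrite /Z big_seq; apply: sumr_ge0 => a as_; rewrite mulr_ge0 ?w0 //.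
  by case: ifP => // oa; rewrite ler0z leNgt oa.
have P0 : 0 <= P by rewrite /P big_seq; apply: sumr_ge0 => a as_; rewrite mulr_ge0 ?w0.
have cn := cont_norm cl.
have prox : proximity f rho = 2^-1 * (U + J).
  rewrite proximityE (eq_rmean (fun t => log_plusE _)) rmeanZ ?rmeanD //.
  exact: cont_add.
have UJ : J <= U.
  by apply: rmean_le => // t _; exact: ler_norm.
have U0 : 0 <= U + J.
  rewrite /U /J -rmeanD // -(rmean_cst 0); apply: rmean_le.
  - exact: cst_continuous.
  - exact: cont_add.
  - by move=> t _; rewrite -lerBlDr sub0r -normrN ler_norm.
have T : nevanlinna_T f rho = 2^-1 * (U + J) + P.
  by rewrite /nevanlinna_T prox counting_integralE.
have K1 : - K <= ln (normc (lc f 0)) by rewrite lerNl /K -normrN ler_norm.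
have K2 : ln (normc (lc f 0)) <= K by exact: ler_norm.
rewrite ZaP T; rewrite ZP in jen; split; lra.
Qed.

End AtRadius.

(** On the circle of radius rho' each zero or pole of modulus at most rho has
    weight at least log 2. *)
Lemma count_specials rho rho' : 2 <= rho' -> 2 * rho <= rho' -> generic f rho' ->
  \sum_(a <- specials rho) `|ord f a|%:~R <=
  (2 * nevanlinna_T f rho' + `|ln (normc (lc f 0))|) / ln 2.
Proof.
move=> r2 rr gen; have r1 : 1 <= rho' by lra.
have [_ H] := nevanlinna_bounds r1 gen.
have l2 : 0 < ln 2 :> R by rewrite ln_gt0 // ltr1n.
rewrite ler_pdivlMr //; apply: le_trans H; rewrite mulr_suml.
have pe : perm_eq (specials rho) [seq a <- specials rho' | normc a <= rho].
  apply: uniq_perm; rewrite ?filter_uniq ?specials_uniq // => a.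
  rewrite mem_filter !mem_specials; case: (boolP (normc a <= rho)) => //= ar.
  by have -> : normc a <= rho' by have := normc_ge0 a; lra.
rewrite (perm_big _ pe) big_filter big_mkcond /= !big_seq; apply: ler_sum => a as_.
have w0 := jweight_ge0 (fm := fm) (f0 := f0) r1 gen as_.
case: ifP => ar; last by rewrite mulr_ge0.
rewrite ler_wpM2l //.
have r0 : 0 < rho' by lra.
rewrite /jweight; case: eqP => [_|/eqP a0].
  by rewrite ler_ln ?posrE.
have na : 0 < normc a by rewrite normc_gt0.
rewrite ler_ln ?posrE ?divr_gt0 // ler_pdivlMr //; lra.
Qed.

End NevanlinnaBounds.

(** * Sums of inverse distances outside exceptional radii *)

Section RadialEstimate.
Context {R : realType}.
Notation mu := (@lebesgue_measure R).

Lemma ln_le_id (x : R) : 0 < x -> ln x <= x.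
Proof.
move=> x0; have := @le_ln1Dx R (x - 1); rewrite (_ : 1 + (x - 1) = x); last by ring.
move=> H; by apply: le_trans (H _) _; [rewrite ltrBrDr addrC subrr|rewrite gerBl].
Qed.

Lemma rint_kernel_right (c b h : R) : 0 < h -> c <= b ->
  rint c b (fun t => (h + `|t - c|)^-1) = ln (1 + (b - c) / h).
Proof.
move=> h0 cb.
rewrite (@eq_rint _ _ _ _ (fun t => (h - c + 1 * t)^-1)); last first.
  by move=> t /andP[ct _]; rewrite ger0_norm ?subr_ge0 //; congr (_^-1); ring.
have pos t : c <= t <= b -> 0 < h - c + 1 * t by move=> /andP[ct _]; lra.
pose F (t : R) := ln (h - c + 1 * t).
apply: (@eq_trans _ _ (F b - F c)); last first.
- rewrite /F -ln_div ?posrE ?pos ?lexx ?cb //; congr ln.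
  rewrite (_ : h - c + 1 * c = h); last by ring.
  by field; rewrite gt_eqF.
apply: (@rint_FTC_within _ c b _ F) => //.
- by apply: within_cont_inv => t /pos t0; rewrite gt_eqF.
move=> t /pos t0.
have Hl : is_derive (h - c + 1 * t) 1 (@ln R) (h - c + 1 * t)^-1 by exact: is_derive1_ln.
have Ha : is_derive t 1 (fun s : R => h - c + 1 * s) 1.
  by apply: is_derive_eq; rewrite /GRing.scale /=; ring.
by have := @is_derive1_comp R (@ln R) (fun s : R => h - c + 1 * s) t _ _ Hl Ha; rewrite mulr1.
Qed.

Lemma rint_kernel_left (a c h : R) : 0 < h -> a <= c ->
  rint a c (fun t => (h + `|t - c|)^-1) = ln (1 + (c - a) / h).
Proof.
move=> h0 ac.
rewrite (@eq_rint _ _ _ _ (fun t => (h + c + (-1) * t)^-1)); last first.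
  by move=> t /andP[_ ct]; rewrite ler0_norm ?subr_le0 //; congr (_^-1); ring.
have pos t : a <= t <= c -> 0 < h + c + (-1) * t by move=> /andP[_ ct]; lra.
pose F (t : R) := - ln (h + c + (-1) * t).
apply: (@eq_trans _ _ (F c - F a)); last first.
- rewrite /F opprK addrC -ln_div ?posrE ?pos ?lexx ?ac //; congr ln.
  rewrite (_ : h + c + -1 * c = h); last by ring.
  by field; rewrite gt_eqF.
apply: (@rint_FTC_within _ a c _ F) => //.
- by apply: within_cont_inv => t /pos t0; rewrite gt_eqF.
move=> t /pos t0.
have Hl : is_derive (h + c + (-1) * t) 1 (@ln R) (h + c + (-1) * t)^-1 by exact: is_derive1_ln.
have Ha : is_derive t 1 (fun s : R => h + c + (-1) * s) (-1).
  by apply: is_derive_eq; rewrite /GRing.scale /=; ring.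
have := @is_derive1_comp R (@ln R) (fun s : R => h + c + (-1) * s) t _ _ Hl Ha.
move=> /is_deriveN H; apply: is_derive_eq H _; ring.
Qed.

Lemma cont_kernel (x h : R) : 0 < h -> continuous (fun t : R => (h + `|t - x|)^-1).
Proof.
move=> h0 t; apply: cvgV; first by rewrite gt_eqF // ltr_pwDl.
apply: cvgD; first exact: cvg_cst.
by apply: cvg_norm; apply: cvgB; [exact: cvg_id|exact: cvg_cst].
Qed.

(** Truncated at the height 1 / h, the inverse distance to x has an integral
    that is only logarithmic in h; the worst position of x is inside the
    interval. *)
Lemma rint_kernel_le (A x h : R) : 0 < A -> 0 < h ->
  rint A (2 * A) (fun t => (h + `|t - x|)^-1) <= 2 * ln (1 + A / h).
Proof.
move=> A0 h0; have A2 : A <= 2 * A by lra.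
(* moving x into the interval only brings it closer *)
pose c := Num.max A (Num.min x (2 * A)).
have Ac : A <= c by rewrite le_max lexx.
have cA : c <= 2 * A by rewrite ge_max A2 ge_min lexx orbT.
have cl t : A <= t <= 2 * A -> `|t - c| <= `|t - x|.
  move=> /andP[At tA]; rewrite /c.
  have [x1|x1] := leP x (2 * A); have [x2|x2] := leP A x.
  - by [].
  - rewrite !ger0_norm ?subr_ge0 //; lra.
  - by have [?|?] := leP A (2 * A); rewrite !ler0_norm ?subr_le0 //; lra.
  - by have [?|?] := leP A (2 * A); rewrite !ler0_norm ?subr_le0 //; lra.
apply: (@le_trans _ _ (rint A (2 * A) (fun t => (h + `|t - c|)^-1))).
  apply: rint_le => [||t tA]; try exact: cont_kernel.
  by rewrite lef_pV2 ?posrE ?ltr_pwDl // lerD2l cl.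
rewrite (@rint_split _ A c (2 * A)) //; last exact: cont_kernel.
rewrite rint_kernel_left // rint_kernel_right //.
rewrite (_ : 2 * ln (1 + A / h) = ln (1 + A / h) + ln (1 + A / h)); last by ring.
have b y : 0 <= y -> y <= A -> ln (1 + y / h) <= ln (1 + A / h).
  move=> y0 yA; rewrite ler_ln ?posrE ?ltr_pwDl ?divr_ge0 ?(ltW h0) ?(ltW A0) //.
  by rewrite lerD2l ler_pM2r ?invr_gt0.
by apply: lerD; apply: b; lra.
Qed.

Lemma markov_itv (psi : R -> R) (a b lam B : R) : continuous psi ->
  (forall t, 0 <= psi t) -> 0 < lam -> rint a b psi <= B ->
  let E := [set t : R | a <= t <= b /\ lam <= psi t] in
  measurable (E : set (measurableTypeR R)) /\ (mu E <= (B / lam)%:E)%E.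
Proof.
move=> cpsi psi0 lam0 HB E.
have mpsi : measurable_fun setT (psi : measurableTypeR R -> measurableTypeR R).
  exact: continuous_measurable_fun.
have EE : E = `[a, b]%classic `&` (setT `&` psi @^-1` `[lam, +oo[).
  by apply/seteqP; split => t /=; rewrite !in_itv /= andbT => -[]; [|move=> ? []].
have mE : measurable (E : set (measurableTypeR R)).
  rewrite EE; apply: measurableI; first exact: measurable_itv.
  by apply: mpsi => //; exact: measurable_itv.
split=> //.
have H1 : (lam%:E * mu E <= \int[mu]_(t in E) (psi t)%:E)%E.
  rewrite -integral_cst //; apply: ge0_le_integral => //.
  - by move=> t _; rewrite lee_fin ltW.
  - by apply/measurable_EFinP; exact: measurable_funTS.
  - by move=> t [_ lt_]; rewrite lee_fin.
have H2 : (\int[mu]_(t in E) (psi t)%:E <= \int[mu]_(t in `[a, b]) (psi t)%:E)%E.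
  apply: ge0_subset_integral => //.
  - by apply/measurable_EFinP; exact: measurable_funTS.
  - by move=> t _; rewrite lee_fin.
  - by move=> t []; rewrite /= in_itv.
have H3 : (\int[mu]_(t in `[a, b]) (psi t)%:E = (rint a b psi)%:E)%E.
  rewrite /rint /Rintegral fineK //; apply: integrable_fin_num => //.
  exact: cont_integrable.
have : (lam%:E * mu E <= B%:E)%E.
  by apply: le_trans H1 (le_trans H2 _); rewrite H3 lee_fin.
rewrite muleC -lee_pdivlMr //.
Qed.

Lemma sum_cont (I : Type) (s : seq I) (F : I -> R -> R) :
  (forall i, continuous (F i)) -> continuous (fun t => \sum_(i <- s) F i t).
Proof.
move=> cF; elim: s => [|i s IH].
  by under eq_fun do rewrite big_nil; exact: cst_continuous.
by under eq_fun do rewrite big_cons; apply: cont_add.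
Qed.

Lemma rint_sum (I : Type) (s : seq I) (F : I -> R -> R) (a b : R) :
  (forall i, continuous (F i)) ->
  rint a b (fun t => \sum_(i <- s) F i t) = \sum_(i <- s) rint a b (F i).
Proof.
move=> cF; elim: s => [|i s IH].
  rewrite big_nil (@eq_rint _ _ _ _ (fun=> 0)) => [|t _]; last by rewrite big_nil.
  by rewrite /rint /Rintegral integral0.
rewrite big_cons -IH -rintD //; last exact: sum_cont.
by apply: eq_rint => t _; rewrite big_cons.
Qed.

(** The truncated sum psi of inverse distances has an integral of order N log
    Lam over [A, 2A]. With Lam of order N^(1 + tau) this is at most d Lam, so
    by Markov's inequality psi < Lam / A outside a set of measure d A. There
    the truncation is harmless, because every distance exceeds its threshold
    h. *)
Lemma radial_exceptional (tau d : R) : 0 < tau -> 0 < d ->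
  exists2 C, 0 < C & forall (I : eqType) (s : seq I) (k x : I -> R) (A N : R),
    0 < A -> (forall i, i \in s -> 1 <= k i) -> \sum_(i <- s) k i <= N ->
    exists E : set (measurableTypeR R), [/\ measurable E, (mu E <= (d * A)%:E)%E &
      forall r, A <= r <= 2 * A -> ~ E r ->
        (forall i, i \in s -> 0 < `|r - x i|) /\
        \sum_(i <- s) k i / `|r - x i| <= C * (N + 1) `^ (1 + tau) / A].
Proof.
move=> tau0 d0; pose be := tau / (1 + tau).
have tau1 : 0 < 1 + tau by rewrite ltr_pwDl // ltW.
have be0 : 0 < be by rewrite divr_gt0.
have be1 : be < 1 by rewrite ltr_pdivrMr // mul1r; lra.
pose c0 := (8 / (be * d)).
have c00 : 0 < c0 by rewrite divr_gt0 // mulr_gt0.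
pose C := 1 + c0 `^ (1 + tau).
have C1 : 1 <= C by rewrite lerDl powR_ge0.
exists (2 * C); first by rewrite mulr_gt0 // (lt_le_trans _ C1).
move=> I s k x A N A0 k1 kN.
have k0 i : i \in s -> 0 <= k i by move=> /k1; apply: le_trans.
have N0 : 0 <= N by apply: le_trans kN; rewrite big_seq; apply: sumr_ge0 => i /k0.
have N1 : 1 <= N + 1 by rewrite lerDr.
have N10 : 0 < N + 1 by rewrite (lt_le_trans _ N1).
pose Lam := C * (N + 1) `^ (1 + tau).
have Lam1 : 1 <= Lam.
  have := ler_powR N1 (ltW tau1); rewrite powRr0 => H.
  by have := ler_pM ler01 ler01 C1 H; rewrite mulr1.
have Lam0 : 0 < Lam by rewrite (lt_le_trans _ Lam1).
pose lam := Lam / A; have lam0 : 0 < lam by rewrite divr_gt0.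
pose h := (2 * lam)^-1; have h0 : 0 < h by rewrite invr_gt0 mulr_gt0.
pose psi t := \sum_(i <- s) `|k i| * (h + `|t - x i|)^-1.
have ck i : continuous (fun t : R => `|k i| * (h + `|t - x i|)^-1).
  by apply: cont_mulr; [exact: cst_continuous|exact: cont_kernel].
have cpsi : continuous psi by apply: sum_cont.
have psi0 t : 0 <= psi t.
  by apply: sumr_ge0 => i _; rewrite mulr_ge0 // invr_ge0 addr_ge0 // ltW.
have ipsi : rint A (2 * A) psi <= N * (2 * ln (1 + 2 * Lam)).
  rewrite /psi rint_sum //.
  have Ah : A / h = 2 * Lam.
    by rewrite /h invrK /lam; field; rewrite gt_eqF.
  apply: (@le_trans _ _ (\sum_(i <- s) k i * (2 * ln (1 + 2 * Lam)))).
    rewrite !big_seq; apply: ler_sum => i is_.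
    rewrite rintZ; last exact: cont_kernel.
    rewrite ger0_norm ?k0 // ler_wpM2l ?k0 // -Ah.
    exact: rint_kernel_le.
  rewrite -mulr_suml; apply: ler_wpM2r kN.
  by rewrite mulr_ge0 // ln_ge0 // lerDl mulr_ge0 // ltW.
have key : N * (2 * ln (1 + 2 * Lam)) <= d * Lam.
  have l1 : ln (1 + 2 * Lam) <= (4 * Lam) `^ be / be.
    rewrite ler_pdivlMr // mulrC -ln_powR.
    apply: le_trans (ln_le_id _) _; first by rewrite powR_gt0; lra.
    by apply: ge0_ler_powR; rewrite ?nnegrE ?(ltW be0) //; lra.
  have l2 : (4 * Lam) `^ be <= 4 * Lam `^ be.
    rewrite powRM ?(ltW Lam0) // ler_wpM2r ?powR_ge0 //.
    by rewrite -[leRHS](powRr1 (ler0n R 4)) // ler_powR ?(ltW be1) // ler1n.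
  have l3 : c0 * (N + 1) <= Lam `^ (1 - be).
    have e1 : 1 - be = (1 + tau)^-1 by rewrite /be; field; rewrite gt_eqF.
    have : (c0 * (N + 1)) `^ (1 + tau) <= Lam.
      rewrite powRM ?(ltW c00) ?(ltW N10) // /Lam ler_wpM2r ?powR_ge0 //.
      by rewrite lerDr.
    have p0 : 0 <= c0 * (N + 1) by rewrite mulr_ge0 // ltW.
    move=> H; have -> : c0 * (N + 1) = ((c0 * (N + 1)) `^ (1 + tau)) `^ (1 + tau)^-1.
      by rewrite -powRrM mulfV ?powRr1 // lt0r_neq0.
    rewrite e1.
    by apply: ge0_ler_powR; rewrite ?nnegrE ?powR_ge0 ?invr_ge0 ?(ltW tau1) ?(ltW Lam0).
  have e2 : Lam = Lam `^ (1 - be) * Lam `^ be.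
    rewrite -powRD ?subrK ?powRr1 ?(ltW Lam0) //.
    by rewrite (lt0r_neq0 Lam0) implybT.
  have q0 : 0 <= Lam `^ be := powR_ge0 _ _.
  apply: (@le_trans _ _ (d * (c0 * (N + 1)) * Lam `^ be)).
    have -> : d * (c0 * (N + 1)) * Lam `^ be = (N + 1) * (2 * (4 * Lam `^ be / be)).
      by rewrite /c0; field; rewrite !gt_eqF.
    apply: ler_pM => //; rewrite ?lerDl //; last first.
      by rewrite ler_wpM2l // (le_trans l1) // ler_wpM2r // invr_ge0 ltW.
    by rewrite mulr_ge0 // ln_ge0 // lerDl mulr_ge0 // ltW.
  by rewrite [in leRHS]e2 mulrA ler_wpM2r // ler_wpM2l // ltW.
have [mE EA] := markov_itv cpsi psi0 lam0 (le_trans ipsi key).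
exists [set t : R | A <= t <= 2 * A /\ lam <= psi t]; split => //.
  apply: le_trans EA _; rewrite lee_fin (_ : d * Lam / lam = d * A) // /lam.
  by field; rewrite !gt_eqF.
move=> r rA nE.
have psil : psi r < lam by rewrite ltNge; apply/negP => H; apply: nE.
have dist i : i \in s -> h < `|r - x i|.
  move=> is_; have ki := k1 i is_.
  have H0 : 0 < h + `|r - x i| by rewrite ltr_pwDl.
  have : (h + `|r - x i|)^-1 < lam.
    apply: le_lt_trans psil; rewrite /psi (big_rem i) //=.
    apply: (@le_trans _ _ (`|k i| * (h + `|r - x i|)^-1)).
      by rewrite ler_peMl ?invr_ge0 ?(ltW H0) // ger0_norm // k0.
    rewrite lerDl; apply: sumr_ge0 => j _.
    by rewrite mulr_ge0 // invr_ge0 addr_ge0 // ltW.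
  have -> : lam = (2 * h)^-1 by rewrite /h invfM invrK mulrA mulVf ?mul1r.
  by rewrite ltf_pV2 ?posrE ?mulr_gt0 //; lra.
split=> [i /dist|]; first exact: lt_trans.
apply: (@le_trans _ _ (2 * psi r)); last first.
  have -> : 2 * C * (N + 1) `^ (1 + tau) / A = 2 * lam by rewrite /lam /Lam; ring.
  by rewrite ler_wpM2l // ltW.
rewrite /psi mulr_sumr !big_seq; apply: ler_sum => i is_.
rewrite (ger0_norm (k0 i is_)) mulrCA ler_wpM2l ?k0 //.
have H := dist i is_; have H1 : 0 < `|r - x i| by exact: lt_trans H.
have H0 : 0 < h + `|r - x i| by rewrite ltr_pwDl.
rewrite -[2 in leRHS]invrK -invfM lef_pV2 ?posrE ?mulr_gt0 ?invr_gt0 //.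
rewrite mulrC ler_pdivrMr //; lra.
Qed.

End RadialEstimate.

(** * Upper logarithmic density *)

Section Limsup.
Context {R : realType}.

Lemma limf_esup_le (f : R -> \bar R) (c : \bar R) :
  (\forall x \near +oo, (f x <= c)%E) -> (limf_esup f +oo%R <= c)%E.
Proof.
move=> H; rewrite limf_esupE.
apply: (@le_trans _ _ (ereal_sup [set f x | x in [set x | (f x <= c)%E]])).
  by apply: ereal_inf_lbound; exists [set x | (f x <= c)%E].
by apply: ge_ereal_sup => _ [x /= fx <-].
Qed.

Lemma limf_esup_lt (f : R -> \bar R) (c : \bar R) :
  (limf_esup f +oo%R < c)%E -> \forall x \near +oo, (f x < c)%E.
Proof.
rewrite limf_esupE => /ereal_inf_lt[_ [V FV <-] HV].
apply: filterS FV => x Vx; apply: le_lt_trans HV.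
by apply: ereal_sup_ubound; exists x.
Qed.

End Limsup.

Section Density.
Context {R : realType}.
Notation mu := (@lebesgue_measure R).
Implicit Types S F G : set R.

(** For arbitrary sets, as an inequality between suprema over simple
    minorants. *)
Lemma log_measure_le S F : S `<=` F -> (log_measure S <= log_measure F)%E.
Proof.
move=> SF.
have pos (T : set R) (t : R) : `[1%R, +oo[%classic t -> (0 <= (\1_T t / t)%:E)%E.
  rewrite /= in_itv /= andbT => t1; rewrite lee_fin mulr_ge0 // invr_ge0.
  exact: le_trans t1.
rewrite /log_measure !ge0_integralE; try by move=> t; exact: pos.
apply: ereal_sup_le => _ [h /= Hh <-]; exists h => //= t.
apply: le_trans (Hh t) _; rewrite !patchE; case: ifP => // ti.
rewrite inE /= in ti; rewrite lee_fin; have := pos setT t ti.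
rewrite /= in_itv /= andbT in ti => _.
rewrite ler_wpM2r ?invr_ge0 ?(le_trans _ ti) // !indicE ler_nat.
by case: (boolP (t \in S)) => //= /set_mem/SF/mem_set ->.
Qed.

(** The density of the logarithmic measure on [1, +oo), extended continuously
    to the line. *)
Let kap (t : R) : R := (Num.max 1 t)^-1.

Let kap_gt0 t : 0 < kap t.
Proof. by rewrite invr_gt0 lt_max ltr01. Qed.

Let mkap : measurable_fun setT (kap : measurableTypeR R -> measurableTypeR R).
Proof.
apply: continuous_measurable_fun => t; apply: cvgV.
  by rewrite gt_eqF // lt_max ltr01.
have := @cont_max R (fun=> 1) id; apply => //.
  by move=> s; exact: cst_continuous.
by move=> s; exact: cvg_id.
Qed.

Let mfun F : measurable (F : set (measurableTypeR R)) ->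
  measurable_fun setT ((fun t => \1_F t * kap t) : measurableTypeR R -> measurableTypeR R).
Proof. by move=> mF; apply: measurable_funM => //; exact: measurable_indic. Qed.

Let log_measureE F : log_measure F =
  (\int[mu]_(t in `[1%R, +oo[) (\1_F t * kap t)%:E)%E.
Proof.
apply: eq_integral => t; rewrite inE /= in_itv /= andbT => t1.
by rewrite /kap (max_idPr t1).
Qed.

Lemma log_measureU F G : measurable (F : set (measurableTypeR R)) ->
  measurable (G : set (measurableTypeR R)) ->
  (log_measure (F `|` G) <= log_measure F + log_measure G)%E.
Proof.
move=> mF mG; rewrite !log_measureE.
have mFG : measurable (F `|` G : set (measurableTypeR R)) by exact: measurableU.
have pos (T : set R) t : (0 <= (\1_T t * kap t)%:E)%E.
  by rewrite lee_fin mulr_ge0 // ltW.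
rewrite -ge0_integralD //; last 2 first.
- by apply/measurable_EFinP; apply: measurable_funTS; exact: mfun.
- by apply/measurable_EFinP; apply: measurable_funTS; exact: mfun.
apply: ge0_le_integral => //.
- by apply/measurable_EFinP; apply: measurable_funTS; exact: mfun.
- apply/measurable_EFinP; apply: measurable_funTS.
  by apply: measurable_funD; exact: mfun.
move=> t _; rewrite -EFinD lee_fin -mulrDl ler_wpM2r ?(ltW (kap_gt0 t)) //.
rewrite !indicE -natrD ler_nat.
case: (boolP (t \in F `|` G)) => // /set_mem[/mem_set->//|/mem_set->].
by rewrite addn1.
Qed.

Lemma log_measure_itv F a : measurable (F : set (measurableTypeR R)) -> 1 <= a ->
  (forall t, F t -> a <= t) -> (log_measure F <= (a^-1)%:E * mu F)%E.
Proof.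
move=> mF a1 Fa; have a0 : 0 < a by exact: lt_le_trans a1.
rewrite log_measureE.
have pos (T : set R) t : (0 <= (\1_T t * kap t)%:E)%E.
  by rewrite lee_fin mulr_ge0 // ltW.
apply: (@le_trans _ _ (\int[mu]_(t in F) (cst (a^-1)%:E t))%E); last by rewrite integral_cst.
have -> : (\int[mu]_(t in F) (cst (a^-1)%:E t) =
    \int[mu]_(t in setT) ((a^-1)%:E * (\1_F t)%:E))%E.
  rewrite integral_mkcond; apply: eq_integral => t _.
  by rewrite patchE indicE; case: ifP => _ /=; rewrite ?mule1 ?mule0.
apply: (@le_trans _ _ (\int[mu]_(t in setT) (\1_F t * kap t)%:E)%E).
  apply: ge0_subset_integral => //.
  by apply/measurable_EFinP; exact: mfun.
apply: ge0_le_integral => //.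
- by apply/measurable_EFinP; exact: mfun.
- apply/measurable_EFinP; apply: measurable_funM => //; exact: measurable_indic.
move=> t _; rewrite -EFinM lee_fin indicE.
case: (boolP (t \in F)) => [/set_mem/Fa at_|_]; last by rewrite mul0r mulr0.
by rewrite mul1r mulr1 /kap (max_idPr (le_trans a1 at_)) lef_pV2 ?posrE // (lt_le_trans a0).
Qed.

(** Otherwise S would be covered by one set of logarithmic measure at most d
    in each dyadic interval [A, 2A], and its density would be at most d / log
    2, up to an additive constant in the measure. *)
Lemma pos_density S : (0 < upper_log_density S)%E ->
  exists2 d : R, 0 < d & forall A0 : R, exists A, [/\ A0 <= A, 1 <= A &
    forall E : set (measurableTypeR R), measurable E -> (mu E <= (d * A)%:E)%E ->
      exists r, [/\ S r, A <= r <= 2 * A & ~ E r]].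
Proof.
move=> HS.
have [dl dl0 Hdl] : exists2 dl : R, 0 < dl & (dl%:E < upper_log_density S)%E.
  move: HS; case: (upper_log_density S) => [x| |] //.
  - by rewrite lte_fin => x0; exists (x / 2);
      [rewrite divr_gt0|rewrite lte_fin ltr_pdivrMr // ltr_pMr // ltr1n].
  - by exists 1 => //; rewrite ltry.
have l2 : 0 < ln 2 :> R by rewrite ln_gt0 // ltr1n.
(* d / log 2 is half of the lower bound dl of the density *)
pose d := dl * ln 2 / 2; have d0 : 0 < d by rewrite divr_gt0 // mulr_gt0.
exists d => // A0; apply: contrapT => /forallNP H.
have {}H A : A0 <= A -> 1 <= A -> exists E : set (measurableTypeR R),
    [/\ measurable E, (mu E <= (d * A)%:E)%E & forall r, S r -> A <= r <= 2 * A -> E r].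
  move=> A01 A1; apply: contrapT => /forallNP H2; apply: (H A); split => // E mE EA.
  apply: contrapT => /forallNP H3; apply: (H2 E); split => // r Sr rA.
  by apply: contrapT => nE; apply: (H3 r).
pose A1 := Num.max A0 1.
have A11 : 1 <= A1 by rewrite le_max lexx orbT.
have A10 : 0 < A1 by rewrite (lt_le_trans _ A11).
have cover (M : nat) : exists F : set (measurableTypeR R), [/\ measurable F,
    forall r, S r -> 1 <= r <= A1 * 2 ^+ M -> F r &
    (log_measure F <= (A1 + M%:R * d)%:E)%E].
  elim: M => [|M [F [mF F1 F2]]].
    exists `[1, A1]%classic; split => //.
      by move=> r _; rewrite expr0 mulr1 /= in_itv.
    apply: le_trans (log_measure_itv (a := 1) _ _ _) _ => //.
      by move=> t; rewrite /= in_itv /= => /andP[].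
    rewrite invr1 mul1e mul0r addr0 lebesgue_measure_itv /=; case: ifP => _.
      by rewrite -EFinB lee_fin gerBl.
    by rewrite lee_fin ltW.
  pose A := A1 * 2 ^+ M.
  have A1A : A1 <= A by rewrite ler_peMr ?(ltW A10) // exprn_ege1 // ler1n.
  have A1' : 1 <= A by exact: le_trans A1A.
  have [||E [mE E1 E2]] := H A; [|by []|].
    by apply: le_trans A1A; rewrite le_max lexx.
  pose G := E `&` `[A, 2 * A]%classic.
  have mG : measurable (G : set (measurableTypeR R)) by apply: measurableI.
  exists (F `|` G); split; first exact: measurableU.
    move=> r Sr /andP[r1 rM]; have [rA|Ar] := leP r A.
      by left; apply: F1 => //; rewrite r1.
    right; have rA : A <= r <= 2 * A.
      by rewrite (ltW Ar) /=; move: rM; rewrite exprS /A; lra.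
    by split; [exact: (E2 r Sr rA)|rewrite /= in_itv /=].
  apply: le_trans (log_measureU mF mG) _.
  rewrite (_ : A1 + M.+1%:R * d = (A1 + M%:R * d) + d); last by rewrite -natr1; ring.
  rewrite EFinD leeD //.
  apply: le_trans (log_measure_itv (a := A) mG A1' _) _.
    by move=> t [_]; rewrite /= in_itv /= => /andP[].
  have A0' : 0 < A by exact: lt_le_trans A1'.
  apply: (@le_trans _ _ ((A^-1)%:E * (d * A)%:E)%E).
    rewrite lee_wpmul2l ?lee_fin ?invr_ge0 ?(ltW A0') //.
    by apply: le_trans E1; apply: le_measure; rewrite ?inE // => t [].
  by rewrite -EFinM lee_fin mulrCA mulVf ?mulr1 // gt_eqF.
suff : (upper_log_density S <= dl%:E)%E by rewrite leNgt Hdl.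
apply: limf_esup_le.
have C0 : 0 < A1 + d by rewrite addr_gt0.
near=> r.
have r1 : A1 < r by near: r; apply: nbhs_pinfty_gt; exact: num_real.
have r2 : expR (2 * (A1 + d) / dl) < r by near: r; apply: nbhs_pinfty_gt; exact: num_real.
have r0 : 0 < r by exact: lt_trans r1.
have lr : 2 * (A1 + d) / dl < ln r by rewrite -(expRK (_ / _)) ltr_ln ?posrE ?expR_gt0.
have lr0 : 0 < ln r by apply: lt_trans lr; rewrite divr_gt0 // mulr_gt0.
pose M := (Num.truncn (ln r / ln 2)).+1.
have x0 : 0 <= ln r / ln 2 by rewrite divr_ge0 ?ltW.
have /andP[M1 M2] := truncn_itv x0.
have [F [mF F1 F2]] := cover M.
have rM : r <= A1 * 2 ^+ M.
  apply: (@le_trans _ _ (2 ^+ M)); last by rewrite ler_peMl ?exprn_ge0.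
  rewrite -ler_ln ?posrE ?exprn_gt0 // lnXn //.
  by have := ltW M2; rewrite ler_pdivrMr // mulr_natl.
have : (log_measure (S `&` `[1%R, r]) <= (A1 + M%:R * d)%:E)%E.
  apply: le_trans F2; apply: log_measure_le => t [St]; rewrite /= in_itv /= => /andP[t1 tr].
  by apply: F1 => //; rewrite t1 (le_trans tr).
move=> H1; apply: (@le_trans _ _ ((A1 + M%:R * d)%:E * ((ln r)^-1)%:E)%E).
  by rewrite lee_wpmul2r // lee_fin invr_ge0 ltW.
rewrite -EFinM lee_fin ler_pdivrMr //.
have M3 : M%:R * d <= (ln r / ln 2 + 1) * d.
  by rewrite ler_wpM2r ?(ltW d0) // /M -natr1 lerD2r.
have M4 : ln r / ln 2 * d = dl / 2 * ln r by rewrite /d; field; rewrite gt_eqF.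
have M5 : A1 + d <= dl / 2 * ln r.
  by rewrite mulrAC ler_pdivlMr // mulrC [leRHS]mulrC -ler_pdivrMr // ltW.
rewrite mulrDl mul1r M4 in M3.
apply: le_trans (_ : A1 + (dl / 2 * ln r + d) <= _); first by rewrite lerD2l.
rewrite addrCA (le_trans (_ : _ <= dl / 2 * ln r + dl / 2 * ln r)) ?lerD2l //.
by rewrite -mulrDl -splitr.
Unshelve. all: by end_near.
Qed.

End Density.

(** * Quotients of shifts *)

Section ShiftQuotient.
Context {R : realType}.
Implicit Types (z w a : R[i]).
Variable f : R[i] -> R[i].
Hypotheses (fm : meromorphic f) (f0 : not_identically_zero f).

Local Notation specials := (specials fm f0).
Local Notation T := (nevanlinna_T f).

Lemma ex_shift_bound (n : nat) (cs : 'I_n -> R[i]) :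
  exists2 B : R, 1 <= B & forall j, normc (cs j) <= B.
Proof.
exists (1 + \sum_j normc (cs j)); first by rewrite lerDl; apply: sumr_ge0 => j _; exact: normc_ge0.
move=> j; rewrite (bigD1 j) //= addrCA lerDl addr_ge0 //.
by apply: sumr_ge0 => i _; exact: normc_ge0.
Qed.

(** [ln_normc_f_diff] on a circle of radius about 9 A, which leaves room for
    the shifts. The number of zeros and poles is bounded by T at about twice
    the radius. Since |z + c_j - a| is at least the distance from |z| to |a -
    c_j|, it is enough that |z| avoids the exceptional radii of the points a -
    c_j. *)
Lemma shift_quotient (n : nat) (cs : 'I_n -> R[i]) (tau d : R) : 0 < tau -> 0 < d ->
  exists2 C, 0 < C & exists A0, forall A, A0 <= A ->
    exists (E : set (measurableTypeR R)) (R1 R2 : R),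
    [/\ measurable E, (lebesgue_measure E <= (d * A)%:E)%E,
      8 * A < R1 < 9 * A, 18 * A < R2 < 19 * A &
      forall z, A <= normc z <= 2 * A -> ~ E (normc z) ->
        (forall j, ord f (z + cs j) = 0) /\
        forall i j, `|ln (normc (f (z + cs i))) - ln (normc (f (z + cs j)))| <=
          C * (1 + Num.max 0 (T R1) + Num.max 0 (T R2)) `^ (1 + tau) / A].
Proof.
move=> tau0 d0; have [B B1 HB] := ex_shift_bound cs.
have B0 : 0 < B by exact: lt_le_trans B1.
have [C1 C10 HC1] := @radial_exceptional R tau d tau0 d0.
pose K := `|ln (normc (lc f 0))|.
have K0 : 0 <= K by exact: normr_ge0.
have l2 : 0 < ln 2 :> R by rewrite ln_gt0 // ltr1n.
pose C2 := n%:R * ((2 + K) / ln 2) + 1.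
have C20 : 1 <= C2 by rewrite lerDr mulr_ge0 // divr_ge0 ?(ltW l2) // addr_ge0.
pose C := 2 * B * (2 * (2 + K) + 2 * (C1 * C2 `^ (1 + tau)) + (2 + K) / ln 2).
have p0 : 0 <= C2 `^ (1 + tau) := powR_ge0 _ _.
have q0 : 0 <= (2 + K) / ln 2 by rewrite divr_ge0 ?(ltW l2) // addr_ge0.
have C0 : 0 < C.
  have : 0 <= C1 * C2 `^ (1 + tau) by rewrite mulr_ge0 // ltW.
  by move=> h; rewrite /C mulr_gt0 //; lra.
exists C => //; exists (1 + B) => A A1.
have A0 : 0 < A by lra.
have [R1 /andP[R1a R1b] gen1] := @ex_generic _ f fm f0 (8 * A) (9 * A) ltac:(lra).
have [R2 /andP[R2a R2b] gen2] := @ex_generic _ f fm f0 (18 * A) (19 * A) ltac:(lra).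
have [R10 R11 R1h R12 R20] : [/\ 0 < R1, 1 <= R1, R1 / 2 <= R1, 2 * R1 <= R2 & 2 <= R2].
  by split; lra.
have [RA1 RA2 RA3] : [/\ 2 * A + B <= R1 / 2, 16 * A <= 2 * R1 & 4 * A <= R1] by split; lra.
set s := specials R1.
pose Tm := 1 + Num.max 0 (T R1) + Num.max 0 (T R2).
have m1 : 0 <= Num.max 0 (T R1) by rewrite le_max lexx.
have m2 : 0 <= Num.max 0 (T R2) by rewrite le_max lexx.
have Tm1 : 1 <= Tm by rewrite /Tm -addrA lerDl addr_ge0.
have Tm0 : 0 <= Tm by exact: le_trans Tm1.
have TR1 : T R1 <= Tm.
  have h : T R1 <= Num.max 0 (T R1) by rewrite le_max lexx orbT.
  by apply: le_trans h _; rewrite /Tm addrAC lerDr addr_ge0.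
have TR2 : T R2 <= Tm.
  have h : T R2 <= Num.max 0 (T R2) by rewrite le_max lexx orbT.
  by apply: le_trans h _; rewrite /Tm lerDr addr_ge0.
have KT x : x <= Tm -> 2 * x + K <= (2 + K) * Tm.
  by move=> xT; rewrite [leRHS]mulrDl lerD ?ler_peMr // ler_pM2l.
have cnt : \sum_(a <- s) `|ord f a|%:~R <= (2 + K) / ln 2 * Tm.
  apply: le_trans (count_specials fm f0 R20 R12 gen2) _.
  by rewrite mulrAC ler_wpM2r ?invr_ge0 ?(ltW l2) // KT.
pose pairs := [seq (a, j) | a <- s, j <- enum 'I_n].
pose N := n%:R * ((2 + K) / ln 2 * Tm).
have sumE (g : R[i] -> 'I_n -> R) :
    \sum_(p <- pairs) g p.1 p.2 = \sum_(a <- s) \sum_(j < n) g a j.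
  by rewrite big_allpairs_dep /=; apply: eq_bigr => a _; rewrite big_enum.
have kN : \sum_(p <- pairs) `|ord f p.1|%:~R <= N :> R.
  rewrite (sumE (fun a _ => `|ord f a|%:~R)).
  under eq_bigr do rewrite sumr_const card_ord -mulr_natl.
  by rewrite -mulr_sumr ler_wpM2l.
have k1 p : p \in pairs -> 1 <= `|ord f p.1|%:~R :> R.
  move=> /allpairsP[[a j] [/= as_ _ ->]] /=.
  have : ord f a != 0 by move: as_; rewrite mem_specials => /andP[].
  by rewrite -normr_gt0 ler1z gtz0_ge1.
have [E [mE EA HE]] := HC1 _ pairs (fun p => `|ord f p.1|%:~R)
  (fun p => normc (p.1 - cs p.2)) A N A0 k1 kN.
exists E, R1, R2; split; rewrite ?R1a ?R2a // => z zA /(HE _ zA)[H1 H2].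
have near_ p : `|normc z - normc (p.1 - cs p.2)| <= normc (z + cs p.2 - p.1).
  have -> : z + cs p.2 - p.1 = z - (p.1 - cs p.2) by rewrite opprB addrA addrAC.
  by rewrite ler_norml normc_triB andbT lerNl opprB normc_distC normc_triB.
have zj j : normc (z + cs j) <= R1 / 2.
  apply: le_trans (normcD _ _) _; apply: le_trans RA1.
  by rewrite lerD ?HB //; case/andP: zA.
have inp a j : a \in s -> (a, j) \in pairs.
  by move=> as_; apply/allpairsP; exists (a, j); rewrite mem_enum.
have dist a j : a \in s -> 0 < normc (z + cs j - a).
  by move=> as_; exact: lt_le_trans (H1 _ (inp a j as_)) (near_ (a, j)).
have oz j : ord f (z + cs j) = 0.
  apply/eqP; rewrite -[_ == _]negbK; apply/negP => o0.
  have zs : z + cs j \in s by rewrite mem_specials o0 andbT; exact: le_trans (zj j) R1h.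
  by have := dist _ j zs; rewrite subrr normc0 ltxx.
split=> // i j.
have [U1 _] := nevanlinna_bounds fm f0 R11 gen1.
apply: le_trans (ln_normc_f_diff fm f0 R11 gen1 (zj j) (zj i) (oz j) (oz i)) _.
have Tp : Tm <= Tm `^ (1 + tau).
  by rewrite -[leLHS](powRr1 (a := Tm)) ?(le_trans _ Tm1) // ler_powR // lerDl ltW.
have S1 j' : \sum_(a <- s) `|ord f a|%:~R / normc (z + cs j' - a) <=
    C1 * (N + 1) `^ (1 + tau) / A.
  apply: le_trans H2.
  rewrite (sumE (fun a j => `|ord f a|%:~R / `|normc z - normc (a - cs j)|)).
  rewrite !big_seq; apply: ler_sum => a as_; rewrite (bigD1 j') //=.
  rewrite -[leLHS]addr0 lerD //.
    rewrite ler_wpM2l ?ler0z // lef_pV2 ?posrE ?dist //; first exact: (near_ (a, j')).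
    exact: (H1 (a, j') (inp a j' as_)).
  by apply: sumr_ge0 => j2 _; rewrite mulr_ge0 ?ler0z ?invr_ge0.
have N1 : (N + 1) `^ (1 + tau) <= C2 `^ (1 + tau) * Tm `^ (1 + tau).
  have N0 : 0 <= N by rewrite /N mulr_ge0 // mulr_ge0.
  have C2p : 0 <= C2 by exact: le_trans C20.
  have NC : N + 1 <= C2 * Tm.
    by rewrite (_ : C2 * Tm = N + Tm) ?lerD2l //; rewrite /N /C2; ring.
  rewrite -powRM //; apply: ge0_ler_powR NC; rewrite ?nnegrE ?addr_ge0 ?(ltW tau0) //.
  exact: mulr_ge0.
have zij : normc (z + cs i - (z + cs j)) <= 2 * B.
  rewrite opprD addrACA subrr add0r; apply: le_trans (normcB _ _) _.
  by rewrite mulr_natl mulr2n lerD.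
set X := Tm `^ (1 + tau).
have X0 : 0 <= X := powR_ge0 _ _.
have Ai : 0 < A^-1 by rewrite invr_gt0.
have t1 : 16 / R1 * rmean (fun t => `|ln (normc (f (circ R1 t)))|) <= 2 * (2 + K) * X / A.
  have hU : rmean (fun t => `|ln (normc (f (circ R1 t)))|) <= (2 + K) * X.
    apply: le_trans U1 _; apply: le_trans (KT _ TR1) _.
    by rewrite ler_wpM2l // addr_ge0.
  have hR : 16 / R1 <= 2 / A.
    by rewrite ler_pdivrMr // mulrAC ler_pdivlMr.
  apply: (@le_trans _ _ (16 / R1 * ((2 + K) * X))).
    by rewrite ler_wpM2l // divr_ge0 // ltW.
  rewrite (_ : 2 * (2 + K) * X / A = 2 / A * ((2 + K) * X)); last by ring.
  by rewrite ler_wpM2r // mulr_ge0 // addr_ge0.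
have t2 j' : \sum_(a <- s) `|ord f a|%:~R / normc (z + cs j' - a) <= C1 * C2 `^ (1 + tau) * X / A.
  apply: le_trans (S1 j') _; rewrite ler_wpM2r ?(ltW Ai) // -mulrA.
  by rewrite ler_wpM2l ?(ltW C10).
have t3 : \sum_(a <- s) `|ord f a|%:~R * (4 / R1) <= (2 + K) / ln 2 * X / A.
  rewrite -mulr_suml; apply: ler_pM => //.
  - by apply: sumr_ge0 => a _; rewrite ler0z.
  - by rewrite divr_ge0 // ltW.
  - by apply: le_trans cnt _; rewrite ler_wpM2l.
  - by rewrite ler_pdivrMr // mulrC ler_pdivlMr.
apply: (@le_trans _ _ (2 * B * (2 * (2 + K) * X / A +
   (C1 * C2 `^ (1 + tau) * X / A + C1 * C2 `^ (1 + tau) * X / A + (2 + K) / ln 2 * X / A)))).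
  apply: ler_pM zij _ => //; first exact: normc_ge0.
    apply: addr_ge0.
      rewrite mulr_ge0 ?divr_ge0 ?(ltW R10) // -(rmean_cst 0); apply: rmean_le => //.
        exact: cst_continuous.
      exact: cont_norm (cont_ln_f_circ fm f0 R11 gen1).
    apply: sumr_ge0 => a _; rewrite mulr_ge0 ?ler0z //.
    by rewrite !addr_ge0 ?invr_ge0 ?normc_ge0 // divr_ge0 // ltW.
  rewrite lerD //; under eq_bigr do rewrite !mulrDr.
  by rewrite !big_split /= !lerD.
by rewrite le_eqVlt; apply/orP; left; apply/eqP; rewrite /C; ring.
Qed.

(** The radii of D cannot all fall into the exceptional sets of
    [shift_quotient]. *)
Lemma good_point (n : nat) (cs : 'I_n -> R[i]) (D : set R[i]) (tau : R) :
  (0 < upper_log_density [set normc z | z in D])%E -> 0 < tau ->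
  exists2 C, 0 < C & forall A0 : R, exists A z R1 R2,
    [/\ A0 <= A /\ 1 <= A, D z, A <= normc z <= 2 * A,
      8 * A < R1 < 9 * A /\ 18 * A < R2 < 19 * A &
      (forall j, ord f (z + cs j) = 0) /\
      forall i j, `|ln (normc (f (z + cs i))) - ln (normc (f (z + cs j)))| <=
          C * (1 + Num.max 0 (T R1) + Num.max 0 (T R2)) `^ (1 + tau) / A].
Proof.
move=> HD tau0; have [d d0 Hd] := pos_density HD.
have [C C0 [A1 HA1]] := @shift_quotient n cs tau d tau0 d0.
exists C => // A0; have [A [A2 A3 HA]] := Hd (Num.max A0 A1).
have [A4 A5] : A0 <= A /\ A1 <= A by move: A2; rewrite ge_max => /andP[].
have [E [R1 [R2 [mE EA r1 r2 H]]]] := HA1 A A5.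
have [_ [[z Dz <-] zA nE]] := HA E mE EA.
by exists A, z, R1, R2; split => //; exact: H.
Qed.

End ShiftQuotient.

(** * Iterated exponentials and rational functions *)

Section IteratedExp.
Context {R : realType}.
Implicit Types (x y a b K : R) (n : nat).

Lemma exp_S n x : exp_ n.+1 x = expR (exp_ n x).
Proof. by []. Qed.

Lemma exp_Sr n x : exp_ n.+1 x = exp_ n (expR x).
Proof. exact: iterSr. Qed.

Lemma log_S n x : log_ n.+1 x = ln (log_ n x).
Proof. by []. Qed.

Lemma ler_exp_ n x y : x <= y -> exp_ n x <= exp_ n y.
Proof. by move=> xy; elim: n => // n IH; rewrite !exp_S ler_expR. Qed.

Lemma exp_ge_id n x : x <= exp_ n x.
Proof.
elim: n => // n IH; rewrite exp_S; apply: le_trans IH _.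
by apply: le_trans (expR_ge1Dx _); rewrite lerDr.
Qed.

Lemma exp_gt0 n x : (0 < n)%N -> 0 < exp_ n x.
Proof. by case: n => // n _; rewrite exp_S expR_gt0. Qed.

Lemma log_le_exp n x y : log_ n x <= y -> x <= exp_ n y.
Proof.
elim: n y => // n IH y; rewrite log_S exp_Sr => H; apply: IH.
have [l0|l0] := leP (log_ n x) 0; first by apply: le_trans l0 (ltW (expR_gt0 _)).
by rewrite -(lnK (x := log_ n x)) ?posrE // ler_expR.
Qed.

Lemma log_pinfty n K : \forall r \near (+oo%R : set_system R), K < log_ n r.
Proof.
elim: n K => [|n IH] K; first by apply: nbhs_pinfty_gt; exact: num_real.
apply: filterS (IH (expR K)) => r H; rewrite log_S -(expRK K).
by rewrite ltr_ln ?posrE ?expR_gt0 // (lt_trans (expR_gt0 K)).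
Qed.

Lemma ler_ln1 x y : x <= y -> 1 <= y -> ln x <= ln y.
Proof.
move=> xy y1; have [x0|x0] := leP x 0; first by rewrite ln0 // ln_ge0.
by rewrite ler_ln ?posrE // (lt_le_trans x0).
Qed.

(** Iterated logarithms do not feel a constant factor. *)
Lemma log_scale n (c : R) : 1 <= c -> \forall r \near (+oo%R : set_system R),
  forall s, s <= c * r -> log_ n.+1 s <= 2 * log_ n.+1 r.
Proof.
move=> c1; have c0 : 0 < c by exact: lt_le_trans c1.
elim: n => [|n IH].
  near=> r => s sr.
  have rc : c < r by near: r; apply: nbhs_pinfty_gt; exact: num_real.
  have r1 : 1 <= r by rewrite (le_trans c1) // ltW.
  have r0 : 0 < r by exact: lt_le_trans r1.
  rewrite !log_S /=; apply: le_trans (ler_ln1 sr _) _.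
    by rewrite -[1]mulr1 ler_pM.
  rewrite lnM ?posrE //.
  have : ln c <= ln r by rewrite ler_ln ?posrE // ltW.
  lra.
have := IH; have := log_pinfty n.+1 2; apply: filterS2 => r r2 H s /H Hs.
rewrite [log_ n.+2 s]log_S [log_ n.+2 r]log_S.
have l0 : 0 < log_ n.+1 r by lra.
apply: le_trans (ler_ln1 Hs _) _; first by lra.
rewrite lnM ?posrE //.
have : ln 2 <= ln (log_ n.+1 r) by rewrite ler_ln ?posrE // ltW.
lra.
Unshelve. all: by end_near.
Qed.

Lemma exp_ge2 n y : (0 < n)%N -> 1 <= y -> 2 <= exp_ n y.
Proof.
case: n => // n _ y1; rewrite exp_S; apply: le_trans (expR_ge1Dx _).
by have := exp_ge_id n y; lra.
Qed.

Lemma exp_sqr n y : (0 < n)%N -> 1 <= y -> exp_ n y ^+ 2 <= exp_ n (2 * y).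
Proof.
case: n => // n _ y1; elim: n => [|n IH].
  by rewrite !exp_S /= expr2 -expRD mulr_natl mulr2n.
rewrite [exp_ n.+2 y]exp_S [exp_ n.+2 (2 * y)]exp_S expr2 -expRD ler_expR.
apply: le_trans IH; have := exp_ge2 (n := n.+1) isT y1; rewrite expr2.
by move: (exp_ n.+1 y) => E E2; nra.
Qed.

Lemma exp_dominates n a b K : (0 < n)%N -> 0 <= K -> 0 <= b < a ->
  \forall y \near (+oo%R : set_system R), K + K * exp_ n (b * y) < exp_ n (a * y).
Proof.
case: n => // n _; elim: n K => [|n IH] K K0 ba; case/andP: (ba) => b0 ab.
  have ab0 : 0 < a - b by rewrite subr_gt0.
  near=> y.
  have y1 : 2 * K / (a - b) < y by near: y; apply: nbhs_pinfty_gt; exact: num_real.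
  have y0 : 0 < y by near: y; apply: nbhs_pinfty_gt; exact: num_real.
  rewrite ltr_pdivrMr // in y1.
  rewrite !exp_S /= (_ : a * y = b * y + (a - b) * y); last by ring.
  rewrite expRD; have := expR_ge1Dx ((a - b) * y).
  have : 1 <= expR (b * y) by rewrite -expR0 ler_expR mulr_ge0 // ltW.
  by move: (expR (b * y)) (expR _) => E F; nra.
have K1 : 0 <= 2 * K + 1 by lra.
have := IH _ K1 ba; apply: filterS => y H.
rewrite exp_S [exp_ n.+2 (a * y)]exp_S.
apply: (@le_lt_trans _ _ (expR (2 * K + exp_ n.+1 (b * y)))).
  rewrite expRD; have := expR_ge1Dx (2 * K).
  have e0 : 0 <= exp_ n.+1 (b * y) by rewrite ltW // exp_gt0.
  have : 1 <= expR (exp_ n.+1 (b * y)) by rewrite -expR0 ler_expR.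
  by move: (expR _) (expR (2 * K)) => E F; nra.
rewrite ltr_expR; apply: le_lt_trans H.
have e0 : 0 <= exp_ n.+1 (b * y) by rewrite ltW // exp_gt0.
move: e0; move: (exp_ n.+1 _) => E; nra.
Unshelve. all: by end_near.
Qed.

Lemma exp_dominates0 n a b K : 0 <= b < a ->
  \forall y \near (+oo%R : set_system R), K + exp_ n (b * y) < exp_ n (a * y).
Proof.
move=> ab; case: n => [|n].
  case/andP: ab => b0 ab; have ab0 : 0 < a - b by rewrite subr_gt0.
  near=> y.
  have y1 : K / (a - b) < y by near: y; apply: nbhs_pinfty_gt; exact: num_real.
  by rewrite ltr_pdivrMr // in y1; rewrite /exp_ /=; lra.
have K1 : 0 <= `|K| + 1 by rewrite addr_ge0.
have := exp_dominates (n := n.+1) isT K1 ab; apply: filterS => y.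
have e0 : 0 <= exp_ n.+1 (b * y) by rewrite ltW // exp_gt0.
have := ler_norm K; have := normr_ge0 K.
by move: (exp_ _ _) (`|K|) e0 => E k; nra.
Unshelve. all: by end_near.
Qed.

End IteratedExp.

Section Rational.
Context {R : realType}.
Implicit Types (z w : R[i]).

(** Moving the argument by a bounded amount multiplies each factor z - a by at
    most 2, once z is large. *)
Lemma poly_shift_bound (P : {poly R[i]}) (B : R) : P != 0 -> 0 <= B ->
  exists r0, forall z w, r0 <= normc z -> normc (w - z) <= B ->
    P.[z] != 0 /\ normc P.[w] <= 2 ^+ size P * normc P.[z].
Proof.
move=> P0 B0; have [s Ps] := closed_field_poly_normal P.
exists (B + 1 + \sum_(a <- s) normc a) => z w zr wz.
have fac a : a \in s -> normc (z - a) != 0 /\ normc (w - a) <= 2 * normc (z - a).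
  move=> as_; have : normc a <= \sum_(a <- s) normc a.
    rewrite (big_rem a) //= lerDl; apply: sumr_ge0 => b _; exact: normc_ge0.
  move=> h; have h2 := normc_triB z a.
  split; first by rewrite gt_eqF //; lra.
  apply: le_trans (normc_distD _ z _) _; lra.
have hp v : normc P.[v] = normc (lead_coef P) * \prod_(a <- s) normc (v - a).
  rewrite {1}Ps hornerZ normcM horner_prod normc_prod; congr (_ * _).
  by apply: eq_bigr => a _; rewrite hornerXsubC.
have l0 : 0 < normc (lead_coef P) by rewrite normc_gt0 lead_coef_eq0.
have ss : (size s <= size P)%N.
  rewrite {1}Ps size_scale ?lead_coef_eq0 // size_prod_XsubC; exact: leqnSn.
split.
  rewrite -normc_eq0 hp gt_eqF // mulr_gt0 // lt_def.
  rewrite prodr_ge0 ?andbT => [|a _]; last exact: normc_ge0.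
  by rewrite prodf_seq_neq0; apply/allP => a /fac[].
rewrite !hp mulrCA ler_wpM2l ?(ltW l0) //.
apply: (@le_trans _ _ (2 ^+ size s * \prod_(a <- s) normc (z - a))); last first.
  by rewrite ler_wpM2r ?prodr_ge0 // ?ler_weXn2l ?ler1n // => a _; exact: normc_ge0.
elim: s fac {Ps hp ss zr} => [|a s IH] fac; first by rewrite !big_nil mulr1.
rewrite !big_cons exprS.
have [_ h1] := fac a (mem_head _ _).
have h2 : \prod_(j <- s) normc (w - j) <= 2 ^+ size s * \prod_(j <- s) normc (z - j).
  by apply: IH => b bs; apply: fac; rewrite inE bs orbT.
rewrite mulrACA ler_pM ?normc_ge0 ?prodr_ge0 // => b _; exact: normc_ge0.
Qed.

Lemma rational_shift (f : R[i] -> R[i]) (n : nat) (cs : 'I_n -> R[i]) :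
  meromorphic f -> not_identically_zero f -> rational_function f ->
  exists Q r0, forall z, r0 <= normc z -> (forall j, ord f (z + cs j) = 0) ->
    forall i j, `|ln (normc (f (z + cs i))) - ln (normc (f (z + cs j)))| <= Q.
Proof.
move=> fm f0 [P [Qp [Q0 fE]]].
have [B B1 HB] := ex_shift_bound cs.
have B20 : 0 <= 2 * B by lra.
have [r1 H1] := poly_shift_bound Q0 B20.
have [P0|P0] := eqVneq P 0.
  exists 0, (r1 + B) => z zr oz i j; exfalso.
  have [_ E] := ord_eq0 fm f0 (oz i); have := lc_neq0 fm f0 (z + cs i).
  rewrite -E fE ?P0 ?horner0 ?mul0r ?eqxx //.
  have [] := H1 (z + cs i) (z + cs i) _ _ => //.
    have := normc_triB z (- cs i); rewrite opprK normc_opp.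
    by have := HB i; lra.
  by rewrite subrr normc0.
have [r2 H2] := poly_shift_bound P0 B20.
exists (ln (2 ^+ size P * 2 ^+ size Qp)), (Num.max r1 r2 + B) => z zr oz.
have key i j : ln (normc (f (z + cs i))) - ln (normc (f (z + cs j))) <=
    ln (2 ^+ size P * 2 ^+ size Qp).
  have far k : Num.max r1 r2 <= normc (z + cs k).
    have := normc_triB z (- cs k); rewrite opprK normc_opp.
    by have := HB k; lra.
  have far1 k : r1 <= normc (z + cs k) by apply: le_trans (far k); rewrite le_max lexx.
  have far2 k : r2 <= normc (z + cs k) by apply: le_trans (far k); rewrite le_max lexx orbT.
  have d k m : normc (z + cs k - (z + cs m)) <= 2 * B.
    rewrite opprD addrACA subrr add0r; apply: le_trans (normcB _ _) _.
    by have := HB k; have := HB m; lra.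
  have [q1 q2] := H1 (z + cs i) (z + cs j) (far1 i) (d j i).
  have [q3 _] := H1 (z + cs j) (z + cs i) (far1 j) (d i j).
  have [p1 p2] := H2 (z + cs j) (z + cs i) (far2 j) (d i j).
  have [p3 _] := H2 (z + cs i) (z + cs j) (far2 i) (d j i).
  have pos (x : R[i]) : x != 0 -> 0 < normc x by rewrite normc_gt0.
  rewrite !fE // !normcM !normcV -ln_div ?posrE ?divr_gt0 ?pos //.
  rewrite ler_ln ?posrE ?mulr_gt0 ?invr_gt0 ?exprn_gt0 ?pos //; last first.
    by rewrite mulr_gt0 ?invr_gt0 ?pos.
  rewrite ler_pdivrMr ?divr_gt0 ?pos // ler_pdivrMr ?pos //.
  have := ler_pM (normc_ge0 _) (normc_ge0 _) p2 q2.
  have := pos _ q1; have := pos _ q3.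
  move: (normc P.[z + cs i]) (normc Qp.[z + cs j]) (normc P.[z + cs j])
    (normc Qp.[z + cs i]) => a b c d0 b0 d0' h.
  rewrite -(ler_pM2r b0) [X in _ <= X](_ : _ = 2 ^+ size P * c * (2 ^+ size Qp * d0)) //.
  by field; rewrite gt_eqF.
by move=> i j; rewrite ler_norml key andbT lerNl opprB key.
Qed.

End Rational.

(** * Growth of solutions of the difference equation *)

Section Comparison.
Context {R : realType}.
Implicit Types (z w : R[i]).

(** Solve for the term of index l: each of the other u_j exceeds u_l in
    modulus by a factor of at most exp Q. *)
Lemma dominant_term_bound (n : nat) (a u : 'I_n -> R[i]) (l : 'I_n) (M Q : R) :
  0 <= M -> (forall j, u j != 0) -> \sum_j a j * u j = 0 ->
  (forall j, j != l -> normc (a j) <= M) ->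
  (forall i j, `|ln (normc (u i)) - ln (normc (u j))| <= Q) ->
  normc (a l) <= n%:R * (M * expR Q).
Proof.
move=> M0 u0 sum0 aM uQ.
have un j : 0 < normc (u j) by rewrite normc_gt0.
rewrite -(ler_pM2r (un l)) -normcM.
have -> : a l * u l = - \sum_(j | j != l) a j * u j.
  by apply/eqP; rewrite -addr_eq0; apply/eqP; rewrite -[RHS]sum0 [RHS](bigD1 l).
rewrite normc_opp.
have nsum (P : pred 'I_n) (F : 'I_n -> R[i]) : normc (\sum_(j | P j) F j) <= \sum_(j | P j) normc (F j).
  elim/big_rec2: _ => [|j x y _ H]; first by rewrite normc0.
  by apply: le_trans (normcD _ _) _; rewrite lerD2l.
apply: le_trans (nsum _ _) _.
have q0 : 0 <= M * expR Q * normc (u l) by rewrite !mulr_ge0 ?expR_ge0 ?normc_ge0.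
apply: (@le_trans _ _ (\sum_(j < n) M * expR Q * normc (u l))); last first.
  by rewrite sumr_const card_ord -[leRHS]mulrA mulr_natl.
rewrite big_mkcond /=; apply: ler_sum => j _; case: ifP => // jl.
rewrite normcM -mulrA ler_pM ?normc_ge0 ?aM //.
rewrite -(lnK (x := normc (u l))) ?posrE // -expRD -[leLHS]lnK ?posrE // ler_expR.
by have := uQ j l; rewrite ler_norml => /andP[_]; rewrite lerBlDr.
Qed.

Lemma near_powR_log (n : nat) (s : R) (P : R -> Prop) : 0 < s ->
  (\forall y \near (+oo%R : set_system R), P y) ->
  \forall r \near (+oo%R : set_system R), P (log_ n r `^ s).
Proof.
move=> s0 [M [_ HM]]; apply: filterS (log_pinfty n ((`|M| + 1) `^ s^-1)) => r H.
apply: HM; apply: (@lt_le_trans _ _ (`|M| + 1)).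
  by rewrite (le_lt_trans (ler_norm M)) // ltrDl.
have M1 : 0 <= `|M| + 1 by rewrite addr_ge0.
have -> : `|M| + 1 = ((`|M| + 1) `^ s^-1) `^ s.
  by rewrite -powRrM mulVf ?powRr1 // lt0r_neq0.
by apply: ge0_ler_powR (ltW H); rewrite ?nnegrE ?powR_ge0 ?(ltW s0) // (le_trans (powR_ge0 _ _) (ltW H)).
Qed.

Lemma ex_real_between (x : \bar R) (y t : R) : (x < y%:E)%E -> t < y ->
  exists2 sg : R, t <= sg < y & (x < sg%:E)%E.
Proof.
case: x => [x| |] // xy ty.
- rewrite lte_fin in xy; exists ((Num.max x t + y) / 2).
    rewrite ler_pdivlMr // ltr_pdivrMr //.
    have : Num.max x t < y by rewrite gt_max xy.
    have : t <= Num.max x t by rewrite le_max lexx orbT.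
    lra.
  rewrite lte_fin ltr_pdivlMr //.
  have : x <= Num.max x t by rewrite le_max lexx.
  lra.
- by exists t; rewrite ?lexx // ltNyr.
Qed.

Lemma characteristic_le (f : R[i] -> R[i]) (p q : nat) (sg : R) : (0 < p)%N ->
  (limf_esup (fun r : R => (log_ p (nevanlinna_T f r) / log_ q r)%:E) +oo%R < sg%:E)%E ->
  \forall r \near (+oo%R : set_system R),
    Num.max 0 (nevanlinna_T f r) <= exp_ p (sg * log_ q r).
Proof.
move=> p0 /limf_esup_lt; have := log_pinfty (R := R) q 0.
apply: filterS2 => r l0; rewrite lte_fin ltr_pdivrMr // => H.
by rewrite ge_max (ltW (exp_gt0 _ p0)) /= log_le_exp // ltW.
Qed.

Lemma annuli (B R1 R2 : R) : 1 <= B -> 8 * B < R1 < 9 * B -> 18 * B < R2 < 19 * B ->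
  [/\ B < R1, R1 <= 19 * B, B < R2 & R2 <= 19 * B].
Proof. by move=> B1 /andP[? ?] /andP[? ?]; split; lra. Qed.

Lemma add_max0_le (x y e : R) : 1 <= e -> Num.max 0 x <= e -> Num.max 0 y <= e ->
  0 <= 1 + Num.max 0 x + Num.max 0 y <= 3 * e.
Proof.
move=> e1 xe ye; rewrite !addr_ge0 ?le_max ?lexx //=.
by rewrite (_ : 3 * e = e + e + e) ?lerD //; ring.
Qed.

(** In this section p and q stand for the predecessors of the indices p and q
    of the order, so that [log_ q] is the log_(q-1) of the growth conditions.
    The case of the ordinary order is p = q = 0. *)
Section Equation.
Variables (p q k : nat) (A : 'I_k.+1 -> R[i] -> R[i]) (c : 'I_k -> R[i]).
Variables (D : set R[i]) (l : 'I_k.+1) (a b s : R) (f : R[i] -> R[i]).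
Hypothesis hD : (0 < upper_log_density [set normc z | z in D])%E.
Hypothesis hgrowth : \forall r \near (+oo%R : set_system R), forall z, D z -> normc z = r ->
  exp_ p.+1 (a * log_ q r `^ s) <= normc (A l z) /\
  forall j, j != l -> normc (A j z) <= exp_ p.+1 (b * log_ q r `^ s).
Hypotheses (fm : meromorphic f) (f0 : not_identically_zero f).
Hypothesis hsol : forall z, holomorphic_at f z ->
  (forall i, holomorphic_at f (z + c i)) ->
  \sum_(i < k) A (lift ord0 i) z * f (z + c i) + A ord0 z * f z = 0.

Local Notation T := (nevanlinna_T f).

(** The term without shift is treated as the shift by [cs ord0] = 0. The last
    clause has no T, because the quotients of shifts of a rational function
    are bounded. *)
Lemma equation_growth (tau : R) : 0 < tau -> exists C K : R, [/\ 0 < C, 0 <= K &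
  forall A0 : R, exists B r R1 R2, [/\ A0 <= B /\ 1 <= B, B <= r,
    8 * B < R1 < 9 * B /\ 18 * B < R2 < 19 * B,
    exp_ p (a * log_ q r `^ s) <= K + exp_ p (b * log_ q r `^ s) +
      C * (1 + Num.max 0 (T R1) + Num.max 0 (T R2)) `^ (1 + tau) / B &
    rational_function f ->
      exp_ p (a * log_ q r `^ s) <= K + exp_ p (b * log_ q r `^ s)]].
Proof.
move=> tau0.
pose cs (j : 'I_k.+1) := if unlift ord0 j is Some i then c i else 0.
have [C C0 HC] := good_point fm f0 cs hD tau0.
have [Q [r0 HQ]] : exists Q r0, rational_function f ->
    forall z, r0 <= normc z -> (forall j, ord f (z + cs j) = 0) ->
    forall i j, `|ln (normc (f (z + cs i))) - ln (normc (f (z + cs j)))| <= Q.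
  have [rf|nrf] := pselect (rational_function f); last by exists 0, 0.
  by have [Q [r0 H]] := rational_shift cs fm f0 rf; exists Q, r0.
have [r1 [_ Hr1]] := hgrowth.
have k0 : 0 <= ln (k.+1%:R : R) by rewrite ln_ge0 // ler1n.
exists C, (ln k.+1%:R + `|Q|); split; [by []|exact: addr_ge0|].
(* beyond A1 both the growth conditions and the bound for rational f hold *)
move=> A0; pose A1 := Num.max A0 (Num.max r0 (r1 + 1)).
have [B [z [R1 [R2 [[AB B1] Dz /andP[zB _] R12 [oz Hz]]]]]] := HC A1.
move: AB; rewrite !ge_max => /andP[A0B /andP[r0B r1B]].
exists B, (normc z), R1, R2.
have [g1 g2] := Hr1 (normc z) ltac:(lra) z Dz erefl.
have fz j : f (z + cs j) != 0.
  by have [_ ->] := ord_eq0 fm f0 (oz j); exact: lc_neq0.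
have fh j : holomorphic_at f (z + cs j) by have [] := ord_eq0 fm f0 (oz j).
have c0 : z + cs ord0 = z by rewrite /cs unlift_none addr0.
have cl i : z + cs (lift ord0 i) = z + c i by rewrite /cs liftK.
have sum0 : \sum_j A j z * f (z + cs j) = 0.
  rewrite big_ord_recl c0 addrC -[RHS](@hsol z) //; last first.
  - by move=> i; rewrite -cl; exact: fh.
  - by have := fh ord0; rewrite c0.
  by congr (_ + _); apply: eq_bigr => i _; rewrite cl.
set X := log_ q (normc z) `^ s in g1 g2 *.
have red (Q' : R) : (forall i j, `|ln (normc (f (z + cs i))) - ln (normc (f (z + cs j)))| <= Q') ->
    exp_ p (a * X) <= ln k.+1%:R + exp_ p (b * X) + Q'.
  move=> HQ'.
  have H := dominant_term_bound (ltW (exp_gt0 (b * X) (ltn0Sn p))) fz sum0 g2 HQ'.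
  have := le_trans g1 H; rewrite exp_S [exp_ p.+1 _]exp_S -expRD.
  have -> : k.+1%:R = expR (ln k.+1%:R) :> R by rewrite lnK // posrE ltr0n.
  by rewrite expRK -expRD ler_expR addrA.
split => //.
  by have := red _ Hz; have := normr_ge0 Q; lra.
move=> rf; have zr : r0 <= normc z by lra.
have := red _ (HQ rf z zr oz); have := ler_norm Q; lra.
Qed.

Hypotheses (ab : 0 <= b < a) (s0 : 0 < s).

Lemma not_rational : ~ rational_function f.
Proof.
move=> rf; have [C [K [C0 K0 H]]] := @equation_growth 1 ltr01.
have [M [_ HM]] := near_powR_log q s0 (exp_dominates0 p K ab).
have [B [r [R1 [R2 [[MB _] Br _ _ /(_ rf)]]]]] := H (M + 1).
by rewrite leNgt HM //; lra.
Qed.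

(** If T(r) <= r^sg for large r, the right-hand side of [equation_growth] is
    O(|z|^th) with th = sg (1 + tau) - 1, the -1 coming from the division by
    B. This is too small against |z|^s when sg - 1 < s and tau is small. *)
Lemma order_contradiction (sg : R) : p = 0%N -> q = 0%N -> 1 <= sg ->
  sg - 1 < s ->
  (limf_esup (fun r : R => (log_ 1 (T r) / log_ 1 r)%:E) +oo%R < sg%:E)%E -> False.
Proof.
move=> p0 q0 sg1 sgs Hs; have sg0 : 0 < sg by lra.
pose g := s - (sg - 1); have g0 : 0 < g by rewrite subr_gt0.
(* this tau leaves half of the gap g between sg - 1 and s *)
pose tau := g / (2 * sg); have tau0 : 0 < tau by rewrite divr_gt0 // mulr_gt0.
pose th := sg * (1 + tau) - 1.
have thE : th = sg - 1 + g / 2 by rewrite /th /tau; field; rewrite gt_eqF.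
have th0 : 0 <= th by rewrite thE; lra.
have ths : th < s by rewrite thE; move: g0; rewrite /g; lra.
have [C [K [C0 K0 H]]] := equation_growth tau0.
have [M [_ HM]] := characteristic_le (ltn0Sn 0) Hs.
pose K2 := C * (3 `^ (1 + tau) * 19 `^ (sg * (1 + tau))).
have K20 : 0 <= K2 by rewrite mulr_ge0 ?(ltW C0) // mulr_ge0 ?powR_ge0.
have [b0 ba] := andP ab; have ab0 : 0 < a - b by rewrite subr_gt0.
have sth : 0 < s - th by rewrite subr_gt0.
have [M2 [_ HM2]] := near_powR_log 0 sth (nbhs_pinfty_gt (num_real ((K + K2) / (a - b)))).
have [B [r [R1 [R2 [[MB B1] Br [/(annuli B1) R1B /R1B[R1a R1b R2a R2b]] + _]]]]] :=
  H (Num.max (Num.max M M2) 0 + 1).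
clear R1B.
have MB1 : M < B /\ M2 < B.
  have := MB; rewrite -lerBrDr !ge_max => /andP[/andP[]]; lra.
have B0 : 0 < B by exact: lt_le_trans B1.
have r1 : 1 <= r by exact: le_trans Br.
have r0 : 0 < r by exact: lt_le_trans r1.
have B19 : 1 <= 19 * B by rewrite mulr_ege1 // ler1n.
have tau1 : 0 <= 1 + tau by rewrite addr_ge0 // ltW.
rewrite p0 q0 /exp_ /= => E.
pose P := (19 * B) `^ sg.
have P1 : 1 <= P.
  by have := ler_powR B19 (ltW sg0); rewrite powRr0.
have TP Ri : B < Ri -> Ri <= 19 * B -> Num.max 0 (T Ri) <= P.
  move=> BR RB; have R0 := lt_trans B0 BR.
  apply: le_trans (HM Ri (lt_trans MB1.1 BR)) _.
  rewrite /exp_ /log_ /= /P (_ : expR (sg * ln Ri) = Ri `^ sg); last first.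
    by rewrite /powR gt_eqF.
  by apply: ge0_ler_powR RB; rewrite ?nnegrE ?(ltW sg0) ?(ltW R0) // (le_trans _ B19).
have /andP[m0 m3] := add_max0_le P1 (TP R1 R1a R1b) (TP R2 R2a R2b).
have P3 : 0 <= 3 * P by exact: le_trans m3.
have Tm : (1 + Num.max 0 (T R1) + Num.max 0 (T R2)) `^ (1 + tau) <=
    3 `^ (1 + tau) * (19 `^ (sg * (1 + tau)) * B `^ (th + 1)).
  apply: (@le_trans _ _ ((3 * P) `^ (1 + tau))).
    exact: ge0_ler_powR m3.
  rewrite powRM // ?(le_trans ler01) //.
  rewrite /P -powRrM powRM // ?(ltW B0) //.
  by rewrite /th subrK.
have Qb : C * (1 + Num.max 0 (T R1) + Num.max 0 (T R2)) `^ (1 + tau) / B <= K2 * r `^ th.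
  apply: (@le_trans _ _ (K2 * B `^ th)); last first.
    by rewrite ler_wpM2l // ge0_ler_powR ?nnegrE // ltW.
  rewrite ler_pdivrMr //.
  have -> : K2 * B `^ th * B = C * (3 `^ (1 + tau) * (19 `^ (sg * (1 + tau)) * B `^ (th + 1))).
    have -> : B `^ (th + 1) = B `^ th * B.
      by rewrite powRD ?powRr1 ?(ltW B0) // (gt_eqF B0) implybT.
    by rewrite /K2; ring.
  by rewrite ler_wpM2l // ltW.
have rth : 1 <= r `^ th by have := ler_powR r1 th0; rewrite powRr0.
have rs : r `^ s = r `^ (s - th) * r `^ th.
  by rewrite -powRD ?subrK // (gt_eqF r0) implybT.
have big : (K + K2) / (a - b) < r `^ (s - th) by apply: HM2; exact: lt_le_trans MB1.2 Br.
rewrite ltr_pdivrMr // in big.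
have : (a - b) * r `^ s <= (K + K2) * r `^ th.
  have : K <= K * r `^ th by rewrite ler_peMr.
  by move: E Qb; lra.
rewrite rs mulrA ler_pM2r; last by rewrite powR_gt0.
by move: big; rewrite mulrC; lra.
Qed.

(** The positive part of T is at most exp_p (a X / 4), with X = (log_q |z|)^s,
    even at the radius 19 |z|, and the square of this bound is negligible
    against exp_p (a X). *)
Lemma pq_order_contradiction (sg : R) : (0 < p)%N -> (0 < q)%N -> 0 < sg -> sg < s ->
  (limf_esup (fun r : R => (log_ p.+1 (T r) / log_ q.+1 r)%:E) +oo%R < sg%:E)%E -> False.
Proof.
move=> p0 q0 sg0 sgs Hs.
have [C [K [C0 K0 H]]] := @equation_growth 1 ltr01.
have [M [_ HM]] := characteristic_le (ltn0Sn p) Hs.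
have [b0 ba] := andP ab; have a0 : 0 < a by exact: le_lt_trans ba.
(* exp_p (b X) and the square of exp_p (a X / 4) are at most exp_p (be X) *)
pose be := Num.max b (a / 2).
have be0 : 0 <= be < a.
  rewrite le_max b0 /= gt_max ba /= ltr_pdivrMr // ltr_pMr // ltr1n //.
have KC : 0 <= K + 1 + 9 * C by lra.
have ssg : 0 < s - sg by rewrite subr_gt0.
have [M1 [_ HM1]] := near_powR_log q s0 (exp_dominates p0 KC be0).
have [M2 [_ HM2]] := near_powR_log q ssg (nbhs_pinfty_gt (num_real (2 `^ sg / (a / 4)))).
have [M3 [_ HM3]] := near_powR_log q s0 (nbhs_pinfty_gt (num_real (a / 4)^-1)).
have [q' qE] : exists q', q = q'.+1 by exists q.-1; rewrite prednK.
have [M4 [_ HM4]] := @log_scale R q' 19 (ler1n _ 19).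
have [M5 [_ HM5]] := @log_pinfty R q 1.
pose MM := Num.max M (Num.max M1 (Num.max M2 (Num.max M3 (Num.max M4 M5)))).
have [B [r [R1 [R2 [[MB B1] Br [/(annuli B1) R1B /R1B[R1a R1b R2a R2b]] + _]]]]] := H (MM + 1).
clear R1B.
have : MM < B by rewrite (lt_le_trans _ MB) // ltrDl.
rewrite /MM !gt_max => /andP[b_ /andP[b_1 /andP[b_2 /andP[b_3 /andP[b_4 b_5]]]]].
have B0 : 0 < B by exact: lt_le_trans B1.
have dom := HM1 r (lt_le_trans b_1 Br).
have h2 := HM2 r (lt_le_trans b_2 Br); have h3 := HM3 r (lt_le_trans b_3 Br).
have h4 := HM4 r (lt_le_trans b_4 Br); have h5 := HM5 r (lt_le_trans b_5 Br).
have B19 : 19 * B <= 19 * r by rewrite ler_pM2l.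
set x := log_ q r in dom h2 h3 h5 *; set X := x `^ s in dom h3 *.
have x0 : 0 < x by exact: lt_trans h5.
move=> E.
pose Ee := exp_ p (a / 4 * X).
have aX : 1 <= a / 4 * X.
  by rewrite mulrC -ler_pdivrMr ?divr_gt0 // mul1r ltW.
have E2 : 2 <= Ee by exact: exp_ge2.
have TE Ri : B < Ri -> Ri <= 19 * B -> Num.max 0 (T Ri) <= Ee.
  move=> BR RB; have {}RB := le_trans RB B19.
  apply: le_trans (HM Ri (lt_trans b_ BR)) _; rewrite exp_Sr; apply: ler_exp_.
  have lR : log_ q.+1 Ri <= ln (2 * x).
    rewrite log_S; apply: ler_ln1; last first.
      by rewrite (le_trans (ltW h5)) // ler_peMl ?ler1n // ltW.
    by have := h4 Ri RB; rewrite -qE.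
  apply: (@le_trans _ _ ((2 * x) `^ sg)).
    rewrite /powR gt_eqF ?mulr_gt0 // ler_expR ler_wpM2l // ltW //.
  rewrite powRM ?(ltW x0) //.
  have -> : X = x `^ (s - sg) * x `^ sg.
    by rewrite /X -powRD ?subrK // (gt_eqF x0) implybT.
  rewrite mulrA ler_wpM2r ?powR_ge0 //.
  by rewrite mulrC -ler_pdivrMr ?divr_gt0 // ltW.
have E1 : 1 <= Ee by rewrite (le_trans _ E2) // ler1n.
have /andP[m0 m3] := add_max0_le E1 (TE R1 R1a R1b) (TE R2 R2a R2b).
have Tm : (1 + Num.max 0 (T R1) + Num.max 0 (T R2)) `^ (1 + 1) <= 9 * exp_ p (be * X).
  rewrite -[1 + 1]/(2%:R) powR_mulrn //.
  apply: (@le_trans _ _ ((3 * Ee) ^+ 2)).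
    by rewrite lerXn2r // nnegrE (le_trans m0).
  rewrite exprMn (_ : 3 ^+ 2 = 9); last by ring.
  rewrite ler_wpM2l //; apply: le_trans (exp_sqr p0 aX) _; apply: ler_exp_.
  rewrite mulrA ler_wpM2r ?powR_ge0 // le_max; apply/orP; right.
  by rewrite (_ : 2 * (a / 4) = a / 2) //; field.
have Eb : exp_ p (b * X) <= exp_ p (be * X).
  by apply: ler_exp_; rewrite ler_wpM2r ?powR_ge0 // le_max lexx.
have Q : C * (1 + Num.max 0 (T R1) + Num.max 0 (T R2)) `^ (1 + 1) / B <= 9 * C * exp_ p (be * X).
  rewrite ler_pdivrMr //.
  apply: (@le_trans _ _ (C * (9 * exp_ p (be * X)))); first by rewrite ler_wpM2l // ltW.
  rewrite (_ : C * _ = 9 * C * exp_ p (be * X)); last by ring.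
  rewrite ler_peMr // mulr_ge0 ?mulr_ge0 ?(ltW C0) // ltW //; exact: exp_gt0.
have e0 := exp_gt0 (be * X) p0.
move: dom E Eb Q e0; rewrite -/X; move: (exp_ p (be * X)) (exp_ p (a * X)) (exp_ p (b * X)) => u v w.
have := K0; have := C0.
by move: (_ / B) => y; nra.
Qed.

End Equation.

Lemma bigmax_pq_order_le (n : nat) (F : 'I_n -> \bar R) (rho : R) (l : 'I_n) :
  (\big[Order.max/-oo]_(j < n) F j <= rho%:E)%E -> (F l <= rho%:E)%E.
Proof. by apply: le_trans; exact: le_bigmax. Qed.

End Comparison.

Theorem theorem17 (R : realType) (p q : nat)
  (hpq : (1 <= q <= p)%N \/ (2 <= q)%N /\ q = p.+1)
  (k : nat) (hk : (2 <= k)%N)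
  (A : 'I_k.+1 -> R[i] -> R[i]) (c : 'I_k -> R[i])
  (hA0 : forall j, not_identically_zero (A j))
  (hc0 : forall i, c i != 0) (hc : injective c)
  (D : set R[i])
  (hD : (0 < upper_log_density [set normc z | z in D])%E)
  (hA : forall j, entire (A j))
  (rho : R)
  (hrho : (\big[Order.max/-oo]_(j < k.+1) pq_order p q (A j) <= rho%:E)%E)
  (l : 'I_k.+1)
  (hgrowth : forall eta : R, 0 < eta ->
    exists a b delta : R,
      [/\ 0 <= b < a, 0 < delta < rho, delta < eta &
        \forall r \near +oo, forall z, D z -> normc z = r ->
          exp_ p (a * log_ q.-1 r `^ (rho - delta)) <= normc (A l z) /\
          forall j, j != l ->
            normc (A j z) <= exp_ p (b * log_ q.-1 r `^ (rho - delta))])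
  (f : R[i] -> R[i]) (hf : meromorphic f) (hf0 : not_identically_zero f)
  (hsol : forall z, holomorphic_at f z ->
    (forall i, holomorphic_at f (z + c i)) ->
    \sum_(i < k) A (lift ord0 i) z * f (z + c i) + A ord0 z * f z = 0) :
  (p = 1%N -> q = 1%N ->
     (pq_order 1 1 (A l) + 1 <= pq_order 1 1 f)%E) /\
  ((2 <= q <= p)%N -> (pq_order p q (A l) <= pq_order p q f)%E).
Proof.
have Al : (pq_order p q (A l) <= rho%:E)%E := bigmax_pq_order_le l hrho.
have pq_f sg : (pq_order p q f < sg)%E -> ~ rational_function f ->
    (limf_esup (fun r : R => (log_ p (nevanlinna_T f r) / log_ q r)%:E) +oo%R < sg)%E.
  by move=> + nr; rewrite /pq_order asboolF.
have rho0 : 0 < rho.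
  have [a [b [delta [_ /andP[d0 dr] _ _]]]] := hgrowth 1 ltr01.
  exact: lt_trans dr.
split=> [p1 q1|/andP[q2 qp]].
- rewrite leNgt; apply/negP; rewrite p1 q1 in Al pq_f hgrowth => lt_f.
  have lt_f1 : (pq_order 1 1 f < (rho + 1)%:E)%E.
    by apply: lt_le_trans lt_f _; rewrite EFinD leeD2r.
  have rho1 : 1 < rho + 1 by rewrite ltrDr.
  have [sg /andP[sg1 sgr] sgf] := ex_real_between lt_f1 rho1.
  have e0 : 0 < rho + 1 - sg by rewrite subr_gt0.
  (* such a delta makes rho - delta exceed sg - 1 *)
  have [a [b [delta [ab /andP[_ dr] de Hg]]]] := hgrowth _ e0.
  have s0 : 0 < rho - delta by rewrite subr_gt0.
  have nr := @not_rational R 0 0 k A c D l a b _ f hD Hg hf hf0 hsol ab s0.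
  have sgs : sg - 1 < rho - delta by lra.
  exact: (@order_contradiction R 0 0 k A c D l a b _ f hD Hg hf hf0 hsol ab
    sg erefl erefl sg1 sgs (pq_f _ sgf nr)).
rewrite leNgt; apply/negP => lt_f.
have lt_f1 : (pq_order p q f < rho%:E)%E by exact: lt_le_trans lt_f Al.
case: p hpq hrho hgrowth Al pq_f lt_f lt_f1 q2 qp => [|p] _ _ hg _ pq_f _ lt_f1 q2 qp.
  by move: q2 qp; case: (q) => // [[|]].
case: q hg pq_f lt_f1 q2 qp => [|q] // hg pq_f lt_f1 q2 qp.
have p0 : (0 < p)%N by exact: (leq_trans q2 qp).
have rho2 : rho / 2 < rho by rewrite ltr_pdivrMr // ltr_pMr // ltr1n.
have [sg /andP[sg1 sgr] sgf] := ex_real_between lt_f1 rho2.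
have e0 : 0 < rho - sg by rewrite subr_gt0.
(* such a delta makes rho - delta exceed sg *)
have [a [b [delta [ab /andP[_ dr] de Hg]]]] := hg _ e0.
have s0 : 0 < rho - delta by rewrite subr_gt0.
have nr := @not_rational R p q k A c D l a b _ f hD Hg hf hf0 hsol ab s0.
have sgs : sg < rho - delta by lra.
have sg0 : 0 < sg by apply: lt_le_trans sg1; rewrite divr_gt0.
exact: (@pq_order_contradiction R p q k A c D l a b _ f hD Hg hf hf0 hsol ab s0
  sg p0 q2 sg0 sgs (pq_f _ sgf nr)).
Qed.
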